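(* Let $m\ge 0$ be an integer, $\mathbf x=(x_1,\dots,x_{m+1})$, $\mathbf y=(y_1,\dots,y_{m+1})$, and put $\mathbf x'=(x_1,\dots,x_m)$, $\mathbf y'=(y_1,\dots,y_m)$. Then \[ Z_{\mathrm{HT}}(2m+1;\mathbf x,\mathbf y)=\frac{a\,x_{m+1}y_{m+1}}{\sigma(a)\,(a x_{m+1}+y_{m+1})(a y_{m+1}+x_{m+1})}\Big[Z(m+1;\mathbf x,\mathbf y)\,Z^{(2)}_{\mathrm{HT}}(2m;\mathbf x',\mathbf y')+Z(m;\mathbf x',\mathbf y')\,Z^{(2)}_{\mathrm{HT}}(2m+2;\mathbf x,\mathbf y)\Big]. \]
   Context: Notation: $\bar z=z^{-1}$, $\sigma(z)=z-z^{-1}$; $a$ is a fixed (generic) nonzero complex parameter. Vertex weights: at a vertex where a horizontal and a vertical line cross, the four incident edges are oriented with exactly two pointing into the vertex (ice rule). The vertex is of type 1 if both horizontal edges point into it and both vertical edges point out; type 2 if both horizontal edges point out and both vertical edges point in; type 3 if both horizontal edges point right and both vertical edges point up; type 4 if horizontal edges point left and vertical edges point down; type 5 if horizontal edges point left and vertical edges point up; type 6 if horizontal edges point right and vertical edges point down. A vertex with spectral parameter $z$ has weight $\sigma(a^2)$ (types 1,2), $\sigma(az)$ (types 3,4), $\sigma(a\bar z)$ (types 5,6). A state is an orientation of all internal edges obeying the ice rule at every vertex, its weight is the product of its vertex weights, and the partition function is the sum of weights of all states. Domain-wall model: $Z(n;\mathbf x,\mathbf y)$, $\mathbf x=(x_1,\dots,x_n)$,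 $\mathbf y=(y_1,\dots,y_n)$, is the partition function on the $n\times n$ grid of vertices $(i,j)$ (row $i$ from the top, column $j$ from the left), vertex $(i,j)$ having spectral parameter $x_i\bar y_j$; horizontal boundary edges (left of column 1, right of column $n$) point into the grid, vertical boundary edges (above row 1, below row $n$) point out of the grid. $Z(0)=1$. Even half-turn model: for $\mathbf x=(x_1,\dots,x_m)$, $\mathbf y=(y_1,\dots,y_m)$, $Z_{\mathrm{HT}}(2m;\mathbf x,\mathbf y)$ is the partition function on the grid of vertices $(r,j)$, $1\le r\le 2m$ (from the top), $1\le j\le m$; vertex $(r,j)$ has spectral parameter $x_{i(r)}\bar y_j$ with $i(r)=\min(r,2m+1-r)$; left boundary edges point right (into the grid), top boundary edges point up, bottom boundary edges point down; for each $r\le m$ the edge to the right of vertex $(r,m)$ and the edge to the right of vertex $(2m+1-r,m)$ are one single edge (a U-turn) with one orientation (pointing out of one of these two vertices and into the other). $Z_{\mathrm{HT}}(0)=1$. Define $Z^{(2)}_{\mathrm{HT}}(2m;\mathbf x,\mathbf y)=Z_{\mathrm{HT}}(2m;\mathbf x,\mathbf y)/Z(m;\mathbf x,\mathbf y)$ (so $Z^{(2)}_{\mathrm{HT}}(0)=1$). Odd half-turn model: for $\mathbf x=(x_1,\dots,x_{m+1})$, $\mathbf y=(y_1,\dots,y_{m+1})$, $Z_{\mathrm{HT}}(2m+1;\mathbf x,\mathbf y)$ is the partition function on the vertex set $\{(r,j):1\le r\le 2m+1,\,1\le j\le m\}\cup\{(r,m+1): m+2\le r\le 2m+1\}$ (rows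 from the top, columns from the left), vertex $(r,j)$ having spectral parameter $x_{i(r)}\bar y_j$ with $i(r)=\min(r,2m+2-r)$. Edges join consecutive vertices in each row and in each column. Boundary: the left boundary edge of each row points right (into the grid), the top boundary edges of columns $1,\dots,m$ point up, the bottom boundary edges of columns $1,\dots,m+1$ (below row $2m+1$) point down. The edge to the right of $(m+1,m)$ and the edge above $(m+2,m+1)$ form one single edge (the middle line of parameter $x_{m+1}$ turns into the vertical line of parameter $y_{m+1}$), pointing right out of $(m+1,m)$ iff pointing down into $(m+2,m+1)$ (for $m=0$ there are no vertices and $Z_{\mathrm{HT}}(1)=1$). For each $r\le m$, the edge to the right of $(r,m)$ and the edge to the right of $(2m+2-r,m+1)$ are one single edge with one orientation (out of one of these vertices, into the other). States of this model are in bijection with the $(2m+1)\times(2m+1)$ half-turn symmetric alternating-sign matrices. *)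

(* Defs.v *)
From mathcomp Require Import all_boot all_algebra.
Set Implicit Arguments. Unset Strict Implicit. Unset Printing Implicit Defensive.
Import GRing.Theory.
Local Open Scope ring_scope.

Section SixVertex.
Variable K : fieldType.

Definition sigma (z : K) : K := z - z^-1.

(* Weight of a vertex with spectral parameter z.  The four incident edges are
   described by booleans:
     l = the edge to the LEFT of the vertex points right,
     r = the edge to the RIGHT of the vertex points right,
     t = the edge ABOVE the vertex points up,
     b = the edge BELOW the vertex points up.
   Configurations violating the ice rule get weight 0. *)
Definition vweight (a z : K) (l r t b : bool) : K :=
  match l, r, t, b with
  | true,  false, true,  false => sigma (a ^+ 2)
  | false, true,  false, true  => sigma (a ^+ 2)
  | true,  true,  true,  true  => sigma (a * z)
  | false, false, false, false => sigma (a * z)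
  | false, false, true,  true  => sigma (a * z^-1)
  | true,  true,  false, false => sigma (a * z^-1)
  | _, _, _, _ => 0
  end.

(* Edge variables on an R x C grid of vertex positions (0-indexed):
   h (i,j), j <= C : the horizontal edge to the left of position (i,j)
                     (j = C: right of position (i,C-1)); true = points right;
   v (i,j), i <= R : the vertical edge above position (i,j)
                     (i = R: below position (R-1,j)); true = points up.
   Accessors by natural-number indices (out of range: false, never used). *)
Definition hget R C (h : {ffun 'I_R * 'I_C.+1 -> bool}) (i j : nat) : bool :=
  match (insub i : option 'I_R), (insub j : option 'I_C.+1) with
  | Some i', Some j' => h (i', j')
  | _, _ => false
  end.

Definition vget R C (v : {ffun 'I_R.+1 * 'I_C -> bool}) (i j : nat) : bool :=
  match (insub i : option 'I_R.+1), (insub j : option 'I_C) with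
  | Some i', Some j' => v (i', j')
  | _, _ => false
  end.

(* Generic partition function: sum over all orientations of all edge
   positions satisfying the constraints [constr] (which fix boundary edges,
   identify the two ends of U-turn edges, and fix unused positions), of the
   product of the weights of the vertices at the positions (i,j) with
   [present i j]. *)
Definition gridPF (a : K) (R C : nat) (present : nat -> nat -> bool)
  (spec : nat -> nat -> K)
  (constr : (nat -> nat -> bool) -> (nat -> nat -> bool) -> bool) : K :=
  \sum_(h : {ffun 'I_R * 'I_C.+1 -> bool})
   \sum_(v : {ffun 'I_R.+1 * 'I_C -> bool})
     (if constr (hget h) (vget v) then
        \prod_(i < R) \prod_(j < C | present i j)
          vweight a (spec i j) (hget h i j) (hget h i j.+1)
                               (vget v i j) (vget v i.+1 j)
      else 0).

(* Spectral parameters are given as functions nat -> K, used 1-indexed: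
   x_1, ..., x_n are x 1, ..., x n (x 0 is never used). *)

(* Domain-wall partition function Z(n; x, y). Vertex at 0-indexed position
   (i,j) is vertex (i+1, j+1) of the paper, parameter x_{i+1} / y_{j+1}. *)
Definition Zdw (a : K) (n : nat) (x y : nat -> K) : K :=
  gridPF a n n (fun _ _ => true) (fun i j => x i.+1 / y j.+1)
    (fun h v =>
       [forall i : 'I_n, h i 0%N && ~~ h i n] &&
       [forall j : 'I_n, v 0%N j && ~~ v n j]).

(* Even half-turn partition function Z_HT(2m; x, y): 2m rows, m columns.
   1-indexed row r = i+1 has parameter x_{min(r, 2m+1-r)}.
   U-turn: right edge of row r (0-idx i < m) and right edge of row 2m+1-r
   (0-idx 2m-1-i) form one edge, out of one vertex and into the other, i.e.
   the two "points right" values differ. *)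
Definition ZHTeven (a : K) (m : nat) (x y : nat -> K) : K :=
  gridPF a m.*2 m (fun _ _ => true)
    (fun i j => x (minn i.+1 (m.*2 - i)) / y j.+1)
    (fun h v =>
       [forall i : 'I_m.*2, h i 0%N] &&
       [forall j : 'I_m, v 0%N j && ~~ v m.*2 j] &&
       [forall i : 'I_m, h i m != h (m.*2.-1 - i)%N m]).

(* Odd half-turn partition function Z_HT(2m+1; x, y): positions on a
   (2m+1) x (m+1) grid; the position (i,j) (0-indexed) carries a vertex iff
   j < m or i >= m+1.  1-indexed row r = i+1 has parameter x_{min(r,2m+2-r)}.
   Edge positions that are not edges of the model (right of the absent
   positions in rows 0..m of column m, and above/below absent positions of
   column m) are fixed to false. *)
Definition ZHTodd (a : K) (m : nat) (x y : nat -> K) : K :=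
  gridPF a m.*2.+1 m.+1 (fun i j => (j < m)%N || (m.+1 <= i)%N)
    (fun i j => x (minn i.+1 (m.*2.+1 - i)) / y j.+1)
    (fun h v =>
       [forall i : 'I_m.*2.+1, h i 0%N] &&
       [forall j : 'I_m, v 0%N j] &&
       [forall j : 'I_m.+1, ~~ v m.*2.+1 j] &&
       [forall i : 'I_m.+1, ~~ h i m.+1] &&
       [forall i : 'I_m.+1, ~~ v i m] &&
       (* the middle line turns into column m+1: pointing right out of
          (m+1,m) iff pointing down into (m+2,m+1) *)
       (h m m != v m.+1 m) &&
       (* U-turns: right edge of (r,m) and right edge of (2m+2-r,m+1) *)
       [forall i : 'I_m, h i m != h (m.*2 - i)%N m.+1]).

Definition ZHT2 (a : K) (m : nat) (x y : nat -> K) : K :=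
  ZHTeven a m x y / Zdw a m x y.

End SixVertex.

(* Main.v *)
(** The grids are cut into rows, and a row acts on the vertical edges crossing it
by two operators, one for each direction of its right edge. These operators
satisfy the Yang-Baxter exchange relations, which make lines exchangeable and
let a turned line slide through other rows.

Write O(x,u) for the odd half-turn model whose centre row of parameter x turns
into the column of parameter u, and G(v,u) for the even half-turn model whose
last column has parameter v in the upper half and u in the lower half. A vertex
of parameter a^{-1} or a splits its two lines into corners. Hence O at
x = a^{+-1} y_j is, up to an explicit factor, a G with one column and one row
parameter fewer; G at x_1 = a^{+-1} v is a smaller O; O at x = a^{+-1} u is an
even model; and the domain-wall and even models have similar recursions.

With Z the domain-wall and E the even partition functions (primed when the line
x and the column u are removed), both
  sigma(a) (a x + u) (a u + x) O Z' Z = a x u (Z^2 E' + Z'^2 E)  and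
  (u + v) sigma(a) G(v,u) Z(u) Z(v) = (a u - v/a) (Z(u)^2 E(v) + Z(v)^2 E(u))
are identities between Laurent polynomials, in x and in v respectively, that
agree at the 4k points +-a^{+-1} w, where w runs over the k column parameters
for the first and the k row parameters for the second. Sign symmetries lower
the degrees just enough for 4k points to suffice, so that the two identities
follow from each other by induction on the size, for generic parameters and
then, by density along x_i + t^i and y_j + t^j, for all. *)
Require Import Defs.
From mathcomp Require Import all_boot all_order all_algebra.
From mathcomp Require Import ring zify.
Set Implicit Arguments. Unset Strict Implicit. Unset Printing Implicit Defensive.
Import Order.TTheory GRing.Theory Num.Theory.
Local Open Scope ring_scope.

(** Whether [E / Z] is a Laurent polynomial is never asked: both identities are multiplied by
    domain-wall functions, and division occurs only at the very end. The obstacle is that the first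
    identity is not closed under its recursions. At x = a^{+-1} y_j the vertex on the column y_j
    splits, and one half of that column is glued to the column u; two halves with different
    parameters cannot be avoided, which is the origin of G. The prefactors are forced. The two
    directions of the right end of the centre row contribute to O with opposite parities in x, so O
    at x = -u/a and x = -a u is out of reach of the recursions; there (a x + u)(a u + x) vanishes,
    and the bracket cancels because E is odd in x and Z^2 is even. The value at x = u/a fixes the
    factor sigma(a), by sigma(a^2) = sigma(a)(a + 1/a). The factors u + v and a u - v/a come from
    sigma(a u / x) = (a u - x)(a u + x)/(a x u) at x = v/a. The recursions use only exchange
    relations and two eigenvector equations, so they are stated for arbitrary row operators [U] and
    apply again after a column has been appended. *)

Lemma lincomb (R : comNzRingType) (g g' c1 l1 r1 c2 l2 r2 c3 l3 r3 c4 l4 r4 : R) :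
  l1 = r1 -> l2 = r2 -> l3 = r3 -> l4 = r4 ->
  g - g' = c1 * (l1 - r1) + c2 * (l2 - r2) + c3 * (l3 - r3) + c4 * (l4 - r4) ->
  g = g'.
Proof.
by move=> -> -> -> -> e; apply: subr0_eq; rewrite e !subrr !mulr0 !addr0.
Qed.

(* [ring] uses no hypotheses; an identity that holds modulo up to four equations is proved by
   supplying its coefficients on them. *)
Tactic Notation "lincomb" constr(c1) constr(H1) :=
  apply: (@lincomb _ _ _ c1 _ _ 0 0 0 0 0 0 0 0 0 H1 erefl erefl erefl); ring.
Tactic Notation "lincomb" constr(c1) constr(H1) constr(c2) constr(H2) :=
  apply: (@lincomb _ _ _ c1 _ _ c2 _ _ 0 0 0 0 0 0 H1 H2 erefl erefl); ring.
Tactic Notation "lincomb" constr(c1) constr(H1) constr(c2) constr(H2)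
    constr(c3) constr(H3) :=
  apply: (@lincomb _ _ _ c1 _ _ c2 _ _ c3 _ _ 0 0 0 H1 H2 H3 erefl); ring.
Tactic Notation "lincomb" constr(c1) constr(H1) constr(c2) constr(H2)
    constr(c3) constr(H3) constr(c4) constr(H4) :=
  apply: (@lincomb _ _ _ c1 _ _ c2 _ _ c3 _ _ c4 _ _ H1 H2 H3 H4); ring.

(** * Row operators and exchange relations *)

Section RowOperators.
Variables (K : fieldType) (a : K).
Hypothesis a_neq0 : a != 0.
Notation s := (sigma (a ^+ 2)).
Notation sg := (@sigma K).

(* Appends one column to a row with operators [A] (right edge pointing right) and [B]
   (left); [r] is the direction of the new right edge. Blocks are indexed by the edges
   above (rows) and below (columns) the new vertex, "up" coming first. *)
Definition add_col d (z : K) (A B : 'M[K]_d) (r : bool) : 'M[K]_(d + d) :=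
  if r then block_mx (sg (a * z) *: A) 0 (s *: B) (sg (a / z) *: A)
  else block_mx (sg (a / z) *: B) (s *: A) 0 (sg (a * z) *: B).

(* The factor [r0] is kept on the left so that the relations hold even where it vanishes. *)
Definition exchange d (x x' : K) (A B A' B' : 'M[K]_d) :=
  let r0 := sg (a ^+ 2 * x' / x) in let t := sg (x / x') in
  [/\ r0 *: (A *m A') = r0 *: (A' *m A),
      r0 *: (B *m B') = r0 *: (B' *m B),
      r0 *: (B *m A') = t *: (A' *m B) + s *: (B' *m A) &
      r0 *: (A *m B') = s *: (A' *m B) + t *: (B' *m A)].

(** In [exchange], the scalars [r0], [t] and [s] are the three weights of a vertex of parameter
    [a * x' / x], the crossing of the lines [x] and [x']. The next three identities are the scalar
    content of the Yang-Baxter equation for the lines [x], [x'] and [y]. *)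
Lemma ybe1 x x' y : x != 0 -> x' != 0 -> y != 0 ->
  sg (a * (x' / y)) * sg (x / x') + sg (a / (x / y)) * s =
  sg (a ^+ 2 * x' / x) * sg (a / (x' / y)).
Proof. by move=> x0 x'0 y0; rewrite /sigma; field; rewrite a_neq0 x0 x'0 y0. Qed.
Lemma ybe2 x x' y : x != 0 -> x' != 0 -> y != 0 ->
  sg (a * (x' / y)) * s + sg (a / (x / y)) * sg (x / x') =
  sg (a ^+ 2 * x' / x) * sg (a * (x / y)).
Proof. by move=> x0 x'0 y0; rewrite /sigma; field; rewrite a_neq0 x0 x'0 y0. Qed.
Lemma ybe3 x x' y : x != 0 -> x' != 0 -> y != 0 ->
  sg (a * (x / y)) * sg (a / (x' / y)) =
  sg (a * (x' / y)) * sg (a / (x / y)) + sg (x / x') * s.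
Proof. by move=> x0 x'0 y0; rewrite /sigma; field; rewrite a_neq0 x0 x'0 y0. Qed.

Lemma block_mx_congr (R : Type) m n p q (A A' : 'M[R]_(m, p)) (B B' : 'M[R]_(m, q))
    (C C' : 'M[R]_(n, p)) (D D' : 'M[R]_(n, q)) :
  A = A' -> B = B' -> C = C' -> D = D' -> block_mx A B C D = block_mx A' B' C' D'.
Proof. by move=> -> -> -> ->. Qed.

Lemma exchange_add_col d (x x' y : K) (A B A' B' : 'M[K]_d) :
  x != 0 -> x' != 0 -> y != 0 -> exchange x x' A B A' B' ->
  exchange x x' (add_col (x / y) A B true) (add_col (x / y) A B false)
    (add_col (x' / y) A' B' true) (add_col (x' / y) A' B' false).
Proof.
move=> x0 x'0 y0; rewrite /exchange /add_col.
move: (ybe1 x0 x'0 y0) (ybe2 x0 x'0 y0) (ybe3 x0 x'0 y0).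
move: (sg (a ^+ 2 * _ / _)) (sg (x / x')) (sg (a * (x / y))) (sg (a / (x / y))).
move: (sg (a * (x' / y))) (sg (a / (x' / y))) s.
move=> p' q' s r0 t p q e1 e2 e3 [hAA hBB hBA hAB].
rewrite !mulmx_block !(mulmx0, mul0mx, addr0, add0r) -!(scalemxAl, scalemxAr).
rewrite !(scale_block_mx, add_block_mx, scaler0, addr0).
move: hAA hBB hBA hAB.
move: (A *m A') (A' *m A) (B *m B') (B' *m B) (B *m A') (A' *m B) (B' *m A) (A *m B').
move=> AA AA' BB BB' BA ab ba AB hAA hBB hBA hAB.
have E (M N : 'M[K]_d) i j : M = N -> M i j = N i j by move->.
split; apply: block_mx_congr; rewrite ?scaler0 ?add0r //; apply/matrixP => i j;
  move: (E _ _ i j hAA) (E _ _ i j hBB) (E _ _ i j hBA) (E _ _ i j hAB); rewrite !mxE;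
  clear hAA hBB hBA hAB E;
  move: (AA i j) (AA' i j) (BB i j) (BB' i j) (BA i j) (ab i j) (ba i j) (AB i j);
  move=> {}AA {}AA' {}BB {}BB' {}BA {}ab {}ba {}AB hAA hBB hBA hAB.
(* Four relations of four blocks each; the two blocks reading 0 = 0 are already closed. The matrix
   products have become scalars, so every other block is a combination of the old relations and of
   [e1], [e2], [e3]. *)
- lincomb (p * p') hAA.
- lincomb (s * p') hBA (q * s) hAB (s * ab) e1 (s * ba) e2.
- lincomb (q * q') hAA.
- lincomb (q * q') hBB.
- lincomb (q * s) hBA (s * p') hAB (s * ab) e2 (s * ba) e1.
- lincomb (p * p') hBB.
- lincomb (q * p') hBA (s * s) hAB (- s * ba) e3.
- lincomb (s * q') hAA (- s * AA') e1.
- lincomb (p * s) hBB (- s * BB') e2.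
- lincomb (p * q') hBA (s * ba) e3.
- lincomb (p * q') hAB (s * ab) e3.
- lincomb (p * s) hAA (- s * AA') e2.
- lincomb (s * q') hBB (- s * BB') e1.
- lincomb (s * s) hBA (q * p') hAB (- s * ab) e3.
Qed.
End RowOperators.

(** This is 2^n, computed by sums so that the types of block matrices are convertible. *)
Fixpoint spin_dim n := if n is n'.+1 then (spin_dim n' + spin_dim n')%N else 1%N.

Section Nest.
Variables (K : fieldType) (a : K).
Hypothesis a_neq0 : a != 0.
Notation sg := (@sigma K).
Implicit Types (y : nat -> K) (x v : K) (xs : seq K).

Definition with_column d (U : K -> bool -> 'M[K]_d) v x r : 'M[K]_(d + d) :=
  add_col a (x / v) (U x true) (U x false) r.

(** The empty row hands the left boundary edge, which points right, on to its right end: the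
    identity for [r = true] and 0 otherwise. *)
Fixpoint row_op y n x r : 'M[K]_(spin_dim n) :=
  if n is n'.+1 return 'M[K]_(spin_dim n) then with_column (row_op y n') (y n'.+1) x r
  else if r then 1%:M else 0.

Fixpoint upv n : 'rV[K]_(spin_dim n) :=
  if n is n'.+1 return 'rV[K]_(spin_dim n) then row_mx (upv n') 0 else 1%:M.
Fixpoint dnv n : 'cV[K]_(spin_dim n) :=
  if n is n'.+1 return 'cV[K]_(spin_dim n) then col_mx 0 (dnv n') else 1%:M.

Definition exch d (U : K -> bool -> 'M[K]_d) x x' :=
  exchange a x x' (U x true) (U x false) (U x' true) (U x' false).

Lemma exch_with_col d (U : K -> bool -> 'M[K]_d) v x x' :
  x != 0 -> x' != 0 -> v != 0 -> exch U x x' -> exch (with_column U v) x x'.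
Proof. by move=> x0 x'0 v0 h; apply: exchange_add_col. Qed.

Lemma exch_row_op y n x x' :
  (forall j, (0 < j <= n)%N -> y j != 0) -> x != 0 -> x' != 0 -> exch (row_op y n) x x'.
Proof.
move=> + x0 x'0; elim: n => [|n IHn] y0.
  rewrite /exch /exchange /= mulmx1 !mulmx0 !mul0mx !scaler0 addr0.
  by split.
apply: exch_with_col => //; first by apply: y0; rewrite ltn0Sn leqnn.
by apply: IHn => j /andP[j0 jn]; apply: y0; rewrite j0 ltnW.
Qed.

(* A U-turned line: row operators [U] in the upper half, [L] in the lower half, whose
   right edges are opposite. In [nest] the head of the list is the outermost line. *)
Definition fold_line p q (U : K -> bool -> 'M[K]_p) (L : K -> bool -> 'M[K]_q) x
    (N : 'M[K]_(p, q)) :=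
  U x true *m N *m L x false + U x false *m N *m L x true.

Definition nest p q (U : K -> bool -> 'M[K]_p) (L : K -> bool -> 'M[K]_q) xs
    (M : 'M[K]_(p, q)) := foldr (fold_line U L) M xs.

(** After multiplication by [r0], the left side is exchanged in the upper half and the right side in
    the lower half. Both exchanges mix the two terms in which [x] and [x'] have different right
    edges by the same symmetric matrix with entries [t] and [s], so the crossing passes through the
    turns. *)
Lemma fold_lineC p q (U : K -> bool -> 'M[K]_p) (L : K -> bool -> 'M[K]_q) x x' M :
  sg (a ^+ 2 * x' / x) != 0 -> exch U x x' -> exch L x x' ->
  fold_line U L x (fold_line U L x' M) = fold_line U L x' (fold_line U L x M).
Proof.
rewrite /exch /exchange; set r0 := sg _ => r0_neq0.
move=> [uAA uBB uBA uAB] [lAA lBB lBA lAB].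
have eU (P Q : 'M_p) (R S : 'M_q) :
    r0 *: (P *m (Q *m M *m R) *m S) = r0 *: (P *m Q) *m M *m (R *m S).
  by rewrite -!scalemxAl !mulmxA.
have eL (P Q : 'M_p) (R S : 'M_q) :
    r0 *: (P *m (Q *m M *m R) *m S) = P *m Q *m M *m (r0 *: (R *m S)).
  by rewrite -!scalemxAr !mulmxA.
apply: (scalerI r0_neq0); rewrite /fold_line !(mulmxDl, mulmxDr) !scalerDr.
rewrite !eU uAA uBB uBA uAB -!eU !eL lAA lBB lBA lAB.
rewrite !(mulmxDl, mulmxDr).
by rewrite -!scalemxAl -!scalemxAr -!addrA; do 2!congr (_ + _); rewrite addrCA.
Qed.

Lemma nest_to_front p q (U : K -> bool -> 'M[K]_p) (L : K -> bool -> 'M[K]_q) x s1 s2 M :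
  (forall x', x' \in s1 ->
     [/\ sg (a ^+ 2 * x / x') != 0, exch U x' x & exch L x' x]) ->
  nest U L (s1 ++ x :: s2) M = nest U L (x :: s1 ++ s2) M.
Proof.
elim: s1 => //= x' s1 IHs1 h; rewrite IHs1; last first.
  by move=> x'' hx''; apply: h; rewrite inE hx'' orbT.
by have [|r0 hU hL] := h x'; rewrite ?mem_head //= fold_lineC.
Qed.

(** An intertwiner at the centre is carried outwards through the lower halves of the lines. The two
    lemmas that follow carry one outwards through the upper halves and inwards from the outside. *)
Lemma nest_slideR p q q' (U : K -> bool -> 'M[K]_p) (L : K -> bool -> 'M[K]_q)
    (L' : K -> bool -> 'M[K]_q') xs M (Q : 'M_(q', q)) (c : K -> K) :
  (forall x r, x \in xs -> Q *m L x r = c x *: (L' x r *m Q)) ->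
  nest U L xs (M *m Q) = (\prod_(x <- xs) c x) *: (nest U L' xs M *m Q).
Proof.
elim: xs => [|x xs IHxs] h; first by rewrite big_nil scale1r.
have {}IHxs := IHxs (fun x' r hx' => h x' r (mem_behead (s := x :: xs) hx')).
have hx r := h x r (mem_head _ _).
rewrite big_cons /= IHxs /fold_line -!(scalemxAr, scalemxAl) -!mulmxA !hx.
by rewrite -!scalemxAr !scalerA mulrC mulmxDl !mulmxA scalerDr.
Qed.

Lemma nest_slideL p p' q (U : K -> bool -> 'M[K]_p) (U' : K -> bool -> 'M[K]_p')
    (L : K -> bool -> 'M[K]_q) xs M (J : 'M_(p, p')) (c : K -> K) :
  (forall x r, x \in xs -> U x r *m J = c x *: (J *m U' x r)) ->
  nest U L xs (J *m M) = (\prod_(x <- xs) c x) *: (J *m nest U' L xs M).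
Proof.
elim: xs => [|x xs IHxs] h; first by rewrite big_nil scale1r.
have {}IHxs := IHxs (fun x' r hx' => h x' r (mem_behead (s := x :: xs) hx')).
have hx r := h x r (mem_head _ _).
rewrite big_cons /= IHxs /fold_line -!(scalemxAr, scalemxAl) !mulmxA !hx.
by rewrite -!scalemxAl !scalerA mulrC mulmxDr !mulmxA scalerDr.
Qed.

Lemma nest_pushL p p' q (U : K -> bool -> 'M[K]_p) (U' : K -> bool -> 'M[K]_p')
    (L : K -> bool -> 'M[K]_q) xs M (X : 'M_(p', p)) (c : K -> K) :
  (forall x r, x \in xs -> X *m U x r = c x *: (U' x r *m X)) ->
  X *m nest U L xs M = (\prod_(x <- xs) c x) *: nest U' L xs (X *m M).
Proof.
elim: xs => [|x xs IHxs] h; first by rewrite big_nil scale1r.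
have {}IHxs := IHxs (fun x' r hx' => h x' r (mem_behead (s := x :: xs) hx')).
have hx r := h x r (mem_head _ _).
rewrite big_cons /= /fold_line mulmxDr !mulmxA !hx -!scalemxAl -!(mulmxA _ X) IHxs.
by rewrite -!(scalemxAr, scalemxAl) !scalerA scalerDr.
Qed.

(* At [x = v / a] the line [x] turns down into the column [v], and [row_mx (U x false) (U x true)]
   is that turned line; symmetrically for [x = a * v] below. *)
Lemma turn_down_slide d (U : K -> bool -> 'M[K]_d) v x x' r :
  v != 0 -> x' != 0 -> x = v / a -> exch U x' x ->
  row_mx (U x false) (U x true) *m with_column U v x' r =
  sg (a / (x' / v)) *: (U x' r *m row_mx (U x false) (U x true)).
Proof.
move=> v0 x'0 ex [].
(* At [x = v / a] the weights of the crossing of [x'] with [x] are those of the vertex of [x'] on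
   the column [v], so the exchange relations are exactly the blocks of the claim. *)
have -> : sg (a ^+ 2 * x / x') = sg (a / (x' / v)).
  by congr sg; rewrite ex; field; rewrite a_neq0 x'0 v0.
have -> : sg (x' / x) = sg (a * (x' / v)).
  by congr sg; rewrite ex; field; rewrite a_neq0 v0.
move=> hAA hBB hBA hAB; rewrite mul_mx_row scale_row_mx /with_column /add_col.
case: r; rewrite mul_row_block !mulmx0 ?add0r ?addr0 -!scalemxAr.
  by rewrite hAA hAB addrC.
by rewrite hBB hBA addrC.
Qed.

Lemma turn_up_slide d (U : K -> bool -> 'M[K]_d) v x x' r :
  v != 0 -> x' != 0 -> x = a * v -> exch U x x' ->
  with_column U v x' r *m col_mx (U x true) (U x false) =
  sg (a * (x' / v)) *: (col_mx (U x true) (U x false) *m U x' r).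
Proof.
move=> v0 x'0 ex [].
have -> : sg (a ^+ 2 * x' / x) = sg (a * (x' / v)).
  by congr sg; rewrite ex; field; rewrite a_neq0 v0.
have -> : sg (x / x') = sg (a / (x' / v)).
  by congr sg; rewrite ex; field; rewrite v0 x'0.
move=> hAA hBB hBA hAB; rewrite mul_col_mx scale_col_mx /with_column /add_col.
case: r; rewrite mul_block_col !mul0mx ?add0r ?addr0 -!scalemxAl.
  by rewrite hAA hBA addrC.
by rewrite hBB hAB addrC.
Qed.

(** The ice rule freezes the row: all its vertices have type 3 here, and type 6 in the next
    lemma. *)
Lemma up_row_op y n x :
  upv n *m row_op y n x true = (\prod_(j < n) sg (a * (x / y j.+1))) *: upv n.
Proof.
elim: n => [|n IHn]; first by rewrite big_ord0 scale1r mulmx1.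
rewrite big_ord_recr /= mul_row_block !mul0mx !mulmx0 !addr0 -scalemxAr IHn scalerA.
by rewrite mulrC scale_row_mx scaler0.
Qed.

Lemma row_op_dn y n x :
  row_op y n x true *m dnv n = (\prod_(j < n) sg (a / (x / y j.+1))) *: dnv n.
Proof.
elim: n => [|n IHn]; first by rewrite big_ord0 scale1r mulmx1.
rewrite big_ord_recr /= mul_block_col !mul0mx !mulmx0 !add0r -scalemxAl IHn scalerA.
by rewrite mulrC scale_col_mx scaler0.
Qed.
End Nest.
Arguments with_column : simpl never.

(** * Recursions at special parameters *)

Section Models.
Variables (K : fieldType) (a : K).
Hypothesis a_neq0 : a != 0.
Notation s := (sigma (a ^+ 2)).
Notation sg := (@sigma K).
Notation with_col := (with_column a).
Notation exch := (exch a).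
Implicit Types (x v u : K) (xs : seq K).

Lemma sigma1 : sg 1 = 0.
Proof. by rewrite /sigma invr1 subrr. Qed.

Lemma nest_scale p q (V : K -> bool -> 'M[K]_p) (L : K -> bool -> 'M[K]_q) xs c M :
  nest V L xs (c *: M) = c *: nest V L xs M.
Proof.
elim: xs => //= x xs ->.
by rewrite /fold_line -!(scalemxAl, scalemxAr) -scalerDr.
Qed.

Lemma with_colTE d (U : K -> bool -> 'M[K]_d) v x : with_col U v x true =
  block_mx (sg (a * (x / v)) *: U x true) 0 (s *: U x false) (sg (a / (x / v)) *: U x true).
Proof. by []. Qed.

Lemma with_colFE d (U : K -> bool -> 'M[K]_d) v x : with_col U v x false =
  block_mx (sg (a / (x / v)) *: U x false) (s *: U x true) 0 (sg (a * (x / v)) *: U x false).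
Proof. by []. Qed.

Section Abstract.
Variables (d : nat) (U : K -> bool -> 'M[K]_d) (e : 'rV[K]_d) (f : 'cV[K]_d).
Variables (al be : K -> K).
Hypothesis eU : forall x, e *m U x true = al x *: e.
Hypothesis fU : forall x, U x true *m f = be x *: f.

(** All right boundary edges point left, so only [U x false] occurs. *)
Definition dwpf xs : K := (e *m foldr (fun x w => U x false *m w) f xs) 0 0.
Definition evpf xs : K := (e *m nest U U xs 1%:M *m f) 0 0.
(* G(v,u): the last column has parameter [v] in the upper and [u] in the lower half. *)
Definition sppf v u xs : K :=
  (row_mx e 0 *m nest (with_col U v) (with_col U u) xs 1%:M *m col_mx 0 f) 0 0.
(* O(x,u): the direction of the right end of the centre row [x] selects the block for
   the edge entering the column [u]. *)
Definition odpf x u xs : K :=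
  (e *m nest U (with_col U u) xs (row_mx (U x false) (U x true)) *m col_mx 0 f) 0 0.

(** The centre row with its turn slides out through the lower halves, taking the column [u] with it,
    and freezes at the bottom boundary. *)
Lemma odpf_down x u xs : u != 0 -> x = u / a ->
  (forall x', x' \in xs -> x' != 0 /\ exch U x' x) ->
  odpf x u xs = (\prod_(x' <- xs) sg (a / (x' / u))) * be x * evpf xs.
Proof.
move=> u0 xu hxs; rewrite /odpf -[row_mx _ _]mul1mx.
rewrite (@nest_slideR _ _ _ _ U _ U xs _ _ (fun x' => sg (a / (x' / u)))); last first.
  by move=> x' r /hxs[x'0 ex]; apply: (turn_down_slide a_neq0).
rewrite -scalemxAr -scalemxAl -!mulmxA mul_row_col mulmx0 add0r fU.
by rewrite -!scalemxAr scalerA mxE mulmxA.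
Qed.

(** The row [x] is lifted from the centre to the top. No intertwiner of one half alone does this:
    the vertex of [x'] on the column [u] below supplies the coefficients that exchange [x] with [x']
    above, so both blocks are treated in one induction. *)
Lemma nest_turn_up x u xs : u != 0 -> x = a * u ->
  (forall x', x' \in xs -> x' != 0 /\ exch U x x') ->
  nest U (with_col U u) xs (row_mx (U x false) (U x true)) =
  (\prod_(x' <- xs) sg (a * (x' / u))) *:
    row_mx (U x false *m nest U U xs 1%:M) (U x true *m nest U U xs 1%:M).
Proof.
move=> u0 xu; elim: xs => [|x' xs IHxs] h; first by rewrite big_nil scale1r /= !mulmx1.
rewrite big_cons /= {}IHxs => [|x'' hx'']; last by apply: h; rewrite inE hx'' orbT.
have [x'0 []] := h _ (mem_head _ _).
have -> : sg (a ^+ 2 * x' / x) = sg (a * (x' / u)).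
  by congr sg; rewrite xu; field; rewrite a_neq0 u0.
have -> : sg (x / x') = sg (a / (x' / u)).
  by congr sg; rewrite xu; field; rewrite u0 x'0.
move: (nest U U xs _) => E; rewrite /fold_line /with_column /add_col.
move: (sg (a * (x' / u))) (sg (a / (x' / u))) => p q hAA hBB hBA hAB.
rewrite -!(scalemxAl, scalemxAr) -scalerDr [p * _]mulrC -scalerA; congr (_ *: _).
rewrite !mul_mx_row -!mulmxA !mul_row_block !mulmx0 !addr0 !add_row_mx scale_row_mx.
have sl c (M1 M2 N1 N2 : 'M_d) :
    c *: (M1 *m M2 *m N1 *m N2) = (c *: (M1 *m M2)) *m N1 *m N2.
  by rewrite !scalemxAl.
congr row_mx; rewrite !(mulmxDr, mulmxDl) -!(scalemxAl, scalemxAr) !mulmxA scalerDr.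
  by rewrite !sl hBA hBB !mulmxDl !addrA addrAC.
by rewrite !sl hAA hAB !mulmxDl add0r addrCA addrA.
Qed.

Lemma odpf_up x u xs : u != 0 -> x = a * u ->
  (forall x', x' \in xs -> x' != 0 /\ exch U x x') ->
  odpf x u xs = (\prod_(x' <- xs) sg (a * (x' / u))) * al x * evpf xs.
Proof.
move=> u0 xu hxs; rewrite /odpf nest_turn_up // -scalemxAr -scalemxAl -!mulmxA.
rewrite mul_row_col mulmx0 add0r -[U x true *m _ *m f]mulmxA mulmxA eU.
by rewrite -!scalemxAl scalerA mxE mulmxA.
Qed.

Lemma up_with_colT v x : row_mx e 0 *m with_col U v x true =
  row_mx (sg (a * (x / v)) *: (e *m U x true)) 0.
Proof. by rewrite mul_row_block !mul0mx mulmx0 !addr0 -scalemxAr. Qed.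

Lemma up_with_colF v x : row_mx e 0 *m with_col U v x false =
  row_mx (sg (a / (x / v)) *: (e *m U x false)) (s *: (e *m U x true)).
Proof. by rewrite mul_row_block !mul0mx !addr0 -!scalemxAr. Qed.

Lemma with_col_dnT v x : with_col U v x true *m col_mx 0 f =
  col_mx 0 (sg (a / (x / v)) *: (U x true *m f)).
Proof. by rewrite mul_block_col !mul0mx !mulmx0 !add0r -scalemxAl. Qed.

(** As [a * (x / v) = 1], the outermost upper row has to turn into the column [v]. Its lower half
    freezes at the bottom, while the turned upper half is pushed inwards and becomes the centre row
    that enters the column [u]. *)
Lemma sppf_down x v u xs : v != 0 -> x = v / a ->
  (forall x', x' \in xs -> x' != 0 /\ exch U x' x) ->
  sppf v u (x :: xs) = s * (\prod_(x' <- xs) sg (a / (x' / v))) *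
    (sg (a / (x / u)) * be x) * odpf x u xs.
Proof.
move=> v0 xv hxs; rewrite /sppf /= /fold_line.
rewrite !(mulmxDr, mulmxDl) !mulmxA up_with_colT up_with_colF.
have -> : a * (x / v) = 1 by rewrite xv; field; rewrite a_neq0 v0.
have -> : a / (x / v) = a ^+ 2.
  by rewrite xv; field; rewrite v0 a_neq0 oner_neq0.
rewrite sigma1 !scale0r row_mx0 !mul0mx add0r -scale_row_mx -mul_mx_row -!mulmxA.
rewrite with_col_dnT fU scalerA -[X in col_mx X _](scaler0 _ (sg (a / (x / u)) * be x)).
rewrite -scale_col_mx -!(scalemxAl, scalemxAr).
rewrite -[e *m _ *m _]mulmxA [row_mx (U x false) _ *m _]mulmxA.
rewrite (@nest_pushL _ _ _ _ _ U _ xs _ _ (fun x' => sg (a / (x' / v)))); last first.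
  by move=> x' r /hxs[x'0 ex]; apply: (turn_down_slide a_neq0).
rewrite mulmx1 -!(scalemxAl, scalemxAr) !scalerA mxE mulmxA; congr (_ * _).
by ring.
Qed.

(* Sums over the edge joining the last upper column to the right end of the lower row [x]. *)
Definition join_last p q (L : K -> bool -> 'M[K]_q) x (N : 'M[K]_(p + p, q)) :=
  usubmx N *m L x false + dsubmx N *m L x true.

(** At [x = a * v] the column [v] above and the row [x] below form one line, which is pulled inwards
    past the turned line [x']; the column [v] disappears from it. *)
Lemma join_last_fold x v (L : K -> bool -> 'M[K]_d) q (L' : K -> bool -> 'M[K]_q) x' N :
  v != 0 -> x' != 0 -> x = a * v -> exch L' x x' ->
  join_last L' x (fold_line (with_col L v) L' x' N) =
  sg (a * (x' / v)) *: fold_line L L' x' (join_last L' x N).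
Proof.
move=> v0 x'0 xv [].
have -> : sg (a ^+ 2 * x' / x) = sg (a * (x' / v)).
  by congr sg; rewrite xv; field; rewrite a_neq0 v0.
have -> : sg (x / x') = sg (a / (x' / v)).
  by congr sg; rewrite xv; field; rewrite v0 x'0.
rewrite /fold_line /join_last /with_column /add_col.
move: (sg (a * (x' / v))) (sg (a / (x' / v))) => p q' hAA hBB hBA hAB.
rewrite -[N]vsubmxK; move: (usubmx N) (dsubmx N) => C1 C0.
rewrite !mul_block_col !mul0mx ?add0r ?addr0 !mul_col_mx !add_col_mx.
rewrite !col_mxKu !col_mxKd !(mulmxDr, mulmxDl) -!(scalemxAl, scalemxAr) !mulmxA.
rewrite !scalerDr.
have sr (c : K) (X : 'M_d) (C : 'M_(d, q)) (N1 N2 : 'M_q) :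
    c *: (X *m C *m N1 *m N2) = X *m C *m (c *: (N1 *m N2)).
  by rewrite -scalemxAr !mulmxA.
rewrite !sr hAA hBB hBA hAB !mulmxDr -!scalemxAr.
rewrite -!addrA; congr (_ + _); rewrite addrCA; congr (_ + _).
by rewrite [RHS]addrCA; congr (_ + _); rewrite addrCA.
Qed.

Lemma join_last_nest x v (L : K -> bool -> 'M[K]_d) q (L' : K -> bool -> 'M[K]_q) xs M :
  v != 0 -> x = a * v -> (forall x', x' \in xs -> x' != 0 /\ exch L' x x') ->
  join_last L' x (nest (with_col L v) L' xs M) =
  (\prod_(x' <- xs) sg (a * (x' / v))) *: nest L L' xs (join_last L' x M).
Proof.
move=> v0 xv; elim: xs => [|x' xs IHxs] h; first by rewrite big_nil scale1r.
have [x'0 ex] := h _ (mem_head _ _).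
rewrite big_cons /= join_last_fold // IHxs => [|x'' hx'']; last first.
  by apply: h; rewrite inE hx'' orbT.
by rewrite /fold_line -!(scalemxAl, scalemxAr) -scalerDr scalerA.
Qed.

Lemma sppf_up x v u xs : x != 0 -> v != 0 -> u != 0 -> x = a * v ->
  (forall x', x' \in xs -> x' != 0 /\ exch U x x') ->
  sppf v u (x :: xs) = s * al x * (\prod_(x' <- xs) sg (a * (x' / v))) *
    (sg (a / (x / u)) + s) * odpf x u xs.
Proof.
move=> x0 v0 u0 xv hxs; rewrite /sppf /= /fold_line.
rewrite !(mulmxDr, mulmxDl) !mulmxA up_with_colT up_with_colF.
have -> : a / (x / v) = 1 by rewrite xv; field; rewrite a_neq0 v0.
have -> : a * (x / v) = a ^+ 2 by rewrite xv; field; rewrite v0.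
rewrite sigma1 !scale0r !eU.
set N := nest _ _ _ _.
have eN : (row_mx (s *: (al x *: e)) 0 *m N *m with_col U u x false *m col_mx 0 f +
    row_mx 0 (s *: (al x *: e)) *m N *m with_col U u x true *m col_mx 0 f) =
    (s * al x) *: (e *m join_last (with_col U u) x N *m col_mx 0 f).
  rewrite /join_last -{1 2}[N]vsubmxK !mul_row_col !mul0mx addr0 add0r.
  by rewrite scalerA -!scalemxAl -scalerDr mulmxDr mulmxDl !mulmxA.
rewrite eN join_last_nest //; last first.
  by move=> x' /hxs[x'0 ex]; split => //; apply: exch_with_col.
(* At the centre the right edge of [x] and the edge above it on the column [u] are the same edge, so
   the vertex there contributes a sum over its two directions, a straight weight plus a corner. *)
have -> : join_last (with_col U u) x 1%:M =
    (sg (a / (x / u)) + s) *: row_mx (U x false) (U x true).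
  rewrite /join_last scalar_mx_block block_mxEv col_mxKu col_mxKd.
  rewrite !mul_row_block !mul1mx !mul0mx !add0r !addr0 add_row_mx scale_row_mx.
  by rewrite !scalerDl [X in row_mx _ X]addrC.
by rewrite nest_scale -!(scalemxAl, scalemxAr) !scalerA mxE.
Qed.

(* A half-turn moves the last column from the lower to the upper half, exchanging the
   roles of its two end edges. *)
Lemma nest_rot p (V : K -> bool -> 'M[K]_p) q (L : K -> bool -> 'M[K]_q) v xs N :
  nest V (with_col L v) xs (row_mx (dsubmx N) (usubmx N)) =
  row_mx (dsubmx (nest (with_col V v) L xs N)) (usubmx (nest (with_col V v) L xs N)).
Proof.
elim: xs => //= x xs ->; move: (nest _ _ _ N) => {}N.
rewrite -[N]vsubmxK; move: (usubmx N) (dsubmx N) => C1 C0.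
rewrite /fold_line /with_column /add_col.
rewrite !(mul_mx_row, mul_row_block, mul_block_col, mul_col_mx, add_row_mx, add_col_mx,
  mulmx0, mul0mx, addr0, add0r, col_mxKu, col_mxKd).
rewrite !(mulmxDr, mulmxDl) -!(scalemxAl, scalemxAr).
congr row_mx; first by rewrite addrA addrC addrA.
by rewrite -addrA addrC -addrA.
Qed.
End Abstract.

Section Split.
Variables (d : nat) (W : K -> bool -> 'M[K]_d) (e : 'rV[K]_d) (f : 'cV[K]_d).
Variables (al be : K -> K).
Hypothesis eW : forall x, e *m W x true = al x *: e.
Hypothesis fW : forall x, W x true *m f = be x *: f.

(** The vertex of the centre row on [v] splits: [block_mx P 0 0 P] glues the upper part of [v] to
    the column [u], and [P], the row [x] turning into the lower part of [v], slides out through the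
    lower half. *)
Lemma odpf_split_down x v u xs : v != 0 -> x = v / a ->
  (forall x', x' \in xs -> x' != 0 /\ exch W x' x) ->
  odpf (with_col W v) (row_mx e 0) (col_mx 0 f) x u xs =
  s * (\prod_(x' <- xs) sg (a / (x' / v))) * be x * sppf W e f v u xs.
Proof.
move=> v0 xv hxs; rewrite /odpf.
set P := row_mx (W x false) (W x true).
have -> : row_mx (with_col W v x false) (with_col W v x true) =
    1%:M *m (s *: block_mx P 0 0 P).
  rewrite mul1mx /with_column /add_col.
  have -> : a * (x / v) = 1 by rewrite xv; field; rewrite a_neq0 v0.
  have -> : a / (x / v) = a ^+ 2.
    by rewrite xv; field; rewrite v0 a_neq0 oner_neq0.
  rewrite sigma1 !scale0r scale_block_mx !scaler0 !block_mxEv -!scale_row_mx !row_mx0.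
  by rewrite -block_mxEh block_mxEv.
rewrite (@nest_slideR _ _ _ _ _ _ (with_col W u) xs _ _ (fun x' => sg (a / (x' / v)))).
  rewrite -!(scalemxAl, scalemxAr) scalerA -!mulmxA -/P.
  rewrite mul_block_col mulmx0 !mul0mx !add0r mul_row_col mulmx0 add0r fW.
  rewrite -[X in col_mx X _](scaler0 _ (be x)) -scale_col_mx -!scalemxAr scalerA mxE.
  by rewrite /sppf mulmxA; congr (_ * _); ring.
move=> x' r /hxs[x'0 ex]; rewrite -!(scalemxAl, scalemxAr) scalerA [_ * s]mulrC -scalerA.
congr (_ *: _); have sl r' := turn_down_slide a_neq0 r' v0 x'0 xv ex.
by case: r; rewrite !(with_colTE, with_colFE) -?(with_colTE W v) -?(with_colFE W v)
  !mulmx_block !(mulmx0, mul0mx, addr0, add0r) -!(scalemxAl, scalemxAr) !sl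
  scale_block_mx !scaler0 !scalerA ![sg (a / (x' / v)) * _]mulrC.
Qed.

(** Here [J], the row [x] turning into the upper part of [v], slides out through the upper half. The
    lower parts of [v] and [u] remain, joined at their tops; [nest_rot] turns [u] over into the
    upper half, whence the order of [u] and [v] on the right. *)
Lemma odpf_split_up x v u xs : v != 0 -> x = a * v ->
  (forall x', x' \in xs -> x' != 0 /\ exch W x x') ->
  odpf (with_col W v) (row_mx e 0) (col_mx 0 f) x u xs =
  s * (\prod_(x' <- xs) sg (a * (x' / v))) * al x * sppf W e f u v xs.
Proof.
move=> v0 xv hxs; rewrite /odpf.
set J := col_mx (W x true) (W x false).
have -> : row_mx (with_col W v x false) (with_col W v x true) =
    J *m (s *: row_mx (dsubmx 1%:M) (usubmx 1%:M)).
  rewrite /with_column /add_col.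
  have -> : a / (x / v) = 1 by rewrite xv; field; rewrite a_neq0 v0.
  have -> : a * (x / v) = a ^+ 2 by rewrite xv; field; rewrite v0.
  rewrite sigma1 !scale0r -scalemxAr scalar_mx_block [in RHS]block_mxEv col_mxKu col_mxKd.
  rewrite !block_mxEh !mul_mx_row !mul_col_mx !mulmx1 !mulmx0.
  by rewrite !scale_row_mx !scale_col_mx !scaler0.
rewrite (@nest_slideL _ _ _ _ _ W _ xs _ _ (fun x' => sg (a * (x' / v)))); last first.
  by move=> x' r /hxs[x'0 ex]; apply: (turn_up_slide a_neq0).
rewrite nest_scale nest_rot -!(scalemxAl, scalemxAr) !scalerA -!mulmxA.
rewrite [row_mx e 0 *m _]mulmxA mul_row_col mul0mx addr0 eW mul_row_col mulmx0 add0r.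
rewrite -!scalemxAl scalerA mxE /sppf -[nest (with_col W u) _ _ _ in RHS]vsubmxK.
rewrite mul_row_col mul0mx addr0 mulmxA; congr (_ * _); ring.
Qed.
End Split.
End Models.

(** * Symmetries in the lines *)

Section Symmetries.
Variables (K : fieldType) (a : K).
Hypothesis a_neq0 : a != 0.
Notation s := (sigma (a ^+ 2)).
Notation sg := (@sigma K).
Notation with_col := (with_column a).
Notation exch := (exch a).
Implicit Types (x v u eps c : K) (xs : seq K).

Lemma scale00 c (M : 'M[K]_1) : c * M 0 0 = (c *: M) 0 0.
Proof. by rewrite mxE. Qed.

(** One of the Korepin recursions: the first row turns into the last column and slides down through
    all other rows. *)
Lemma dwpf_down d (U : K -> bool -> 'M[K]_d) e f be x v xs :
  (forall x, U x true *m f = be x *: f) -> v != 0 -> x = v / a ->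
  (forall x', x' \in xs -> x' != 0 /\ exch U x' x) ->
  dwpf (with_col U v) (row_mx e 0) (col_mx 0 f) (x :: xs) =
  s * (\prod_(x' <- xs) sg (a / (x' / v))) * be x * dwpf U e f xs.
Proof.
move=> fU v0 xv hxs; rewrite /dwpf /= mulmxA up_with_colF.
have -> : a / (x / v) = a ^+ 2.
  by rewrite xv; field; rewrite v0 a_neq0 oner_neq0.
rewrite -scale_row_mx -mul_mx_row -scalemxAl -mulmxA.
set P := row_mx _ _; set g := fun _ _ => _.
have -> : P *m foldr g (col_mx 0 f) xs = ((\prod_(x' <- xs) sg (a / (x' / v))) * be x) *:
    foldr (fun x' w => U x' false *m w) f xs.
  elim: xs hxs => [|x' xs IHxs] hxs.
    by rewrite big_nil mul1r mul_row_col mulmx0 add0r fU.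
  have [x'0 ex] := hxs _ (mem_head _ _).
  rewrite big_cons [foldr _ _ _]/= {1}/g mulmxA (turn_down_slide a_neq0) //.
  rewrite -scalemxAl -mulmxA IHxs.
    by rewrite -scalemxAr scalerA mulrA.
  by move=> x'' hx''; apply: hxs; rewrite inE hx'' orbT.
by rewrite -scalemxAr scalerA mxE !mulrA.
Qed.

(** The vertex in the upper right corner must be a corner, which freezes the rest of the first row
    and of the last column. *)
Lemma dwpf_up d (U : K -> bool -> 'M[K]_d) e f al x v xs :
  (forall x, e *m U x true = al x *: e) -> v != 0 -> x = a * v ->
  dwpf (with_col U v) (row_mx e 0) (col_mx 0 f) (x :: xs) =
  s * (\prod_(x' <- xs) sg (a * (x' / v))) * al x * dwpf U e f xs.
Proof.
move=> eU v0 xv; rewrite /dwpf /= mulmxA up_with_colF eU.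
have -> : a / (x / v) = 1 by rewrite xv; field; rewrite a_neq0 v0.
rewrite sigma1 scale0r scalerA -[X in row_mx X _](scaler0 _ (s * al x)).
rewrite -scale_row_mx -scalemxAl.
set g := fun _ _ => _.
have -> : row_mx 0 e *m foldr g (col_mx 0 f) xs = (\prod_(x' <- xs) sg (a * (x' / v))) *:
    (e *m foldr (fun x' w => U x' false *m w) f xs).
  elim: xs (e) => [|x' xs IHxs] e'.
    by rewrite big_nil scale1r mul_row_col mul0mx add0r.
  rewrite big_cons [foldr _ _ _]/= {1}/g !mulmxA mul_row_block !mul0mx mulmx0 !add0r -scalemxAr.
  rewrite -[X in row_mx X _](scaler0 _ (sg (a * (x' / v)))) -scale_row_mx.
  by rewrite -scalemxAl IHxs scalerA.
by rewrite scalerA mxE; congr (_ * _); ring.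
Qed.

Lemma dwpf_to_front d (U : K -> bool -> 'M[K]_d) e f x s1 s2 :
  (forall x', x' \in s1 -> sg (a ^+ 2 * x / x') != 0 /\ exch U x' x) ->
  dwpf U e f (s1 ++ x :: s2) = dwpf U e f (x :: s1 ++ s2).
Proof.
rewrite /dwpf => h; congr ((_ *m _) _ _); elim: s1 h => //= x' s1 IHs1 h.
rewrite IHs1 => [|x'' hx'']; last by apply: h; rewrite inE hx'' orbT.
have [r0 [_ hBB _ _]] := h _ (mem_head _ _).
by rewrite /= !mulmxA (scalerI r0 hBB).
Qed.

(* Used with [eps = 1] for exchanging two columns and [eps = -1] for changing the sign of
   a column parameter. *)
Definition conj_ops d eps c1 c2 (U U' : K -> bool -> 'M[K]_d) (e : 'rV_d) (f : 'cV_d) :=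
  exists X : 'M[K]_d, [/\ forall x r, x != 0 -> X *m U x r = eps *: (U' x r *m X),
    e *m X = c1 *: e & X *m f = c2 *: f].

(** A turned line is crossed once in each half, so its two factors [eps] cancel. *)
Lemma conj_nest p q eps (X : 'M[K]_p) (Y : 'M[K]_q) U U' L L' xs k M M' :
  eps * eps = 1 -> all (fun x => x != 0) xs ->
  (forall x r, x != 0 -> X *m U x r = eps *: (U' x r *m X)) ->
  (forall x r, x != 0 -> Y *m L x r = eps *: (L' x r *m Y)) ->
  X *m M = k *: (M' *m Y) -> X *m nest U L xs M = k *: (nest U' L' xs M' *m Y).
Proof.
move=> eps2 + hX hY hM; elim: xs => //= x xs IHxs /andP[x0 /IHxs {}IHxs].
have t r r' : X *m (U x r *m nest U L xs M *m L x r') =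
    k *: (U' x r *m nest U' L' xs M' *m L' x r' *m Y).
  rewrite !mulmxA hX // -!scalemxAl -(mulmxA (U' x r)) IHxs -scalemxAr -scalemxAl.
  by rewrite -!mulmxA hY // -!scalemxAr !scalerA mulrAC eps2 mul1r.
by rewrite mulmxDr !t mulmxDl scalerDr.
Qed.

Lemma conj_ops_with_col d eps c1 c2 (U U' : K -> bool -> 'M[K]_d) e f v :
  conj_ops eps c1 c2 U U' e f ->
  conj_ops eps c1 c2 (with_col U v) (with_col U' v) (row_mx e 0) (col_mx 0 f).
Proof.
case=> X [hX hXe hXf]; exists (block_mx X 0 0 X); split.
- move=> x r x0; case: r; rewrite !(with_colTE, with_colFE) !mulmx_block.
    rewrite !(mulmx0, mul0mx, addr0, add0r) -!(scalemxAl, scalemxAr) !hX //.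
    by rewrite scale_block_mx scaler0 !scalerA ![eps * _]mulrC.
  rewrite !(mulmx0, mul0mx, addr0, add0r) -!(scalemxAl, scalemxAr) !hX //.
  by rewrite scale_block_mx scaler0 !scalerA ![eps * _]mulrC.
- by rewrite mul_row_block hXe !mul0mx !mulmx0 !addr0 scale_row_mx scaler0.
- by rewrite mul_block_col hXf !mul0mx !mulmx0 !add0r scale_col_mx scaler0.
Qed.

Lemma conj_dwpf d eps c1 c2 (U U' : K -> bool -> 'M[K]_d) e f xs :
  conj_ops eps c1 c2 U U' e f -> all (fun x => x != 0) xs ->
  c1 * dwpf U e f xs = eps ^+ size xs * c2 * dwpf U' e f xs.
Proof.
case=> X [hX hXe hXf] xs0; rewrite /dwpf.
have hF : X *m foldr (fun x w => U x false *m w) f xs =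
    (eps ^+ size xs * c2) *: foldr (fun x w => U' x false *m w) f xs.
  elim: xs xs0 => [|x xs IHxs] /=; first by rewrite mul1r.
  case/andP=> x0 /IHxs {}IHxs; rewrite mulmxA hX // -scalemxAl -mulmxA IHxs.
  by rewrite -scalemxAr scalerA exprS mulrA.
rewrite scale00 scalemxAl -hXe -mulmxA hF -scalemxAr mxE.
by [].
Qed.

Lemma conj_evpf d eps c1 c2 (U U' : K -> bool -> 'M[K]_d) e f xs :
  eps * eps = 1 -> conj_ops eps c1 c2 U U' e f -> all (fun x => x != 0) xs ->
  c1 * evpf U e f xs = c2 * evpf U' e f xs.
Proof.
move=> eps2 [X [hX hXe hXf]] xs0; rewrite /evpf.
rewrite scale00 !scalemxAl -hXe -(mulmxA e X).
rewrite (conj_nest (k := 1) (M' := 1%:M) (Y := X) eps2 xs0 hX hX) ?mulmx1 ?mul1mx ?scale1r //.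
by rewrite !mulmxA -mulmxA hXf -scalemxAr mxE.
Qed.

Lemma conj_odpf d eps c1 c2 (U U' : K -> bool -> 'M[K]_d) e f x u xs :
  eps * eps = 1 -> conj_ops eps c1 c2 U U' e f -> all (fun x => x != 0) (x :: xs) ->
  c1 * odpf a U e f x u xs = eps * c2 * odpf a U' e f x u xs.
Proof.
move=> eps2 hU /= /andP[x0 xs0]; rewrite /odpf.
case: (hU) => X [hX hXe hXf].
rewrite scale00 !scalemxAl -hXe -(mulmxA e X).
pose Y := block_mx X 0 0 X.
have hY x' r : x' != 0 -> Y *m with_col U u x' r = eps *: (with_col U' u x' r *m Y).
  move=> x'0; case: r; rewrite !(with_colTE, with_colFE) !mulmx_block.
    rewrite !(mulmx0, mul0mx, addr0, add0r) -!(scalemxAl, scalemxAr) !hX //.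
    by rewrite scale_block_mx scaler0 !scalerA ![eps * _]mulrC.
  rewrite !(mulmx0, mul0mx, addr0, add0r) -!(scalemxAl, scalemxAr) !hX //.
  by rewrite scale_block_mx scaler0 !scalerA ![eps * _]mulrC.
rewrite (conj_nest (k := eps) (M' := row_mx (U' x false) (U' x true)) eps2 xs0 hX hY).
  rewrite -!(scalemxAr, scalemxAl) -!mulmxA mul_block_col !mul0mx !mulmx0 !add0r hXf.
  rewrite -[X in col_mx X _](scaler0 _ c2) -scale_col_mx -!scalemxAr scalerA mxE.
  by rewrite mulmxA.
rewrite mul_mx_row !hX // mul_row_block !mulmx0 addr0 add0r scale_row_mx.
by [].
Qed.
End Symmetries.

(** * Sign changes and transpositions of columns *)

Section ColumnSymmetries.
Variables (K : fieldType) (a : K).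
Hypothesis a_neq0 : a != 0.
Notation s := (sigma (a ^+ 2)).
Notation sg := (@sigma K).
Notation with_col := (with_column a).
Notation row_op := (row_op a).
Implicit Types (x v u eps c : K) (xs : seq K) (y : nat -> K).

Lemma sigmaN x : sg (- x) = - sg x.
Proof. by rewrite /sigma invrN opprB opprK addrC. Qed.

(** Replacing [v] by [- v] negates the diagonal blocks of [with_column] and keeps the corner blocks;
    conjugation by diag(1, -1) does the opposite, so together they give the sign -1. *)
Lemma conj_ops_neg_col d (U : K -> bool -> 'M[K]_d) e f v :
  conj_ops (- 1) 1 (- 1) (with_col U (- v)) (with_col U v) (row_mx e 0) (col_mx 0 f).
Proof.
exists (block_mx 1%:M 0 0 (- 1%:M)); split.
- move=> x r x0.
  have e1 : a * (x / - v) = - (a * (x / v)) by rewrite invrN !mulrN.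
  have e2 : a / (x / - v) = - (a / (x / v)) by rewrite !invrN !mulrN invrN mulrN.
  case: r; rewrite !(with_colTE, with_colFE) !mulmx_block e1 e2 !sigmaN.
    rewrite !(mulmx0, mul0mx, addr0, add0r, mul1mx, mulmx1) scale_block_mx scaler0.
    by rewrite !(mulNmx, mulmxN, mul1mx, mulmx1) !scaleN1r -!scaleNr !opprK.
  rewrite !(mulmx0, mul0mx, addr0, add0r, mul1mx, mulmx1) scale_block_mx scaler0.
  by rewrite !(mulNmx, mulmxN, mul1mx, mulmx1) !scaleN1r -!scaleNr !opprK.
- by rewrite mul_row_block !mulmx0 mul0mx mulmx1 !addr0 scale1r.
- by rewrite mul_block_col !mulmx0 mul0mx mulNmx mul1mx !add0r scaleN1r opp_col_mx oppr0.
Qed.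

Lemma conj_ops_swap_col d (U : K -> bool -> 'M[K]_d) e f v u : v != 0 -> u != 0 ->
  let r0 := sg (a ^+ 2 * v / u) in
  conj_ops 1 r0 r0 (with_col (with_col U v) u) (with_col (with_col U u) v)
    (row_mx (row_mx e 0) 0) (col_mx 0 (col_mx 0 f)).
Proof.
move=> v0 u0 r0; pose t := sg (u / v).
(* The crossing of the two columns, a vertex of parameter [a * v / u], with weights [r0], [s] and
   [t]. *)
exists (block_mx (block_mx r0%:M 0 0 s%:M) (block_mx 0 0 t%:M 0)
         (block_mx 0 t%:M 0 0) (block_mx s%:M 0 0 r0%:M)); split.
- move=> x r x0; rewrite scale1r.
  case: r; rewrite !(with_colTE, with_colFE) !scale_block_mx !mulmx_block.
    rewrite !(mulmx0, mul0mx, addr0, add0r, scaler0) !add_block_mx.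
    rewrite !(mul_scalar_mx, mul_mx_scalar, scalerA) -!scalerDl !(addr0, add0r).
    by do 2 apply: block_mx_congr => //; congr (_ *: _); rewrite /r0 /t /sigma; field;
      rewrite ?a_neq0 ?x0 ?v0 ?u0.
  rewrite !(mulmx0, mul0mx, addr0, add0r, scaler0) !add_block_mx.
  rewrite !(mul_scalar_mx, mul_mx_scalar, scalerA) -!scalerDl !(addr0, add0r).
  by do 2 apply: block_mx_congr => //; congr (_ *: _); rewrite /r0 /t /sigma; field;
    rewrite ?a_neq0 ?x0 ?v0 ?u0.
- rewrite mul_row_block !mul0mx !addr0 !mul_row_block !mulmx0 !mul0mx !addr0 mul_mx_scalar.
  by rewrite !scale_row_mx !scaler0 row_mx0.
- rewrite mul_block_col !mulmx0 !add0r !mul_block_col !mulmx0 !mul0mx !add0r mul_scalar_mx.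
  by rewrite !scale_col_mx !scaler0 col_mx0.
Qed.

Lemma eq_row_op y y' n x r : (forall j, (0 < j <= n)%N -> y j = y' j) ->
  row_op y n x r = row_op y' n x r.
Proof.
elim: n r => //= n IHn r h; rewrite /with_column !IHn ?h ?ltnSn //;
  by move=> j /andP[j0 jn]; apply: h; rewrite j0 ltnW.
Qed.

Definition swap_fun k y i :=
  if i == k.+1 then y k.+2 else if i == k.+2 then y k.+1 else y i.

Lemma conj_ops_swap y k n : (k.+2 <= n)%N -> y k.+1 != 0 -> y k.+2 != 0 ->
  let r0 := sg (a ^+ 2 * y k.+1 / y k.+2) in
  conj_ops 1 r0 r0 (row_op y n) (row_op (swap_fun k y) n) (upv K n) (dnv K n).
Proof.
move=> + y1 y2 r0; elim: n => [|n IHn]; first by []. rewrite leq_eqVlt => /orP[/eqP[<-]|kn].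
  have [X [hX hXe hXf]] := conj_ops_swap_col (row_op y k) (upv K k) (dnv K k) y1 y2.
  have yk j : (0 < j <= k)%N -> swap_fun k y j = y j.
    by case/andP=> _ jk; rewrite /swap_fun !ifN_eq //; apply/eqP; lia.
  exists X; split; [move=> x r x0 | exact: hXe | exact: hXf].
  have -> : row_op (swap_fun k y) k.+2 x r =
      with_col (with_col (row_op y k) (y k.+2)) (y k.+1) x r.
    rewrite /= /with_column !(eq_row_op _ _ yk) /swap_fun !eqxx.
    by rewrite eqn_leq ltnn.
  exact: hX.
have := conj_ops_with_col a (y n.+1) (IHn kn).
by rewrite /= {3}/swap_fun !ifN_eq //; apply/eqP; lia.
Qed.
End ColumnSymmetries.

(** * Transport of the quadratic identities *)

Section Defects.
Variables (K : fieldType) (a : K).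
Hypothesis a_neq0 : a != 0.
Notation s := (sigma (a ^+ 2)).
Notation sg := (@sigma K).
Notation with_col := (with_column a).
Notation exch := (exch a).
Implicit Types (x v u eps c : K) (xs : seq K).

Definition dwpf_col d (U : K -> bool -> 'M[K]_d) e f u xs :=
  dwpf (with_col U u) (row_mx e 0) (col_mx 0 f) xs.
Definition evpf_col d (U : K -> bool -> 'M[K]_d) e f u xs :=
  evpf (with_col U u) (row_mx e 0) (col_mx 0 f) xs.

Definition odd_defect d (U : K -> bool -> 'M[K]_d) e f x u xs :=
  sg a * (a * x + u) * (a * u + x) * odpf a U e f x u xs *
    dwpf U e f xs * dwpf_col U e f u (x :: xs) -
  a * x * u * (dwpf_col U e f u (x :: xs) ^+ 2 * evpf U e f xs +
               dwpf U e f xs ^+ 2 * evpf_col U e f u (x :: xs)).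

Definition split_defect d (U : K -> bool -> 'M[K]_d) e f v u xs :=
  (u + v) * sg a * sppf a U e f v u xs * dwpf_col U e f u xs * dwpf_col U e f v xs -
  (a * u - v / a) * (dwpf_col U e f u xs ^+ 2 * evpf_col U e f v xs +
                     dwpf_col U e f v xs ^+ 2 * evpf_col U e f u xs).

(** All weights but those of corners are odd in [x], and a row contains an even number of corners
    exactly when its right edge points right; for n columns [tau] is (-1)^n. *)
Definition parity_op d tau (U : K -> bool -> 'M[K]_d) :=
  forall x, U (- x) true = tau *: U x true /\ U (- x) false = - tau *: U x false.

Lemma parity_with_col d tau (U : K -> bool -> 'M[K]_d) v :
  parity_op tau U -> parity_op (- tau) (with_col U v).
Proof.
move=> pU x; have [uT uF] := pU x.
have e1 : a * (- x / v) = - (a * (x / v)) by rewrite mulNr mulrN.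
have e2 : a / (- x / v) = - (a / (x / v)) by rewrite mulNr invrN mulrN.
rewrite !(with_colTE, with_colFE) e1 e2 !sigmaN uT uF !scale_block_mx !scaler0 !scalerA.
by split; apply: block_mx_congr => //; congr (_ *: _); ring.
Qed.

Lemma dwpf_neg d tau (U : K -> bool -> 'M[K]_d) e f x xs : parity_op tau U ->
  dwpf U e f (- x :: xs) = - tau * dwpf U e f (x :: xs).
Proof.
by move=> pU; rewrite /dwpf /= (pU x).2 -!(scalemxAl, scalemxAr) mxE.
Qed.

Lemma fold_line_neg p q tau (U : K -> bool -> 'M[K]_p) (L : K -> bool -> 'M[K]_q) x N :
  tau * tau = 1 -> parity_op tau U -> parity_op tau L ->
  fold_line U L (- x) N = - fold_line U L x N.
Proof.
move=> t2 pU pL; rewrite /fold_line !(pU x).1 !(pL x).1 !(pU x).2 !(pL x).2.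
rewrite -!(scalemxAl, scalemxAr) !scalerA ?mulrN ?mulNr t2 !scaleN1r opprD.
by [].
Qed.

Lemma evpf_neg d tau (U : K -> bool -> 'M[K]_d) e f x xs :
  tau * tau = 1 -> parity_op tau U -> evpf U e f (- x :: xs) = - evpf U e f (x :: xs).
Proof.
by move=> t2 pU; rewrite /evpf /= (fold_line_neg _ _ t2) // mulmxN mulNmx mxE.
Qed.

Lemma sppf_neg d tau (U : K -> bool -> 'M[K]_d) e f v u x xs :
  tau * tau = 1 -> parity_op tau U ->
  sppf a U e f v u (- x :: xs) = - sppf a U e f v u (x :: xs).
Proof.
move=> t2 pU; rewrite /sppf /= (@fold_line_neg _ _ (- tau)) ?mulmxN ?mulNmx ?mxE //.
- by rewrite mulNr mulrN opprK.
- exact: parity_with_col.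
- exact: parity_with_col.
Qed.

Section Points.
Variables (d : nat) (U : K -> bool -> 'M[K]_d) (e : 'rV[K]_d) (f : 'cV[K]_d).
Variables (al be : K -> K) (tau : K).
Hypothesis eU : forall x, e *m U x true = al x *: e.
Hypothesis fU : forall x, U x true *m f = be x *: f.
Hypothesis exU : forall x x', x != 0 -> x' != 0 -> exch U x x'.
Hypothesis tau2 : tau * tau = 1.
Hypothesis pU : parity_op tau U.

Let exU_down x xs : x != 0 -> all (fun x => x != 0) xs ->
  forall x', x' \in xs -> x' != 0 /\ exch U x' x.
Proof. by move=> x0 /allP xs0 x' /xs0 x'0; split=> //; apply: exU. Qed.

Let exU_up x xs : x != 0 -> all (fun x => x != 0) xs ->
  forall x', x' \in xs -> x' != 0 /\ exch U x x'.
Proof. by move=> x0 /allP xs0 x' /xs0 x'0; split=> //; apply: exU. Qed.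

(** The even model is [sppf] with [u = v]; its recursion leads to the odd model at [x = v / a],
    where [odpf_down] applies once more. The two steps contribute the two equal factors of the
    square. *)
Lemma evpf_col_down x v xs : v != 0 -> x = v / a -> all (fun x => x != 0) xs ->
  evpf_col U e f v (x :: xs) =
  (s * (\prod_(x' <- xs) sg (a / (x' / v))) * be x) ^+ 2 * evpf U e f xs.
Proof.
move=> v0 xv xs0; have x0 : x != 0 by rewrite xv mulf_neq0 ?invr_neq0.
have := sppf_down a_neq0 e fU v v0 xv (exU_down x0 xs0).
rewrite /evpf_col /sppf -/(evpf _ _ _ _) => ->.
rewrite (odpf_down a_neq0 e fU v0 xv (exU_down x0 xs0)).
have -> : a / (x / v) = a ^+ 2 by rewrite xv; field; rewrite v0 a_neq0 oner_neq0.
by ring.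
Qed.

Lemma evpf_col_up x v xs : v != 0 -> x = a * v -> all (fun x => x != 0) xs ->
  evpf_col U e f v (x :: xs) =
  (s * (\prod_(x' <- xs) sg (a * (x' / v))) * al x) ^+ 2 * evpf U e f xs.
Proof.
move=> v0 xv xs0; have x0 : x != 0 by rewrite xv mulf_neq0.
have := sppf_up a_neq0 f eU x0 v0 v0 xv (exU_up x0 xs0).
rewrite /evpf_col /sppf -/(evpf _ _ _ _) => ->.
rewrite (odpf_up a_neq0 f eU v0 xv (exU_up x0 xs0)).
have -> : a / (x / v) = 1 by rewrite xv; field; rewrite v0 a_neq0.
by rewrite sigma1; ring.
Qed.

Lemma split_defect_down x v u xs : v != 0 -> u != 0 -> x = v / a ->
  all (fun x => x != 0) xs -> odd_defect U e f x u xs = 0 ->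
  split_defect U e f v u (x :: xs) = 0.
Proof.
move=> v0 u0 xv xs0; have x0 : x != 0 by rewrite xv mulf_neq0 ?invr_neq0.
rewrite /odd_defect /split_defect => hO.
rewrite (sppf_down a_neq0 e fU u v0 xv (exU_down x0 xs0)).
rewrite {2 4}/dwpf_col (dwpf_down a_neq0 e fU v0 xv (exU_down x0 xs0)).
rewrite (evpf_col_down v0 xv xs0).
move: (\prod_(_ <- _) _) (be x) s (odpf _ _ _ _ _ _ _) (dwpf_col _ _ _ _ _) (dwpf _ _ _ _) hO.
move: (evpf _ _ _ _) (evpf_col _ _ _ _ _) => E Ec P b s od Dc D hO.
(* The quotient of the bracket prefactors, [a * u - v / a = a * u - x] by [a * x * u], times the
   square lost by the models with column [v]. The first terms agree by the factorization of sigma(a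
   u / x). *)
pose kk := (s * P * b) ^+ 2 * (a * u - x) / (a * x * u).
have vx : v = a * x by rewrite xv; field.
apply: (@lincomb _ _ _ kk _ _ 0 0 0 0 0 0 0 0 0 hO erefl erefl erefl).
by rewrite /kk vx /sigma; field; rewrite ?a_neq0 ?x0 ?u0.
Qed.

Lemma split_defect_up x v u xs : v != 0 -> u != 0 -> x = a * v ->
  all (fun x => x != 0) xs -> odd_defect U e f x u xs = 0 ->
  split_defect U e f v u (x :: xs) = 0.
Proof.
move=> v0 u0 xv xs0; have x0 : x != 0 by rewrite xv mulf_neq0.
rewrite /odd_defect /split_defect => hO.
rewrite (sppf_up a_neq0 f eU x0 v0 u0 xv (exU_up x0 xs0)).
rewrite {2 4}/dwpf_col (dwpf_up a_neq0 f xs eU v0 xv).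
rewrite (evpf_col_up v0 xv xs0).
move: (\prod_(_ <- _) _) (al x) (odpf _ _ _ _ _ _ _) (dwpf_col _ _ _ _ _) (dwpf _ _ _ _) hO.
move: (evpf _ _ _ _) (evpf_col _ _ _ _ _) => E Ec P b od Dc D hO.
(* Again the quotient of the prefactors, now with [v = x / a]; the first terms agree because sigma(a
   u / x) + sigma(a^2) = (a u / x + a^2)(1 - x / (a^3 u)). *)
pose kk := (s * P * b) ^+ 2 * (a ^+ 3 * u - x) / (a ^+ 3 * x * u).
have vx : v = x / a by rewrite xv; field.
apply: (@lincomb _ _ _ kk _ _ 0 0 0 0 0 0 0 0 0 hO erefl erefl erefl).
by rewrite /kk vx /sigma; field; rewrite ?a_neq0 ?x0 ?u0.
Qed.

(** Both terms of the bracket reduce to the same value, and twice that value matches the first term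
    by sigma(a^2) = sigma(a)(a + 1/a). *)
Lemma odd_defect_down x u xs : u != 0 -> x = u / a -> all (fun x => x != 0) xs ->
  odd_defect U e f x u xs = 0.
Proof.
move=> u0 xu xs0; have x0 : x != 0 by rewrite xu mulf_neq0 ?invr_neq0.
rewrite /odd_defect (odpf_down a_neq0 e fU u0 xu (exU_down x0 xs0)).
rewrite /dwpf_col (dwpf_down a_neq0 e fU u0 xu (exU_down x0 xs0)).
rewrite (evpf_col_down u0 xu xs0).
move: (\prod_(_ <- _) _) (be x) (dwpf _ _ _ _) (evpf _ _ _ _) => P b D E.
have ux : u = a * x by rewrite xu; field.
by rewrite ux /sigma; field; rewrite a_neq0.
Qed.

Lemma odd_defect_up x u xs : u != 0 -> x = a * u -> all (fun x => x != 0) xs ->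
  odd_defect U e f x u xs = 0.
Proof.
move=> u0 xu xs0; have x0 : x != 0 by rewrite xu mulf_neq0.
rewrite /odd_defect (odpf_up a_neq0 f eU u0 xu (exU_up x0 xs0)).
rewrite /dwpf_col (dwpf_up a_neq0 f xs eU u0 xu).
rewrite (evpf_col_up u0 xu xs0).
move: (\prod_(_ <- _) _) (al x) (dwpf _ _ _ _) (evpf _ _ _ _) => P b D E.
by rewrite xu /sigma; field; rewrite a_neq0.
Qed.

Lemma dwpf_col_neg x u xs :
  dwpf_col U e f u (- x :: xs) = tau * dwpf_col U e f u (x :: xs).
Proof.
by rewrite /dwpf_col (dwpf_neg _ _ _ _ (parity_with_col u pU)) opprK.
Qed.

Lemma evpf_col_neg x u xs : evpf_col U e f u (- x :: xs) = - evpf_col U e f u (x :: xs).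
Proof.
apply: evpf_neg (parity_with_col u pU); by rewrite mulNr mulrN opprK.
Qed.

(** The factor [a * x + u] removes [odpf], and the terms of the bracket, equal at [u / a], are
    opposite here since [evpf_col] is odd in [x]. *)
Lemma odd_defect_Ndown x u xs : u != 0 -> x = - (u / a) -> all (fun x => x != 0) xs ->
  odd_defect U e f x u xs = 0.
Proof.
move=> u0 xu xs0; rewrite /odd_defect.
have -> : a * x + u = 0 by rewrite xu; field.
rewrite {}xu dwpf_col_neg evpf_col_neg; set x' := u / a.
have x0 : x' != 0 by rewrite mulf_neq0 ?invr_neq0.
rewrite (evpf_col_down u0 erefl xs0) exprMn expr2 tau2.
rewrite /dwpf_col (dwpf_down a_neq0 e fU u0 erefl (exU_down x0 xs0)).
by ring.
Qed.

Lemma odd_defect_Nup x u xs : u != 0 -> x = - (a * u) -> all (fun x => x != 0) xs ->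
  odd_defect U e f x u xs = 0.
Proof.
move=> u0 xu xs0; rewrite /odd_defect.
have -> : a * u + x = 0 by rewrite xu subrr.
rewrite {}xu dwpf_col_neg evpf_col_neg; set x' := a * u.
have x0 : x' != 0 by rewrite mulf_neq0.
rewrite (evpf_col_up u0 erefl xs0) exprMn expr2 tau2.
rewrite /dwpf_col (dwpf_up a_neq0 f xs eU u0 erefl).
by ring.
Qed.

Lemma split_defect_neg x v u xs :
  split_defect U e f v u (- x :: xs) = - split_defect U e f v u (x :: xs).
Proof.
have t2 : - tau * - tau = 1 by rewrite mulNr mulrN opprK.
rewrite /split_defect (sppf_neg _ _ _ _ _ _ tau2 pU) !dwpf_col_neg !evpf_col_neg.
rewrite !exprMn [tau ^+ 2]expr2 tau2 !mul1r.
move: (sppf _ _ _ _ _ _ _) (dwpf_col _ _ _ _ _) (dwpf_col _ _ _ v _) => S Du Dv.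
move: (evpf_col _ _ _ _ _) (evpf_col _ _ _ u _) => Ev Eu.
apply: (@lincomb _ _ _ (- ((u + v) * sg a * S * Du * Dv)) _ _
  0 0 0 0 0 0 0 0 0 tau2 erefl erefl erefl).
by ring.
Qed.

End Points.

Section SplitPoints.
Variables (d : nat) (W : K -> bool -> 'M[K]_d) (e : 'rV[K]_d) (f : 'cV[K]_d).
Variables (al be : K -> K).
Hypothesis eW : forall x, e *m W x true = al x *: e.
Hypothesis fW : forall x, W x true *m f = be x *: f.
Hypothesis exW : forall x x', x != 0 -> x' != 0 -> exch W x x'.
Local Notation e1 := (row_mx e 0).
Local Notation f1 := (col_mx 0 f).

Lemma eigen_up_with_col u x :
  e1 *m with_col W u x true = (sg (a * (x / u)) * al x) *: e1.
Proof. by rewrite up_with_colT eW scale_row_mx scaler0 scalerA. Qed.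

Lemma eigen_dn_with_col u x :
  with_col W u x true *m f1 = (sg (a / (x / u)) * be x) *: f1.
Proof. by rewrite with_col_dnT fW scale_col_mx scaler0 scalerA. Qed.

Lemma exch_all_with_col u : u != 0 ->
  forall x x', x != 0 -> x' != 0 -> exch (with_col W u) x x'.
Proof. by move=> u0 x x' x0 x'0; apply: exch_with_col => //; apply: exW. Qed.

Lemma odd_defect_split_down x v u xs : v != 0 -> u != 0 -> x = v / a ->
  sg (a ^+ 2 * v / u) != 0 -> all (fun x => x != 0) xs ->
  split_defect W e f v u xs = 0 ->
  odd_defect (with_col W v) e1 f1 x u xs = 0.
Proof.
move=> v0 u0 xv r0 xs0; have x0 : x != 0 by rewrite xv mulf_neq0 ?invr_neq0.
have xxs0 : all (fun x => x != 0) (x :: xs) by rewrite /= x0.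
have csw := conj_ops_swap_col a_neq0 W e f v0 u0.
rewrite /odd_defect /split_defect => hS.
have exx x' : x' \in xs -> x' != 0 /\ exch W x' x.
  by move=> /(allP xs0) x'0; split=> //; apply: exW.
rewrite (odpf_split_down a_neq0 e fW u v0 xv exx).
have exU' x' : x' \in xs -> x' != 0 /\ exch (with_col W u) x' x.
  by move=> /(allP xs0) x'0; split=> //; apply: exch_all_with_col.
have -> : dwpf_col (with_col W v) e1 f1 u (x :: xs) =
    sg (a / (x / u)) * (s * \prod_(x' <- xs) sg (a / (x' / v)) * be x) *
    dwpf_col W e f u xs.
  (* The columns are exchanged so that [v] becomes the last one, which the recursion at [x = v / a]
     removes. *)
  apply: (mulfI r0); have := conj_dwpf csw xxs0; rewrite expr1n mul1r => ->.
  congr (_ * _); rewrite (dwpf_down a_neq0 _ (eigen_dn_with_col u) v0 xv exU').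
  by rewrite /dwpf_col; ring.
have -> : evpf_col (with_col W v) e1 f1 u (x :: xs) =
    (sg (a / (x / u)) * (s * \prod_(x' <- xs) sg (a / (x' / v)) * be x)) ^+ 2 *
    evpf_col W e f u xs.
  apply: (mulfI r0); have := conj_evpf (mul1r 1) csw xxs0 => ->; congr (_ * _).
  have := @evpf_col_down _ _ e1 f1 _ (eigen_dn_with_col u) (exch_all_with_col u0) x v xs v0 xv xs0.
  by rewrite /evpf_col => ->; ring.
rewrite -/(dwpf_col W e f v xs) -/(evpf_col W e f v xs).
move: (\prod_(_ <- _) _) (be x) (sppf _ _ _ _ _ _ _) hS => P b S.
move: (dwpf_col _ _ _ _ _) (dwpf_col _ _ _ v _) (evpf_col _ _ _ _ _) (evpf_col _ _ _ v _).
move=> Du Dv Eu Ev hS.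
pose kk := (s * P * b) ^+ 2 * sg (a / (x / u)) * (a * u + x).
have vx : v = a * x by rewrite xv; field.
apply: (@lincomb _ _ _ kk _ _ 0 0 0 0 0 0 0 0 0 hS erefl erefl erefl).
by rewrite /kk vx; move: s => t; rewrite /sigma; field; rewrite ?a_neq0 ?x0 ?u0.
Qed.

Lemma odd_defect_split_up x v u xs : v != 0 -> u != 0 -> x = a * v ->
  sg (a ^+ 2 * v / u) != 0 -> all (fun x => x != 0) xs ->
  split_defect W e f u v xs = 0 ->
  odd_defect (with_col W v) e1 f1 x u xs = 0.
Proof.
move=> v0 u0 xv r0 xs0; have x0 : x != 0 by rewrite xv mulf_neq0.
have xxs0 : all (fun x => x != 0) (x :: xs) by rewrite /= x0.
have csw := conj_ops_swap_col a_neq0 W e f v0 u0.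
rewrite /odd_defect /split_defect => hS.
have exx x' : x' \in xs -> x' != 0 /\ exch W x x'.
  by move=> /(allP xs0) x'0; split=> //; apply: exW.
rewrite (odpf_split_up a_neq0 f eW u v0 xv exx).
have -> : dwpf_col (with_col W v) e1 f1 u (x :: xs) =
    sg (a * (x / u)) * (s * \prod_(x' <- xs) sg (a * (x' / v)) * al x) *
    dwpf_col W e f u xs.
  apply: (mulfI r0); have := conj_dwpf csw xxs0; rewrite expr1n mul1r => ->.
  congr (_ * _); rewrite (dwpf_up a_neq0 _ _ (eigen_up_with_col u) v0 xv).
  by rewrite /dwpf_col; ring.
have -> : evpf_col (with_col W v) e1 f1 u (x :: xs) =
    (sg (a * (x / u)) * (s * \prod_(x' <- xs) sg (a * (x' / v)) * al x)) ^+ 2 *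
    evpf_col W e f u xs.
  apply: (mulfI r0); have := conj_evpf (mul1r 1) csw xxs0 => ->; congr (_ * _).
  have := @evpf_col_up _ _ e1 f1 _ (eigen_up_with_col u) (exch_all_with_col u0) x v xs v0 xv xs0.
  by rewrite /evpf_col => ->; ring.
rewrite -/(dwpf_col W e f v xs) -/(evpf_col W e f v xs).
move: (\prod_(_ <- _) _) (al x) (sppf _ _ _ _ _ _ _) hS => P b S.
move: (dwpf_col _ _ _ _ _) (dwpf_col _ _ _ v _) (evpf_col _ _ _ _ _) (evpf_col _ _ _ v _).
move=> Du Dv Eu Ev hS.
(* The last factor [a] comes from [a * u + x = a * (u + v)]; the rest matches by sigma(a x / u) = (a
   x - u)(a x + u)/(a x u). *)
pose kk := (s * P * b) ^+ 2 * sg (a * (x / u)) * (a * x + u) * a.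
have vx : v = x / a by rewrite xv; field.
apply: (@lincomb _ _ _ kk _ _ 0 0 0 0 0 0 0 0 0 hS erefl erefl erefl).
by rewrite /kk vx; move: s => t; rewrite /sigma; field; rewrite ?a_neq0 ?x0 ?u0.
Qed.
End SplitPoints.

(** Every term acquires an even power of [eps] and the cube of [c2 / c1], which is a sign and hence
    its own cube. *)
Lemma odd_defect_conj d (U U' : K -> bool -> 'M[K]_d) e f eps c1 c2 x u xs :
  eps * eps = 1 -> c1 * c1 = c2 * c2 -> c1 != 0 -> conj_ops eps c1 c2 U U' e f ->
  all (fun x => x != 0) (x :: xs) ->
  odd_defect U e f x u xs = c2 / c1 * odd_defect U' e f x u xs.
Proof.
move=> eps2 c12 c10 cU xxs0; have /andP[_ xs0] := xxs0.
have cUu := conj_ops_with_col a u cU.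
have e1 : odpf a U e f x u xs = eps * c2 / c1 * odpf a U' e f x u xs.
  apply: (mulfI c10); rewrite (conj_odpf a u eps2 cU xxs0); field; exact: c10.
have e2 : dwpf U e f xs = eps ^+ size xs * c2 / c1 * dwpf U' e f xs.
  apply: (mulfI c10); rewrite (conj_dwpf cU xs0); field; exact: c10.
have e3 : evpf U e f xs = c2 / c1 * evpf U' e f xs.
  apply: (mulfI c10); rewrite (conj_evpf eps2 cU xs0); field; exact: c10.
have e4 : dwpf_col U e f u (x :: xs) =
    eps ^+ (size xs).+1 * c2 / c1 * dwpf_col U' e f u (x :: xs).
  apply: (mulfI c10); rewrite /dwpf_col (conj_dwpf cUu xxs0); field; exact: c10.
have e5 : evpf_col U e f u (x :: xs) = c2 / c1 * evpf_col U' e f u (x :: xs).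
  apply: (mulfI c10); rewrite /evpf_col (conj_evpf eps2 cUu xxs0); field; exact: c10.
have en : eps ^+ size xs * eps ^+ size xs = 1 by rewrite -exprMn eps2 expr1n.
rewrite /odd_defect {}e1 {}e2 {}e3 {}e4 {}e5 exprS.
have k2 : c2 / c1 * (c2 / c1) = 1 by rewrite mulrACA -invfM -c12 mulfV // mulf_neq0.
move: (eps ^+ size xs) en => E en; rewrite -!(mulrA _ c2); move: (c2 / c1) k2 => k k2.
move: (odpf _ _ _ _ _ _ _) (dwpf _ _ _ _) (dwpf_col _ _ _ _ _) => od D Dc.
move: (evpf _ _ _ _) (evpf_col _ _ _ _ _) => Ev Ec.
transitivity (k * (E * E * (eps * eps) * (k * k) *
    (sg a * (a * x + u) * (a * u + x) * od * D * Dc - a * x * u * (Dc ^+ 2 * Ev)) -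
  E * E * (k * k) * (a * x * u * (D ^+ 2 * Ec)))); first by ring.
by rewrite en eps2 k2; ring.
Qed.
End Defects.

(** * Degree bounds *)

Section Laurent.
Variable K : numFieldType.
Notation sg := (@sigma K).
Implicit Types (p q : {poly K}) (f g : K -> K).

Lemma poly_eq0_nz p : (forall t, t != 0 -> p.[t] = 0) -> p = 0.
Proof.
move=> h; apply/eqP/negPn/negP => p0.
have := @max_poly_roots _ p [seq i.+1%:R | i <- iota 0 (size p)] p0.
rewrite size_map size_iota ltnn => hmax; suff: false by []; apply: hmax.
  by apply/allP => _ /mapP[i _ ->]; rewrite /root h ?pnatr_eq0.
by rewrite map_inj_uniq ?iota_uniq // => i j /eqP; rewrite eqr_nat => /eqP[].
Qed.

Lemma poly_eq_nz p q : (forall t, t != 0 -> p.[t] = q.[t]) -> p = q.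
Proof.
move=> h; apply/subr0_eq/poly_eq0_nz => t t0.
by rewrite hornerD hornerN h // subrr.
Qed.

Lemma leq_size_mul (p q : {poly K}) k l :
  (size p <= k)%N -> (size q <= l.+1)%N -> (size (p * q)%R <= k + l)%N.
Proof. by move=> hp hq; apply: leq_trans (size_polyMleq _ _) _; lia. Qed.

(* Laurent polynomials with exponents in [-N, N]. *)
Definition lau N f :=
  exists2 p : {poly K}, (size p <= N.*2.+1)%N & forall t, t != 0 -> f t * t ^+ N = p.[t].

Lemma lau_ext N f g : f =1 g -> lau N f -> lau N g.
Proof. by move=> fg [p hp h]; exists p => // t t0; rewrite -fg h. Qed.

Lemma lau_const N c : lau N (fun=> c).
Proof.
exists (c *: 'X^N) => [|t t0]; last by rewrite hornerZ hornerXn.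
by apply: leq_trans (size_scale_leq _ _) _; rewrite size_polyXn; lia.
Qed.

Lemma lau_add N f g : lau N f -> lau N g -> lau N (fun t => f t + g t).
Proof.
move=> [p hp fp] [q hq gq]; exists (p + q) => [|t t0].
  by apply: leq_trans (size_polyD _ _) _; rewrite geq_max hp.
by rewrite mulrDl fp // gq // hornerD.
Qed.

Lemma lau_mul N M f g : lau N f -> lau M g -> lau (N + M) (fun t => f t * g t).
Proof.
move=> [p hp fp] [q hq gq]; exists (p * q) => [|t t0].
  by apply: leq_trans (size_polyMleq _ _) _; lia.
by rewrite exprD mulrACA fp // gq // hornerM.
Qed.

Lemma lau_cmul N c f : lau N f -> lau N (fun t => c * f t).
Proof. by move=> hf; have := lau_mul (lau_const 0 c) hf. Qed.

Lemma lau_widen N M f : (N <= M)%N -> lau N f -> lau M f.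
Proof.
move=> NM hf; have := lau_mul hf (lau_const (M - N) 1); rewrite subnKC //.
by apply: lau_ext => t; rewrite mulr1.
Qed.

Lemma lau_sum N (I : Type) (r : seq I) (F : I -> K -> K) :
  (forall i, lau N (F i)) -> lau N (fun t => \sum_(i <- r) F i t).
Proof.
move=> h; elim: r => [|i r IHr].
  by apply: lau_ext (lau_const N 0) => t; rewrite big_nil.
by apply: lau_ext (lau_add (h i) IHr) => t; rewrite big_cons.
Qed.

Lemma lau_sigma_num c : lau 1 (fun t => sg (c * t)).
Proof.
exists (c *: 'X^2 - c^-1%:P) => [|t t0].
  apply: leq_trans (size_polyD _ _) _; rewrite geq_max size_polyN.
  rewrite (leq_trans (size_scale_leq _ _)) ?size_polyXn //.
  by rewrite (leq_trans (size_polyC_leq1 _)).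
rewrite hornerD hornerN hornerZ hornerXn hornerC /sigma expr1 invfM.
by rewrite mulrBl -!mulrA mulVf // mulr1 expr2.
Qed.

Lemma lau_sigma_den c : lau 1 (fun t => sg (c / t)).
Proof.
apply: lau_ext (lau_cmul (- 1) (lau_sigma_num c^-1)) => t.
by rewrite /sigma !invfM !invrK mulN1r opprB.
Qed.

(* The parity hypothesis excludes the exponents [N + 1] and [- N - 1]. *)
Lemma lau_tight N f : (forall t, f (- t) = (- 1) ^+ N * f t) -> lau N.+1 f -> lau N f.
Proof.
move=> fN [p hp fp].
(* Multiplication by [t ^+ N.+1] turns the parity of [f] into oddness of [p]; its coefficients of
   index 0 and 2N + 2 therefore vanish, and [p] can be divided by its variable. *)
have pN : \poly_(i < size p) ((- 1) ^+ i * p`_i) = - p.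
  apply: poly_eq_nz => t t0; rewrite hornerN -fp //.
  have <- : p.[- t] = (\poly_(i < size p) ((- 1) ^+ i * p`_i)).[t].
    rewrite horner_poly horner_coef; apply: eq_bigr => i _.
    by rewrite (exprNn t) mulrA [p`_i * _]mulrC.
  rewrite -fp ?oppr_eq0 // fN [(- t) ^+ _]exprNn mulrACA -exprD addnS exprS.
  by rewrite addnn -mul2n exprM sqrrN !expr1n mulr1 mulN1r.
have peven i : ~~ odd i -> p`_i = 0.
  move=> oi; have := congr1 (fun q : {poly K} => q`_i) pN.
  rewrite coef_poly coefN -signr_odd (negbTE oi) mul1r.
  case: ltnP => [_ /eqP|/leq_sizeP -> //]; rewrite -addr_eq0 -mulr2n mulrn_eq0 /=.
  by move/eqP.
exists (\poly_(i < N.*2.+1) p`_i.+1) => [|t t0]; first exact: size_poly.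
apply: (mulIf t0); rewrite -mulrA -exprSr fp // horner_poly mulr_suml.
have hp' : (size p <= N.*2.+2)%N.
  apply/leq_sizeP => i; rewrite leq_eqVlt => /orP[/eqP<-|hi].
    by apply: peven; rewrite /= !negbK odd_double.
  by move/leq_sizeP: hp => -> //; rewrite doubleS.
rewrite (horner_coef_wide _ hp') big_ord_recl peven // mul0r add0r.
by apply: eq_bigr => i _; rewrite exprSr mulrA.
Qed.

Definition mlau m n N (F : K -> 'M[K]_(m, n)) := forall i j, lau N (fun t => F t i j).

Lemma mlau_const m n N (M : 'M[K]_(m, n)) : mlau N (fun=> M).
Proof. by move=> i j; apply: lau_const. Qed.

Lemma mlau_add m n N (F G : K -> 'M[K]_(m, n)) :
  mlau N F -> mlau N G -> mlau N (fun t => F t + G t).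
Proof.
by move=> hF hG i j; apply: lau_ext (lau_add (hF i j) (hG i j)) => t; rewrite mxE.
Qed.

Lemma mlau_mul m n l N M (F : K -> 'M[K]_(m, n)) (G : K -> 'M[K]_(n, l)) :
  mlau N F -> mlau M G -> mlau (N + M) (fun t => F t *m G t).
Proof.
move=> hF hG i j.
apply: lau_ext (lau_sum (index_enum _) (fun k => lau_mul (hF i k) (hG k j))) => t.
by rewrite mxE.
Qed.

Lemma mlau_scale m n N M f (F : K -> 'M[K]_(m, n)) :
  lau N f -> mlau M F -> mlau (N + M) (fun t => f t *: F t).
Proof.
by move=> hf hF i j; apply: lau_ext (lau_mul hf (hF i j)) => t; rewrite mxE.
Qed.

Lemma mlau_block m1 m2 n1 n2 N (A : K -> 'M[K]_(m1, n1)) (B : K -> 'M_(m1, n2))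
    (C : K -> 'M_(m2, n1)) (D : K -> 'M_(m2, n2)) :
  mlau N A -> mlau N B -> mlau N C -> mlau N D ->
  mlau N (fun t => block_mx (A t) (B t) (C t) (D t)).
Proof.
move=> hA hB hC hD i j; rewrite -(splitK i) -(splitK j).
case: (split i) (split j) => {}i [] {}j /=.
- by apply: lau_ext (hA i j) => t; rewrite block_mxEul.
- by apply: lau_ext (hB i j) => t; rewrite block_mxEur.
- by apply: lau_ext (hC i j) => t; rewrite block_mxEdl.
- by apply: lau_ext (hD i j) => t; rewrite block_mxEdr.
Qed.

Lemma mlau_row m n1 n2 N (A : K -> 'M[K]_(m, n1)) (B : K -> 'M_(m, n2)) :
  mlau N A -> mlau N B -> mlau N (fun t => row_mx (A t) (B t)).
Proof.
move=> hA hB i j; rewrite -(splitK j); case: (split j) => {}j /=.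
- by apply: lau_ext (hA i j) => t; rewrite row_mxEl.
- by apply: lau_ext (hB i j) => t; rewrite row_mxEr.
Qed.
End Laurent.

(** * Degrees of the partition functions in one parameter, and the interpolation points *)

Section Degrees.
Variables (K : numFieldType) (a : K).
Hypothesis a_neq0 : a != 0.
Notation s := (sigma (a ^+ 2)).
Notation sg := (@sigma K).
Notation with_col := (with_column a).
Notation row_op := (row_op a).
Implicit Types (x v u : K) (xs : seq K) (y : nat -> K).

Lemma mlau_with_col_l d (U : K -> bool -> 'M[K]_d) x r :
  mlau 1 (fun t => with_col U t x r).
Proof.
have h1 : lau 1 (fun t => sg (a * (x / t))).
  by apply: lau_ext (lau_sigma_den (a * x)) => t; rewrite mulrA.
have h2 : lau 1 (fun t => sg (a / (x / t))).
  by apply: lau_ext (lau_sigma_num (a / x)) => t; rewrite invf_div mulrA mulrAC.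
have hs c (M : 'M[K]_d) : lau 1 c -> mlau 1 (fun t => c t *: M).
  by move=> hc; apply: (mlau_scale hc (mlau_const 0 M)).
by case: r; apply: mlau_block;
  first [exact: hs h1 | exact: hs h2 | exact: (mlau_const 1 (s *: _)) | exact: (mlau_const 1 0)].
Qed.

Lemma mlau_with_col_r d N (U : K -> bool -> 'M[K]_d) v r :
  (forall r, mlau N (fun t => U t r)) -> mlau N.+1 (fun t => with_col U v t r).
Proof.
move=> hU.
have h1 : lau 1 (fun t => sg (a * (t / v))).
  by apply: lau_ext (lau_sigma_num (a / v)) => t; rewrite mulrA mulrAC.
have h2 : lau 1 (fun t => sg (a / (t / v))).
  by apply: lau_ext (lau_sigma_den (a * v)) => t; rewrite invf_div mulrA.
have h3 : lau 1 (fun=> s) by exact: lau_const.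
have hs c (M : K -> 'M[K]_d) : lau 1 c -> mlau N M -> mlau N.+1 (fun t => c t *: M t).
  by move=> hc hM; apply: (mlau_scale hc hM).
case: r; apply: mlau_block.
- exact: (hs _ _ h1 (hU true)).
- exact: (mlau_const N.+1 0).
- exact: (hs _ _ h3 (hU false)).
- exact: (hs _ _ h2 (hU true)).
- exact: (hs _ _ h2 (hU false)).
- exact: (hs _ _ h3 (hU true)).
- exact: (mlau_const N.+1 0).
- exact: (hs _ _ h1 (hU false)).
Qed.

Lemma mlau_row_op y n r : mlau n (fun t => row_op y n t r).
Proof.
elim: n r => [|n IHn] r; first exact: mlau_const.
exact: mlau_with_col_r.
Qed.

Lemma mlau_nest p q (U : K -> K -> bool -> 'M[K]_p) (L : K -> K -> bool -> 'M[K]_q)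
    (M : K -> 'M[K]_(p, q)) m k l xs :
  (forall x r, mlau k (fun t => U t x r)) -> (forall x r, mlau l (fun t => L t x r)) ->
  mlau m M -> mlau (m + size xs * (k + l)) (fun t => nest (U t) (L t) xs (M t)).
Proof.
move=> hU hL hM; elim: xs => [|x xs IHxs] /=; first by rewrite mul0n addn0.
have -> : (m + (size xs).+1 * (k + l) = k + (m + size xs * (k + l)) + l)%N by lia.
by apply: mlau_add; apply: mlau_mul => //; apply: mlau_mul.
Qed.

Lemma lau_matrix_element p q (e : 'rV[K]_p) (f : 'cV[K]_q) N (M : K -> 'M[K]_(p, q)) :
  mlau N M -> lau N (fun t => (e *m M t *m f) 0 0).
Proof.
move=> hM; have h1 := mlau_mul (mlau_const 0 e) hM.
by have := mlau_mul h1 (mlau_const 0 f) 0 0; rewrite addn0.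
Qed.

(** Only the upper half crosses the column of parameter [t], so the bound is half that for
    [evpf_col]. *)
Lemma lau_sppf d (U : K -> bool -> 'M[K]_d) e f u xs :
  lau (size xs) (fun t => sppf a U e f t u xs).
Proof.
apply: lau_matrix_element; rewrite -[size xs]muln1 -[(_ * 1)%N]add0n.
apply: (mlau_nest (k := 1) (l := 0)); last exact: mlau_const.
  by move=> x r; apply: mlau_with_col_l.
by move=> x r; apply: mlau_const.
Qed.

Lemma lau_evpf_col_l d (U : K -> bool -> 'M[K]_d) e f xs :
  lau (size xs).*2 (fun t => evpf_col a U e f t xs).
Proof.
apply: lau_matrix_element; rewrite -muln2 -[(_ * 2)%N]add0n.
apply: (mlau_nest (k := 1) (l := 1)); last exact: mlau_const.
  by move=> x r; apply: mlau_with_col_l.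
by move=> x r; apply: mlau_with_col_l.
Qed.

Lemma lau_dwpf_col_l d (U : K -> bool -> 'M[K]_d) e f xs :
  lau (size xs) (fun t => dwpf_col a U e f t xs).
Proof.
have h : mlau (size xs) (fun t =>
    foldr (fun x w => with_col U t x false *m w) (col_mx 0 f) xs).
  elim: xs => [|x xs IHxs] /=; first exact: mlau_const.
  exact: (mlau_mul (mlau_with_col_l U x false) IHxs).
exact: (mlau_mul (mlau_const 0 (row_mx e 0)) h 0 0).
Qed.

Lemma lau_odpf y n e f u xs :
  lau n (fun t => odpf a (row_op y n) e f t u xs).
Proof.
apply: lau_matrix_element.
have := mlau_nest (U := fun=> row_op y n) (L := fun=> with_col (row_op y n) u)
  (k := 0) (l := 0) (m := n) (M := fun t => row_mx (row_op y n t false) (row_op y n t true)) xs.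
rewrite muln0 addn0; apply.
- by move=> x r; apply: mlau_const.
- by move=> x r; apply: mlau_const.
- by apply: mlau_row; apply: mlau_row_op.
Qed.

Lemma lau_dwpf_col_r y n e f u xs :
  lau n.+1 (fun t => dwpf_col a (row_op y n) e f u (t :: xs)).
Proof.
have h : mlau n.+1 (fun t => with_col (row_op y n) u t false).
  by apply: mlau_with_col_r => r; apply: mlau_row_op.
have := mlau_mul (mlau_const 0 (row_mx e 0)) (mlau_mul h (mlau_const 0
  (foldr (fun x w => with_col (row_op y n) u x false *m w) (col_mx 0 f) xs))) 0 0.
by rewrite addn0.
Qed.

Lemma lau_evpf_col_r y n e f u xs :
  lau n.+1.*2 (fun t => evpf_col a (row_op y n) e f u (t :: xs)).
Proof.
apply: lau_matrix_element; rewrite -addnn.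
have h r : mlau n.+1 (fun t => with_col (row_op y n) u t r).
  by apply: mlau_with_col_r => r'; apply: mlau_row_op.
apply: mlau_add; apply: mlau_mul => //.
  by rewrite -[n.+1]addn0; apply: mlau_mul => //; apply: mlau_const.
by rewrite -[n.+1]addn0; apply: mlau_mul => //; apply: mlau_const.
Qed.

(** The special points of [x] have squares a^2 x^2 and x^2 / a^2, so this keeps them apart from
    those of [x']. It also gives nonzero crossing weights, by which exchange relations can be
    divided. *)
Definition goodp x x' :=
  [&& x ^+ 2 != x' ^+ 2, a ^+ 4 * x ^+ 2 != x' ^+ 2 & a ^+ 4 * x' ^+ 2 != x ^+ 2].

Lemma goodp_sym x x' : goodp x x' = goodp x' x.
Proof. by rewrite /goodp eq_sym [X in _ && X]andbC. Qed.

Lemma goodpN x x' : goodp (- x) x' = goodp x x'.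
Proof. by rewrite /goodp sqrrN. Qed.

Lemma goodp_sigma x x' : x != 0 -> x' != 0 -> goodp x x' -> sg (a ^+ 2 * x / x') != 0.
Proof.
move=> x0 x'0 /and3P[_ h _]; apply: contraNneq h => h0.
have z0 : a ^+ 2 * x / x' != 0 by rewrite !mulf_neq0 ?invr_neq0 ?expf_neq0.
have : (a ^+ 2 * x / x') ^+ 2 = 1.
  by have /eqP := congr1 (fun z => (a ^+ 2 * x / x') * z) h0;
    rewrite /sigma mulr0 mulrBr mulfV // subr_eq0 => /eqP.
by move=> e1; apply/eqP; rewrite -[RHS]mul1r -e1; field.
Qed.

Hypothesis a4 : a ^+ 4 != 1.

Definition special_points x := [:: a * x; - (a * x); x / a; - (x / a)].

Lemma uniq_special_points xs : all (fun x => x != 0) xs -> pairwise goodp xs ->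
  uniq (flatten (map special_points xs)).
Proof.
have sq z x : z \in special_points x -> a ^+ 2 * z ^+ 2 = a ^+ 4 * x ^+ 2 \/
    a ^+ 2 * z ^+ 2 = x ^+ 2.
  by rewrite !inE => /or4P[] /eqP->; [left|left|right|right]; field.
elim: xs => // x xs IHxs /andP[x0 xs0] /andP[gx gxs].
have -> : flatten (map special_points (x :: xs)) =
  special_points x ++ flatten (map special_points xs) by [].
rewrite cat_uniq IHxs // andbT; apply/andP; split; last first.
  apply/hasPn => z /flattenP[_ /mapP[x' x'xs ->]] /sq zx'; apply/negP => /sq zx.
  have /and3P[g1 g2 g3] := allP gx _ x'xs.
  have a40 : a ^+ 4 != 0 by rewrite expf_neq0.
  case: zx zx' => -> [].
  - by move/(mulfI a40)/eqP; rewrite (negPf g1).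
  - by move/eqP; rewrite (negPf g2).
  - by move/esym/eqP; rewrite (negPf g3).
  - by move/eqP; rewrite (negPf g1).
have x20 : x ^+ 2 != 0 by rewrite expf_neq0.
have h1 : a ^+ 4 * x ^+ 2 != x ^+ 2.
  by rewrite -subr_eq0 -{2}[x ^+ 2]mul1r -mulrBl mulf_neq0 ?subr_eq0.
have xa : a ^+ 2 * (x / a) ^+ 2 = x ^+ 2 by field.
have nx (z : K) : z != 0 -> z != - z.
  by move=> z0; rewrite -addr_eq0 -mulr2n mulrn_eq0.
rewrite /special_points /= !inE !negb_or !andbT eqr_opp.
have d1 : a * x != x / a.
  apply: contraNneq h1 => e1; apply/eqP.
  by transitivity (a ^+ 2 * (a * x) ^+ 2); [ring|rewrite e1 xa].
have d2 : a * x != - (x / a).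
  apply: contraNneq h1 => e1; apply/eqP.
  by transitivity (a ^+ 2 * (a * x) ^+ 2); [ring|rewrite e1 sqrrN xa].
rewrite d1 d2 nx ?mulf_neq0 //= nx ?mulf_neq0 ?invr_neq0 //= !andbT.
by rewrite eqr_oppLR d2.
Qed.

Lemma special_roots (p : {poly K}) xs :
  all (fun x => x != 0) xs -> pairwise goodp xs -> (size p <= 4 * size xs)%N ->
  (forall x, x \in xs -> all (root p) (special_points x)) -> p = 0.
Proof.
move=> xs0 gxs sp hp; apply/eqP/negPn/negP => p0.
have := max_poly_roots p0 _ (uniq_special_points xs0 gxs).
have -> : size (flatten (map special_points xs)) = (4 * size xs)%N.
  by elim: (xs) => //= ? ? ->; rewrite mulnS.
rewrite ltnNge sp; move=> h; suff: false by []; apply: h.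
apply/allP => z /flattenP[_ /mapP[x xxs ->]]; exact: (allP (hp _ xxs)).
Qed.
End Degrees.

(** * The identities for generic parameters *)

Section Induction.
Variables (K : numFieldType) (a : K).
Hypothesis a_neq0 : a != 0.
Hypothesis a4 : a ^+ 4 != 1.
Notation sg := (@sigma K).
Notation with_col := (with_column a).
Notation row_op := (row_op a).
Notation goodp := (goodp a).
Notation special_points := (special_points a).
Notation nz := (fun x : K => x != 0).
Implicit Types (x v u : K) (xs : seq K) (y : nat -> K).

Lemma parity_row_op y n : parity_op ((- 1) ^+ n) (row_op y n).
Proof.
elim: n => [|n IHn]; first by move=> x; rewrite scale1r scaler0.
by rewrite exprS mulN1r; apply: parity_with_col.
Qed.

Definition good_columns n y u :=
  [/\ u != 0, forall i, (0 < i <= n)%N -> y i != 0 /\ goodp (y i) u &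
      forall i j, (0 < i <= n)%N -> (0 < j <= n)%N -> i != j -> goodp (y i) (y j)].

Notation odd_def y n := (odd_defect a (row_op y n) (upv K n) (dnv K n)).
Notation split_def y n := (split_defect a (row_op y n) (upv K n) (dnv K n)).

(** The interpolation variable, [x] here and [v] below, is an arbitrary nonzero number; genericity
    is asked of the other parameters. *)
Definition odd_identity n := forall y u xs x, size xs = n -> all nz xs ->
  pairwise goodp xs -> good_columns n y u -> x != 0 -> odd_def y n x u xs = 0.
Definition split_identity n := forall y v u xs, size xs = n.+1 -> all nz xs ->
  pairwise goodp xs -> good_columns n y u -> v != 0 -> split_def y n v u xs = 0.

Lemma special_point_neq0 x z : x != 0 -> z \in special_points x -> z != 0.
Proof.
by move=> x0; rewrite !inE => /or4P[] /eqP ->; rewrite ?oppr_eq0 mulf_neq0 ?invr_neq0.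
Qed.

Lemma split_defect_to_front d (U : K -> bool -> 'M[K]_d) e f v u s1 s2 x :
  v != 0 -> u != 0 -> all nz (s1 ++ x :: s2) ->
  (forall x x', x != 0 -> x' != 0 -> exch a U x x') ->
  (forall x', x' \in s1 -> goodp x x') ->
  split_defect a U e f v u (s1 ++ x :: s2) = split_defect a U e f v u (x :: s1 ++ s2).
Proof.
move=> v0 u0; rewrite all_cat /= => /and3P[/allP s10 x0 _] exU gx.
have r0 x' : x' \in s1 -> sg (a ^+ 2 * x / x') != 0.
  by move=> x's1; apply: goodp_sigma => //; [apply: s10|apply: gx].
have ex w : w != 0 -> forall x', x' \in s1 -> exch a (with_col U w) x' x.
  by move=> w0 x' /s10 x'0; apply: exch_all_with_col.
have dw w : w != 0 -> dwpf_col a U e f w (s1 ++ x :: s2) = dwpf_col a U e f w (x :: s1 ++ s2).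
  by move=> w0; apply: dwpf_to_front => x' x's1; split; [apply: r0|apply: ex].
have ev w w' : w != 0 -> w' != 0 ->
    sppf a U e f w w' (s1 ++ x :: s2) = sppf a U e f w w' (x :: s1 ++ s2).
  move=> w0 w'0; rewrite /sppf (nest_to_front (a := a)) // => x' x's1.
  by split; [apply: r0|apply: ex|apply: ex].
rewrite /split_defect !dw // ev //; congr (_ - _ * (_ * _ + _ * _)).
  exact: ev.
exact: ev.
Qed.

Lemma sign2 n : (- 1) ^+ n * (- 1) ^+ n = 1 :> K.
Proof. by rewrite -exprD addnn -mul2n exprM sqrrN !expr1n. Qed.

Lemma split_from_odd n : odd_identity n -> split_identity n.
Proof.
move=> hO y v u xs sxs xs0 gxs gy v0.
have [u0 gyu gyy] := gy.
have y0 j : (0 < j <= n)%N -> y j != 0 by case/gyu.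
have exU x x' : x != 0 -> x' != 0 -> exch a (row_op y n) x x'.
  by move=> x0 x'0; apply: exch_row_op.
have roots w x : x \in xs -> w \in special_points x -> split_def y n w u xs = 0.
  move=> xxs wx; have x0 := allP xs0 _ xxs; have w0 := special_point_neq0 x0 wx.
  case/splitPr: xxs => s1 s2 in sxs xs0 gxs *.
  have gx x' : x' \in s1 ++ s2 -> goodp x x'.
    move: gxs; rewrite pairwise_cat allrel_consr /=.
    move=> /and3P[/andP[/allP g1 _] _ /andP[/allP g2 _]].
    by rewrite mem_cat => /orP[/g1|/g2 //]; rewrite goodp_sym.
  have gr : pairwise goodp (s1 ++ s2).
    move: gxs; rewrite !pairwise_cat allrel_consr /=.
    by move=> /and3P[/andP[_ ->] -> /andP[_ ->]].
  have r0 : all nz (s1 ++ s2).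
    by move: xs0; rewrite !all_cat /= => /and3P[-> _ ->].
  rewrite split_defect_to_front // => [|x' x's1]; last first.
    by apply: gx; rewrite mem_cat x's1.
  have O0 x' : x' != 0 -> odd_def y n x' u (s1 ++ s2) = 0.
    by move=> x'0; apply: hO => //; move: sxs; rewrite !size_cat /= addnS => -[].
  have xN0 : - x != 0 by rewrite oppr_eq0.
  have neg := split_defect_neg a (upv K n) (dnv K n) (sign2 n) (parity_row_op y n).
  have eU := up_row_op a y n; have fU := row_op_dn a y n.
  (* The points [w] are those at which [x] or [- x] equals [w / a] or [a * w]; for [- x] the oddness
     of the defect in the row parameter is used. *)
  move: wx; rewrite !inE => /or4P[] /eqP ew.
  - apply: (split_defect_down a_neq0 fU exU w0 u0) => //; last exact: O0.
    by rewrite ew; field.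
  - rewrite -[x]opprK neg (split_defect_down a_neq0 fU exU w0 u0) ?oppr0 ?O0 //.
    by rewrite ew; field.
  - apply: (split_defect_up a_neq0 eU exU w0 u0) => //; last exact: O0.
    by rewrite ew; field.
  - rewrite -[x]opprK neg (split_defect_up a_neq0 eU exU w0 u0) ?oppr0 ?O0 //.
    by rewrite ew; field.
(* With 4(n + 1) points the numerator may have degree 4n + 3. This requires parity to lower the
   exponent of [dwpf_col] from n + 1 to n and that of [evpf_col] from 2n + 2 to 2n + 1. *)
have [P1 sP1 hP1] : lau n.*2.+1 (fun t => sppf a (row_op y n) (upv K n) (dnv K n) t u xs *
    dwpf_col a (row_op y n) (upv K n) (dnv K n) t xs).
  rewrite -addnn -addSn; apply: lau_mul; first by rewrite -sxs; apply: lau_sppf.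
  apply: lau_tight => [t|]; last by rewrite -sxs; apply: lau_dwpf_col_l.
  have := conj_dwpf (conj_ops_neg_col a (row_op y n) (upv K n) (dnv K n) t) xs0.
  by rewrite mul1r sxs exprS mulN1r mulrN1 opprK.
have tight_ev : lau n.*2.+1 (fun t => evpf_col a (row_op y n) (upv K n) (dnv K n) t xs).
  apply: lau_tight => [t|]; last by rewrite -doubleS -sxs; apply: lau_evpf_col_l.
  have := conj_evpf (sign2 1) (conj_ops_neg_col a (row_op y n) (upv K n) (dnv K n) t) xs0.
  by rewrite mul1r exprS -mul2n exprM sqrrN !expr1n mulr1.
have tight_dw : lau n (fun t => dwpf_col a (row_op y n) (upv K n) (dnv K n) t xs).
  apply: lau_tight => [t|]; last by rewrite -sxs; apply: lau_dwpf_col_l.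
  have := conj_dwpf (conj_ops_neg_col a (row_op y n) (upv K n) (dnv K n) t) xs0.
  by rewrite mul1r sxs exprS mulN1r mulrN1 opprK.
set Du := dwpf_col a (row_op y n) (upv K n) (dnv K n) u xs.
set Eu := evpf_col a (row_op y n) (upv K n) (dnv K n) u xs.
have [P2 sP2 hP2] : lau n.*2.+1 (fun t =>
    Du ^+ 2 * evpf_col a (row_op y n) (upv K n) (dnv K n) t xs +
    Eu * dwpf_col a (row_op y n) (upv K n) (dnv K n) t xs ^+ 2).
  apply: lau_add; first exact: lau_cmul.
  apply/lau_cmul/(@lau_widen _ (n + n)); first by rewrite addnn leqnSn.
  by apply: lau_ext (lau_mul tight_dw tight_dw) => t; rewrite expr2.
pose P := (sg a * Du) *: ((u%:P + 'X) * P1) - ((a * u)%:P - a^-1 *: 'X) * P2.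
have hP t : t != 0 -> split_def y n t u xs * t ^+ n.*2.+1 = P.[t].
  move=> t0; rewrite /P !(hornerD, hornerN, hornerM, hornerZ, hornerC, hornerX) -hP1 // -hP2 //.
  by rewrite /split_defect -/Du -/Eu; ring.
have sP : (size P <= 4 * size xs)%N.
  rewrite sxs; apply: leq_trans (size_polyD _ _) _; rewrite geq_max size_polyN.
  have -> : (4 * n.+1 = 2 + n.*2.+1.*2)%N by lia.
  apply/andP; split.
    apply: leq_trans (size_scale_leq _ _) _; apply: leq_size_mul => //.
    apply: leq_trans (size_polyD _ _) _.
    by rewrite size_polyX geq_max (leq_trans (size_polyC_leq1 _)).
  apply: leq_size_mul => //; apply: leq_trans (size_polyD _ _) _.
  rewrite size_polyN geq_max (leq_trans (size_polyC_leq1 _)) //.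
  by apply: leq_trans (size_scale_leq _ _) _; rewrite size_polyX.
have P0 : P = 0.
  apply: (special_roots a_neq0 a4 xs0 gxs sP) => x xxs; apply/allP => w wx.
  rewrite /root -hP; last exact: special_point_neq0 (allP xs0 _ xxs) wx.
  by rewrite (roots w x) // mul0r.
by apply/eqP; have /eqP := hP v v0; rewrite P0 horner0 mulf_eq0 expf_eq0 (negPf v0) andbF orbF.
Qed.
Lemma good_columns_belast n y u : good_columns n.+1 y u -> good_columns n y u.
Proof.
case=> u0 gu gy; split=> // [i /andP[i0 ni]|i j /andP[i0 ni] /andP[j0 nj]].
  by apply: gu; rewrite i0 ltnW.
by apply: gy; rewrite ?i0 ?j0 ltnW.
Qed.

Lemma good_columns_last n y u : good_columns n.+1 y u -> good_columns n y (y n.+1).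
Proof.
case=> u0 gu gy; split=> // [|i /andP[i0 ni]|i j /andP[i0 ni] /andP[j0 nj]].
- by have [] := gu n.+1; rewrite ?leqnn.
- split; first by have [] := gu i; rewrite ?i0 1?ltnW.
  by apply: gy; [rewrite i0 ltnW|rewrite leqnn|rewrite neq_ltn ltnS ni].
- by apply: gy; rewrite ?i0 ?j0 ltnW.
Qed.

Lemma good_columnsN n y u : good_columns n y u -> good_columns n y (- u).
Proof.
case=> u0 gu gy; split=> // [|i /gu[yi0 gi]]; first by rewrite oppr_eq0.
by split=> //; rewrite goodp_sym goodpN goodp_sym.
Qed.

Lemma swap_fun_perm k y n : (k.+1 < n)%N -> exists g : nat -> nat,
  [/\ swap_fun k y =1 y \o g, injective g & forall i, (0 < i <= n)%N -> (0 < g i <= n)%N].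
Proof.
move=> kn; exists (fun i => if i == k.+1 then k.+2 else if i == k.+2 then k.+1 else i).
split=> [i|i j|i] /=; first by rewrite /swap_fun; case: ifP => //; case: ifP.
  by do 4?[case: eqP => ?]; lia.
by do 2?[case: eqP => ?]; lia.
Qed.

Lemma good_columns_swap k n y u : (k.+1 < n)%N ->
  good_columns n y u -> good_columns n (swap_fun k y) u.
Proof.
move=> kn [u0 gu gy]; have [g [yg gI gn]] := swap_fun_perm y kn.
split=> // [i /gn|i j /gn gi /gn gj ij]; rewrite !yg; first exact: gu.
by apply: gy => //; rewrite (inj_eq gI).
Qed.

Lemma odd_defect_last_column n y x u xs : split_identity n -> size xs = n.+1 ->
  all nz xs -> pairwise goodp xs -> good_columns n.+1 y u ->
  x \in special_points (y n.+1) -> odd_def y n.+1 x u xs = 0.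
Proof.
move=> hS sxs xs0 gxs gy xy; set v := y n.+1.
have gyu := good_columns_belast gy; have gyv := good_columns_last gy.
have [u0 gu _] := gy; have [v0 gvu] : v != 0 /\ goodp v u by apply: gu; rewrite leqnn.
have [_ gyu0 _] := gyu.
have r0 : sg (a ^+ 2 * v / u) != 0 by apply: goodp_sigma.
have rN0 : sg (a ^+ 2 * (- v) / u) != 0.
  by rewrite mulrN mulNr sigmaN oppr_eq0.
have vN0 : - v != 0 by rewrite oppr_eq0.
have eU := up_row_op a y n; have fU := row_op_dn a y n.
have exU x1 x2 : x1 != 0 -> x2 != 0 -> exch a (row_op y n) x1 x2.
  by move=> x10 x20; apply: exch_row_op => // j /gyu0[].
have x0 : x != 0 by apply: special_point_neq0 xy.
rewrite [LHS]/=.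
(* The points [- (a * v)] and [- (v / a)] are treated as [a * w] and [w / a] for the column
   parameter [w = - v]. *)
have negv : odd_defect a (with_col (row_op y n) v)
    (row_mx (upv K n) 0) (col_mx 0 (dnv K n)) x u xs =
    - odd_defect a (with_col (row_op y n) (- v)) (row_mx (upv K n) 0) (col_mx 0 (dnv K n)) x u xs.
  rewrite [X in _ = - X](@odd_defect_conj _ a _ _ (with_col (row_op y n) v) _ _ (- 1) 1 (- 1)).
  - by rewrite invr1 mulr1 mulN1r opprK.
  - by rewrite mulrNN mulr1.
  - by rewrite mulrNN.
  - exact: oner_neq0.
  - exact: conj_ops_neg_col.
  - by rewrite /= x0.
move: xy; rewrite !inE => /or4P[] /eqP xv.
- apply: (odd_defect_split_up a_neq0 eU exU v0 u0) => //.
  exact: hS.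
- rewrite negv (odd_defect_split_up a_neq0 eU exU vN0 u0) ?oppr0 //.
    by rewrite xv mulrN.
  by apply: hS => //; apply: good_columnsN.
- apply: (odd_defect_split_down a_neq0 fU exU v0 u0) => //.
  exact: hS.
- rewrite negv (odd_defect_split_down a_neq0 fU exU vN0 u0) ?oppr0 //.
    by rewrite xv mulNr.
  exact: hS.
Qed.

(** Transpositions of neighbours bring any column to the last place; [k] counts how many are
    needed. *)
Lemma odd_defect_column n k y x u xs : split_identity n -> size xs = n.+1 ->
  all nz xs -> pairwise goodp xs -> (k <= n)%N -> good_columns n.+1 y u ->
  x \in special_points (y (n.+1 - k)%N) -> odd_def y n.+1 x u xs = 0.
Proof.
move=> hS sxs xs0 gxs; elim: k y => [|k IHk] y kn gy xy.
  by apply: (odd_defect_last_column hS); rewrite subn0 in xy.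
pose j := (n - k.+1)%N.
have ej : (n.+1 - k.+1 = j.+1)%N by rewrite /j subSS -subSn.
have jn : (j.+1 < n.+1)%N by rewrite /j; lia.
have gy' := good_columns_swap jn gy.
have [u0 gu gyy] := gy.
have [y1 _] : y j.+1 != 0 /\ goodp (y j.+1) u by apply: gu; rewrite /= ltnW.
have [y2 _] : y j.+2 != 0 /\ goodp (y j.+2) u by apply: gu.
have r0 : sg (a ^+ 2 * y j.+1 / y j.+2) != 0.
  by apply: goodp_sigma => //; apply: gyy; rewrite /= ?jn ?(ltnW jn) // neq_ltn ltnSn.
rewrite ej in xy.
have x0 : x != 0 by apply: special_point_neq0 xy.
rewrite (odd_defect_conj a u (mul1r 1) erefl r0 (conj_ops_swap a_neq0 jn y1 y2)).
  rewrite (IHk (swap_fun j y)) ?mulr0 //; first exact: ltnW.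
  have -> : (n.+1 - k = j.+2)%N by rewrite /j subSn ?subnSK // ltnW.
  by rewrite /swap_fun eqxx (gtn_eqF (ltnSn _)).
by rewrite /= x0.
Qed.

(** The interpolation points belong to the n columns of [y] and to [u]. For n = 0 only those of [u]
    are left, and they start the induction. *)
Lemma odd_from_split n :
  (forall n', n = n'.+1 -> split_identity n') -> odd_identity n.
Proof.
move=> hS y u xs x sxs xs0 gxs gy x0.
have [u0 gu gyy] := gy.
pose ws := u :: [seq y j | j <- iota 1 n].
have exU x1 x2 : x1 != 0 -> x2 != 0 -> exch a (row_op y n) x1 x2.
  by move=> x10 x20; apply: exch_row_op => // j /gu[].
have eU := up_row_op a y n; have fU := row_op_dn a y n.
have pU := parity_row_op y n; have t2 := sign2 n.
have iotaP j : j \in iota 1 n -> (0 < j <= n)%N by rewrite mem_iota add1n ltnS.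
have ws0 : all nz ws.
  by rewrite /= u0; apply/allP => _ /mapP[j /iotaP /gu[yj0 _] ->].
have gws : pairwise goodp ws.
  rewrite /=; apply/andP; split.
    by apply/allP => _ /mapP[j /iotaP /gu[_ gj] ->]; rewrite goodp_sym.
  rewrite pairwise_map; apply/(pairwiseP 0%N) => i j; rewrite !inE size_iota => hi hj ij.
  by apply: gyy; rewrite ?nth_iota //; lia.
have roots w z : w \in ws -> z \in special_points w -> odd_def y n z u xs = 0.
  rewrite inE => /orP[/eqP-> |/mapP[j /iotaP jn ->]] zw; last first.
    case: n @ws {ws0 gws iotaP} sxs hS eU fU pU t2 exU gy gu gyy jn =>
      [|n] _ sxs hS _ _ _ _ _ gy gu _ jn.
      by move: jn; rewrite leqn0; case: (j).
    apply: (@odd_defect_column n (n.+1 - j)) => //; first exact: hS.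
      lia.
    by rewrite subKn //; case/andP: jn.
  move: zw; rewrite !inE => /or4P[] /eqP zu.
  - exact: (odd_defect_up a_neq0 (dnv K n) eU exU).
  - exact: (odd_defect_Nup a_neq0 (dnv K n) eU exU t2 pU).
  - exact: (odd_defect_down a_neq0 (upv K n) fU exU).
  - exact: (odd_defect_Ndown a_neq0 (upv K n) fU exU t2 pU).
set e := upv K n in roots *; set f := dnv K n in roots *.
have tight_dw : lau n (fun t => dwpf_col a (row_op y n) e f u (t :: xs)).
  apply: lau_tight => [t|]; last exact: lau_dwpf_col_r.
  exact: dwpf_col_neg.
have [P1 sP1 hP1] : lau n.*2 (fun t => odpf a (row_op y n) e f t u xs *
    dwpf_col a (row_op y n) e f u (t :: xs)).
  by rewrite -addnn; apply: lau_mul => //; apply: lau_odpf.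
have tight_ev : lau n.*2.+1 (fun t => evpf_col a (row_op y n) e f u (t :: xs)).
  apply: lau_tight => [t|]; last by rewrite -doubleS; apply: lau_evpf_col_r.
  rewrite (@evpf_col_neg _ a _ _ e f _ t2 pU).
  by rewrite exprS -mul2n exprM sqrrN !expr1n mulr1 mulN1r.
set D := dwpf (row_op y n) e f xs; set E := evpf (row_op y n) e f xs.
have [P2 sP2 hP2] : lau n.*2.+1 (fun t =>
    E * dwpf_col a (row_op y n) e f u (t :: xs) ^+ 2 +
    D ^+ 2 * evpf_col a (row_op y n) e f u (t :: xs)).
  apply: lau_add; last exact: lau_cmul.
  apply/lau_cmul/(@lau_widen _ (n + n)); first by rewrite addnn leqnSn.
  by apply: lau_ext (lau_mul tight_dw tight_dw) => t; rewrite expr2.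
(* The first product was cleared by exponent 2n and the bracket by 2n + 1, hence the extra ['X] in
   the first summand. Both summands have degree at most 4n + 3. *)
pose P := (sg a * D) *: ((a *: 'X + u%:P) * ((a * u)%:P + 'X) * 'X * P1) -
  (a * u) *: 'X * P2.
have hP t : t != 0 -> odd_def y n t u xs * t ^+ n.*2.+1 = P.[t].
  move=> t0; rewrite /P !(hornerD, hornerN, hornerM, hornerZ, hornerC, hornerX) -hP1 // -hP2 //.
  by rewrite /odd_defect -/D -/E !(exprS t); ring.
have s2 c (b : K) : (size (c *: 'X + b%:P)%R <= 2)%N.
  apply: leq_trans (size_polyD _ _) _; rewrite geq_max (leq_trans (size_polyC_leq1 _)) // andbT.
  by apply: leq_trans (size_scale_leq _ _) _; rewrite size_polyX.
have sP : (size P <= 4 * size ws)%N.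
  rewrite /= size_map size_iota.
  apply: leq_trans (size_polyD _ _) _; rewrite geq_max size_polyN.
  apply/andP; split.
    apply: leq_trans (size_scale_leq _ _) _.
    have -> : (4 * n.+1 = 4 + n.*2.*2)%N by lia.
    apply: leq_size_mul => //; apply: (@leq_size_mul _ _ _ 3 1); last by rewrite size_polyX.
    apply: (@leq_size_mul _ _ _ 2 1) => //; rewrite addrC -[X in (X + _)%R]scale1r.
    exact: s2.
  have -> : (4 * n.+1 = 2 + n.*2.+1.*2)%N by lia.
  apply: leq_size_mul => //.
  by apply: leq_trans (size_scale_leq _ _) _; rewrite size_polyX.
have P0 : P = 0.
  apply: (special_roots a_neq0 a4 ws0 gws sP) => w wws; apply/allP => z zw.
  rewrite /root -hP; last exact: special_point_neq0 (allP ws0 _ wws) zw.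
  by rewrite (roots w z) // mul0r.
by apply/eqP; have /eqP := hP x x0; rewrite P0 horner0 mulf_eq0 expf_eq0 (negPf x0) andbF orbF.
Qed.

Theorem odd_identity_all n : odd_identity n.
Proof.
elim: n => [|n IHn]; first by apply: odd_from_split.
by apply: odd_from_split => n' [<-]; apply: split_from_odd.
Qed.
End Induction.

(** * Removal of genericity *)

Section Density.
Variables (K : numFieldType) (a : K).
Hypothesis a_neq0 : a != 0.
Hypothesis a4 : a ^+ 4 != 1.
Notation s := (sigma (a ^+ 2)).
Notation sg := (@sigma K).
Notation with_col := (with_column a).
Notation row_op := (row_op a).
Notation goodp := (goodp a).
Implicit Types (x y : nat -> K) (n m : nat).

Definition dwmx n x y := dwpf (row_op y n) (upv K n) (dnv K n) (map x (iota 1 n)).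
Definition evmx n x y := evpf (row_op y n) (upv K n) (dnv K n) (map x (iota 1 n)).
Definition odmx n x y :=
  odpf a (row_op y n) (upv K n) (dnv K n) (x n.+1) (y n.+1) (map x (iota 1 n)).

Definition defect n x y :=
  sg a * (a * x n.+1 + y n.+1) * (a * y n.+1 + x n.+1) *
    odmx n x y * dwmx n x y * dwmx n.+1 x y -
  a * x n.+1 * y n.+1 *
    (dwmx n.+1 x y ^+ 2 * evmx n x y + dwmx n x y ^+ 2 * evmx n.+1 x y).

Definition good_family n x :=
  (forall i, (0 < i <= n)%N -> x i != 0) /\
  (forall i j, (0 < i <= n)%N -> (0 < j <= n)%N -> i != j -> goodp (x i) (x j)).

Lemma iota1S n : iota 1 n.+1 = iota 1 n ++ [:: n.+1].
Proof. by rewrite -[in LHS](addn1 n) iotaD add1n. Qed.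

Lemma mem_iota1 n i : (i \in iota 1 n) = (0 < i <= n)%N.
Proof. by rewrite mem_iota add1n ltnS. Qed.

Lemma eq_nest p q (U U' : K -> bool -> 'M[K]_p) (L L' : K -> bool -> 'M[K]_q) xs M :
  (forall z r, U z r = U' z r) -> (forall z r, L z r = L' z r) ->
  nest U L xs M = nest U' L' xs M.
Proof. by move=> eU eL; elim: xs => //= z xs ->; rewrite /fold_line !eU !eL. Qed.

Lemma eq_defect n x x' y y' : (forall i, (0 < i <= n.+1)%N -> x i = x' i) ->
  (forall i, (0 < i <= n.+1)%N -> y i = y' i) -> defect n x y = defect n x' y'.
Proof.
move=> ex ey; have last : (0 < n.+1 <= n.+1)%N by rewrite leqnn.
have le i : (0 < i <= n)%N -> (0 < i <= n.+1)%N by case/andP=> -> /leqW.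
have mx k : (k <= n.+1)%N -> map x (iota 1 k) = map x' (iota 1 k).
  move=> kn; apply/eq_in_map => i; rewrite mem_iota1 => /andP[i0 ik].
  by apply: ex; rewrite i0 (leq_trans ik).
have ro k z r : (k <= n.+1)%N -> row_op y k z r = row_op y' k z r.
  by move=> kn; apply: eq_row_op => j /andP[j0 jk]; apply: ey; rewrite j0 (leq_trans jk).
have dw k : (k <= n.+1)%N -> dwmx k x y = dwmx k x' y'.
  move=> kn; rewrite /dwmx mx //; congr ((_ *m _) _ _); elim: (map _ _) => //= z l ->.
  by rewrite ro.
have ev k : (k <= n.+1)%N -> evmx k x y = evmx k x' y'.
  by move=> kn; rewrite /evmx mx // /evpf; congr ((_ *m _ *m _) _ _);
    apply: eq_nest => z r; rewrite ro.
have n1 := leqnSn n; have n2 := leqnn n.+1.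
have od : odmx n x y = odmx n x' y'.
  rewrite /odmx /odpf (mx n n1) (ex _ last) (ey _ last) !(ro n _ _ n1).
  rewrite (@eq_nest _ _ (row_op y n) (row_op y' n) (with_col (row_op y n) (y' n.+1))
    (with_col (row_op y' n) (y' n.+1))) // => z r; first exact: ro.
  by case: r; rewrite !(with_colTE, with_colFE) !(ro n _ _ n1).
rewrite /defect od (dw n n1) (dw n.+1 n2) (ev n n1) (ev n.+1 n2) (ex _ last) (ey _ last).
reflexivity.
Qed.

(** The models list row n + 1 innermost, whereas the recursions treat it as outermost; the exchange
    of lines moves it to the front. *)
Lemma defect_generic n x y : good_family n.+1 x -> good_family n.+1 y -> defect n x y = 0.
Proof.
move=> [x0 gx] [y0 gy].
have le i : (0 < i <= n)%N -> (0 < i <= n.+1)%N by case/andP=> -> /leqW.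
have last : (0 < n.+1 <= n.+1)%N by rewrite leqnn.
have neq i : (0 < i <= n)%N -> i != n.+1 by move=> /andP[_ h]; rewrite neq_ltn ltnS h.
have exU v (z z' : K) : v != 0 -> z != 0 -> z' != 0 -> exch a (with_col (row_op y n) v) z z'.
  move=> v0 z0 z'0; apply: exch_with_col => //; apply: exch_row_op => // j /le.
  exact: y0.
set xs := map x (iota 1 n).
have fr (x' : K) : x' \in xs -> [/\ sg (a ^+ 2 * x n.+1 / x') != 0,
    exch a (with_col (row_op y n) (y n.+1)) x' (x n.+1) &
    exch a (with_col (row_op y n) (y n.+1)) x' (x n.+1)].
  case/mapP=> i; rewrite mem_iota1 => hi ->; have [hi' hi''] := (le _ hi, neq _ hi).
  have xi0 := x0 _ hi'; have xn0 := x0 _ last; have yn0 := y0 _ last.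
  split; [apply: goodp_sigma => // | exact: exU | exact: exU].
  by apply: gx => //; rewrite eq_sym.
have fr2 (x' : K) : x' \in xs -> sg (a ^+ 2 * x n.+1 / x') != 0 /\
    exch a (with_col (row_op y n) (y n.+1)) x' (x n.+1) by case/fr.
have e1 : dwmx n.+1 x y =
    dwpf_col a (row_op y n) (upv K n) (dnv K n) (y n.+1) (x n.+1 :: xs).
  by rewrite /dwmx iota1S map_cat /dwpf_col (dwpf_to_front _ _ _ fr2) cats0.
have e2 : evmx n.+1 x y =
    evpf_col a (row_op y n) (upv K n) (dnv K n) (y n.+1) (x n.+1 :: xs).
  by rewrite /evmx iota1S map_cat /evpf_col /evpf /= (nest_to_front _ _ fr) cats0.
rewrite /defect e1 e2.
apply: (odd_identity_all a_neq0 a4 (n := n) (u := y n.+1) (xs := xs) (x := x n.+1)).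
- by rewrite size_map size_iota.
- by apply/allP => z /mapP[i]; rewrite mem_iota1 => /le hi ->; apply: x0.
- rewrite pairwise_map; apply/(pairwiseP 0%N) => i j; rewrite !inE size_iota => hi hj ij.
  rewrite /= !nth_iota // !add1n; apply: gx; rewrite /= ?ltnS 1?ltnW //.
  by rewrite neq_ltn ltnS ij.
- split; first exact: y0.
    by move=> i hi; split; [apply/y0/le|apply: gy; [apply: le|apply: last|apply: neq]].
  by move=> i j hi hj; apply: gy; apply: le.
- exact: x0.
Qed.

Section Rational.
Variable d : {poly K}.

(* Rational functions whose denominator is a power of [d]. *)
Definition ratl (f : K -> K) := exists N (p : {poly K}),
  forall t, d.[t] != 0 -> f t * d.[t] ^+ N = p.[t].

Lemma ratl_ext f g : f =1 g -> ratl f -> ratl g.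
Proof. by move=> fg [N [p h]]; exists N, p => t t0; rewrite -fg h. Qed.

Lemma ratl_poly (p : {poly K}) : ratl (fun t => p.[t]).
Proof. by exists 0%N, p => t _; rewrite mulr1. Qed.

Lemma ratl_const c : ratl (fun=> c).
Proof. by apply: ratl_ext (ratl_poly c%:P) => t; rewrite hornerC. Qed.

Lemma ratl_inv (p q : {poly K}) : d = p * q -> ratl (fun t => p.[t]^-1).
Proof.
move=> dpq; exists 1%N, q => t; rewrite dpq hornerM expr1 mulf_eq0 negb_or.
by case/andP=> p0 _; rewrite mulKf.
Qed.

Lemma ratl_add f g : ratl f -> ratl g -> ratl (fun t => f t + g t).
Proof.
move=> [N [p hp]] [M [q hq]]; exists (N + M)%N, (p * d ^+ M + q * d ^+ N) => t t0.
by rewrite hornerD !hornerM !horner_exp -hp // -hq // exprD; ring.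
Qed.

Lemma ratl_mul f g : ratl f -> ratl g -> ratl (fun t => f t * g t).
Proof.
move=> [N [p hp]] [M [q hq]]; exists (N + M)%N, (p * q) => t t0.
by rewrite hornerM -hp // -hq // exprD; ring.
Qed.

Lemma ratl_sum (I : Type) (r : seq I) (F : I -> K -> K) :
  (forall i, ratl (F i)) -> ratl (fun t => \sum_(i <- r) F i t).
Proof.
move=> h; elim: r => [|i r IHr].
  by apply: ratl_ext (ratl_const 0) => t; rewrite big_nil.
by apply: ratl_ext (ratl_add (h i) IHr) => t; rewrite big_cons.
Qed.

(** An algebraic substitute for continuity: the numerator times [q * d] vanishes at every point, so
    the numerator is 0, and [d] does not vanish at 0. *)
Lemma ratl_eq0 f (q : {poly K}) : d.[0] != 0 -> q != 0 -> ratl f ->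
  (forall t, d.[t] != 0 -> q.[t] != 0 -> f t = 0) -> f 0 = 0.
Proof.
move=> d00 q0 [N [p hp]] hf.
have d0 : d != 0 by apply: contraNneq d00 => ->; rewrite horner0.
have : p * q * d = 0.
  apply: poly_eq0_nz => t _; rewrite !hornerM.
  have [->|dt] := eqVneq d.[t] 0; first by rewrite mulr0.
  have [->|qt] := eqVneq q.[t] 0; first by rewrite mulr0 mul0r.
  by rewrite -hp // hf // !mul0r.
move/eqP; rewrite !mulf_eq0 (negPf q0) (negPf d0) !orbF => /eqP p0.
by have /eqP := hp 0 d00; rewrite p0 horner0 mulf_eq0 expf_eq0 (negPf d00) andbF orbF => /eqP.
Qed.

Definition mratl p q (F : K -> 'M[K]_(p, q)) := forall i j, ratl (fun t => F t i j).

Lemma mratl_const p q (M : 'M[K]_(p, q)) : mratl (fun=> M).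
Proof. by move=> i j; apply: ratl_const. Qed.

Lemma mratl_add p q (F G : K -> 'M[K]_(p, q)) :
  mratl F -> mratl G -> mratl (fun t => F t + G t).
Proof.
by move=> hF hG i j; apply: ratl_ext (ratl_add (hF i j) (hG i j)) => t; rewrite mxE.
Qed.

Lemma mratl_mul p q r (F : K -> 'M[K]_(p, q)) (G : K -> 'M[K]_(q, r)) :
  mratl F -> mratl G -> mratl (fun t => F t *m G t).
Proof.
move=> hF hG i j.
apply: ratl_ext (ratl_sum (index_enum _) (fun k => ratl_mul (hF i k) (hG k j))) => t.
by rewrite mxE.
Qed.

Lemma mratl_scale p q f (F : K -> 'M[K]_(p, q)) :
  ratl f -> mratl F -> mratl (fun t => f t *: F t).
Proof.
by move=> hf hF i j; apply: ratl_ext (ratl_mul hf (hF i j)) => t; rewrite mxE.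
Qed.

Lemma mratl_block m1 m2 n1 n2 (A : K -> 'M[K]_(m1, n1)) (B : K -> 'M_(m1, n2))
    (C : K -> 'M_(m2, n1)) (D : K -> 'M_(m2, n2)) :
  mratl A -> mratl B -> mratl C -> mratl D ->
  mratl (fun t => block_mx (A t) (B t) (C t) (D t)).
Proof.
move=> hA hB hC hD i j; rewrite -(splitK i) -(splitK j).
case: (split i) (split j) => {}i [] {}j /=.
- by apply: ratl_ext (hA i j) => t; rewrite block_mxEul.
- by apply: ratl_ext (hB i j) => t; rewrite block_mxEur.
- by apply: ratl_ext (hC i j) => t; rewrite block_mxEdl.
- by apply: ratl_ext (hD i j) => t; rewrite block_mxEdr.
Qed.

Lemma mratl_row m n1 n2 (A : K -> 'M[K]_(m, n1)) (B : K -> 'M_(m, n2)) :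
  mratl A -> mratl B -> mratl (fun t => row_mx (A t) (B t)).
Proof.
move=> hA hB i j; rewrite -(splitK j); case: (split j) => {}j /=.
- by apply: ratl_ext (hA i j) => t; rewrite row_mxEl.
- by apply: ratl_ext (hB i j) => t; rewrite row_mxEr.
Qed.

Definition unit_curve (f : K -> K) := ratl f /\ ratl (fun t => (f t)^-1).

Lemma ratl_sigma_num (f g : K -> K) : unit_curve f -> unit_curve g ->
  ratl (fun t => sg (a * (f t / g t))).
Proof.
move=> [f1 f2] [g1 g2].
have h := ratl_add (ratl_mul (ratl_const a) (ratl_mul f1 g2))
  (ratl_mul (ratl_const (- a^-1)) (ratl_mul f2 g1)).
by apply: ratl_ext h => t; rewrite /sigma !invfM invrK mulNr.
Qed.

Lemma ratl_sigma_den (f g : K -> K) : unit_curve f -> unit_curve g ->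
  ratl (fun t => sg (a / (f t / g t))).
Proof.
by move=> uf ug; apply: ratl_ext (ratl_sigma_num ug uf) => t; rewrite invf_div.
Qed.

Lemma mratl_with_col D (U : K -> K -> bool -> 'M[K]_D) (f g : K -> K) r :
  unit_curve f -> unit_curve g -> (forall r, mratl (fun t => U t (f t) r)) ->
  mratl (fun t => with_col (U t) (g t) (f t) r).
Proof.
move=> uf ug hU.
have h1 := ratl_sigma_num uf ug; have h2 := ratl_sigma_den uf ug.
have h3 := ratl_const s.
case: r; apply: mratl_block.
- exact: (mratl_scale h1 (hU true)).
- exact: (mratl_const 0).
- exact: (mratl_scale h3 (hU false)).
- exact: (mratl_scale h2 (hU true)).
- exact: (mratl_scale h2 (hU false)).
- exact: (mratl_scale h3 (hU true)).
- exact: (mratl_const 0).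
- exact: (mratl_scale h1 (hU false)).
Qed.

Lemma mratl_row_op n (Y : nat -> K -> K) (f : K -> K) r :
  unit_curve f -> (forall j, (0 < j <= n)%N -> unit_curve (Y j)) ->
  mratl (fun t => row_op (Y^~ t) n (f t) r).
Proof.
move=> uf; elim: n r => [|n IHn] r uY; first exact: mratl_const.
apply: (mratl_with_col (U := fun t => row_op (Y^~ t) n)) => //.
  by apply: uY; rewrite leqnn.
by move=> r'; apply: IHn => j /andP[j0 /leqW jn]; apply: uY; rewrite j0.
Qed.

Lemma mratl_nest p q (U : K -> K -> bool -> 'M[K]_p) (L : K -> K -> bool -> 'M[K]_q)
    (M : K -> 'M[K]_(p, q)) (X : nat -> K -> K) l :
  (forall i r, i \in l -> mratl (fun t => U t (X i t) r)) ->
  (forall i r, i \in l -> mratl (fun t => L t (X i t) r)) ->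
  mratl M -> mratl (fun t => nest (U t) (L t) (map (X^~ t) l) (M t)).
Proof.
move=> + + hM; elim: l => [|i l IHl] hU hL //=.
have hl : mratl (fun t => nest (U t) (L t) (map (X^~ t) l) (M t)).
  by apply: IHl => j r jl; [apply: hU|apply: hL]; rewrite inE jl orbT.
have hi r r' := mratl_mul (mratl_mul (hU i r (mem_head _ _)) hl) (hL i r' (mem_head _ _)).
exact: mratl_add (hi true false) (hi false true).
Qed.

Lemma ratl_element p q (e : 'rV[K]_p) (f : 'cV[K]_q) (M : K -> 'M[K]_(p, q)) :
  mratl M -> ratl (fun t => (e *m M t *m f) 0 0).
Proof.
by move=> hM; apply: mratl_mul (mratl_mul (mratl_const e) hM) (mratl_const f) 0 0.
Qed.

Section Models.
Variables (X Y : nat -> K -> K) (n : nat).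
Hypothesis uX : forall i, (0 < i <= n)%N -> unit_curve (X i).
Hypothesis uY : forall i, (0 < i <= n)%N -> unit_curve (Y i).

Lemma ratl_dwmx : ratl (fun t => dwmx n (X^~ t) (Y^~ t)).
Proof.
have h : mratl (fun t => foldr (fun z w => row_op (Y^~ t) n z false *m w) (dnv K n)
    (map (X^~ t) (iota 1 n))).
  have : {subset iota 1 n <= iota 1 n} by [].
  elim: {1 3}(iota 1 n) => [|i l IHl] hl /=; first exact: mratl_const.
  apply: mratl_mul; last by apply: IHl => j jl; apply: hl; rewrite inE jl orbT.
  by apply: mratl_row_op => //; apply: uX; rewrite -mem_iota1 hl ?mem_head.
exact: (mratl_mul (mratl_const (upv K n)) h 0 0).
Qed.

Lemma ratl_evmx : ratl (fun t => evmx n (X^~ t) (Y^~ t)).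
Proof.
apply/ratl_element/(mratl_nest (U := fun t => row_op (Y^~ t) n)
  (L := fun t => row_op (Y^~ t) n)); last exact: mratl_const.
  by move=> i r; rewrite mem_iota1 => hi; apply: mratl_row_op => //; apply: uX.
by move=> i r; rewrite mem_iota1 => hi; apply: mratl_row_op => //; apply: uX.
Qed.
End Models.

Lemma ratl_odmx (X Y : nat -> K -> K) n :
  (forall i, (0 < i <= n.+1)%N -> unit_curve (X i)) ->
  (forall i, (0 < i <= n.+1)%N -> unit_curve (Y i)) ->
  ratl (fun t => odmx n (X^~ t) (Y^~ t)).
Proof.
move=> uX uY.
have uYn j : (0 < j <= n)%N -> unit_curve (Y j).
  by move=> /andP[j0 /leqW jn]; apply: uY; rewrite j0.
have last : (0 < n.+1 <= n.+1)%N by rewrite leqnn.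
apply/ratl_element/(mratl_nest (U := fun t => row_op (Y^~ t) n)
  (L := fun t => with_col (row_op (Y^~ t) n) (Y n.+1 t))
  (M := fun t => row_mx (row_op (Y^~ t) n (X n.+1 t) false) (row_op (Y^~ t) n (X n.+1 t) true))).
- move=> i r; rewrite mem_iota1 => /andP[i0 /leqW hi]; apply: mratl_row_op => //.
  by apply: uX; rewrite i0.
- move=> i r; rewrite mem_iota1 => /andP[i0 /leqW hi].
  have ui : unit_curve (X i) by apply: uX; rewrite i0.
  apply: (mratl_with_col (U := fun t => row_op (Y^~ t) n)) => //; first exact: uY.
  by move=> r'; apply: mratl_row_op.
- by apply: mratl_row; apply: mratl_row_op => //; apply: uX.
Qed.
End Rational.

(** The curves have pairwise different degrees, so no p^2 is a constant multiple of another q^2,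
    whatever the values at t = 0 are. *)
Definition curve x i : {poly K} := (x i)%:P + 'X^i.

Lemma size_curve2 x i : (0 < i)%N -> size (curve x i ^+ 2) = i.*2.+1.
Proof.
move=> i0; have sc : size (curve x i) = i.+1.
  by rewrite /curve addrC size_polyDl size_polyXn // (leq_ltn_trans (size_polyC_leq1 _)).
have c0 : curve x i != 0 by rewrite -size_poly_gt0 sc.
by rewrite -[LHS]prednK ?size_poly_gt0 ?expf_neq0 // size_exp sc /= muln2.
Qed.

Definition good_poly (p q : {poly K}) :=
  (p ^+ 2 - q ^+ 2) * (a ^+ 4 *: p ^+ 2 - q ^+ 2) * (a ^+ 4 *: q ^+ 2 - p ^+ 2).

Lemma good_poly_neq0 x i j : (0 < i)%N -> (0 < j)%N -> i != j ->
  good_poly (curve x i) (curve x j) != 0.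
Proof.
move=> i0 j0 ij; have a40 : a ^+ 4 != 0 by rewrite expf_neq0.
have si := size_curve2 x i0; have sj := size_curve2 x j0.
have dij : (i.*2.+1 != j.*2.+1)%N by rewrite eqSS -!muln2 eqn_pmul2r.
rewrite !mulf_neq0 // subr_eq0; apply: contraNneq dij => /(congr1 (fun p : {poly K} => size p)).
- by rewrite si sj => ->.
- by rewrite size_scale // si sj => ->.
- by rewrite size_scale // si sj => ->.
Qed.

Lemma good_polyP p q t : (good_poly p q).[t] != 0 -> goodp p.[t] q.[t].
Proof.
rewrite !(hornerM, hornerD, hornerN, hornerZ, horner_exp) !mulf_eq0 !negb_or !subr_eq0.
by rewrite /goodp => /andP[/andP[-> ->] ->].
Qed.

Lemma good_family_curve n x : exists2 q : {poly K}, q != 0 &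
  forall t, q.[t] != 0 -> (forall i, (0 < i <= n)%N -> (curve x i).[t] != 0) ->
  good_family n (fun i => (curve x i).[t]).
Proof.
exists (\prod_(i < n) \prod_(j < n | i != j) good_poly (curve x i.+1) (curve x j.+1)).
  apply/prodf_neq0 => i _; apply/prodf_neq0 => j ij; exact: good_poly_neq0.
move=> t; rewrite horner_prod => /prodf_neq0 qt xt; split=> // i j /andP[i0 hi] /andP[j0 hj] ij.
case: i j i0 j0 hi hj ij => // i [] // j _ _ hi hj ij.
have := qt (Ordinal hi) isT; rewrite horner_prod => /prodf_neq0 /(_ (Ordinal hj)).
by move=> h; apply: good_polyP; apply: h.
Qed.

Theorem defect_eq0 n x y : (forall i, (0 < i <= n.+1)%N -> x i != 0) ->
  (forall i, (0 < i <= n.+1)%N -> y i != 0) -> defect n x y = 0.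
Proof.
move=> x0 y0.
pose X i t := (curve x i).[t]; pose Y i t := (curve y i).[t].
pose d := (\prod_(i <- iota 1 n.+1) curve x i) * \prod_(i <- iota 1 n.+1) curve y i.
have [q1 q10 gx] := good_family_curve n.+1 x.
have [q2 q20 gy] := good_family_curve n.+1 y.
have at0 z i : (0 < i)%N -> (curve z i).[0] = z i.
  by move=> i0; rewrite hornerD hornerC hornerXn expr0n gtn_eqF // addr0.
have hd (z : nat -> K) i : (0 < i <= n.+1)%N ->
    exists r, \prod_(i <- iota 1 n.+1) curve z i = curve z i * r.
  move=> hi; exists (\prod_(j <- rem i (iota 1 n.+1)) curve z j).
  by rewrite (big_rem i) ?mem_iota1.
have uX i : (0 < i <= n.+1)%N -> unit_curve d (X i).
  move=> /(hd x)[r er]; split; first exact: ratl_poly.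
  by apply: (ratl_inv (q := r * \prod_(i <- iota 1 n.+1) curve y i)); rewrite /d er mulrA.
have uY i : (0 < i <= n.+1)%N -> unit_curve d (Y i).
  move=> /(hd y)[r er]; split; first exact: ratl_poly.
  by apply: (ratl_inv (q := r * \prod_(i <- iota 1 n.+1) curve x i)); rewrite /d er; ring.
have rD : ratl d (fun t => defect n (X^~ t) (Y^~ t)).
  have le i : (0 < i <= n)%N -> (0 < i <= n.+1)%N by case/andP=> -> /leqW.
  have Z0 := ratl_dwmx (fun i h => uX i (le i h)) (fun i h => uY i (le i h)).
  have E0 := ratl_evmx (fun i h => uX i (le i h)) (fun i h => uY i (le i h)).
  have Z1 := ratl_dwmx uX uY; have E1 := ratl_evmx uX uY; have O := ratl_odmx uX uY.
  have last : (0 < n.+1 <= n.+1)%N by rewrite leqnn.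
  have [[x1 _] [y1 _]] := (uX _ last, uY _ last).
  have c k := ratl_const d k.
  have w1 := ratl_mul (c (sg a)) (ratl_mul (ratl_add (ratl_mul (c a) x1) y1)
    (ratl_add (ratl_mul (c a) y1) x1)).
  have h1 := ratl_mul w1 (ratl_mul O (ratl_mul Z0 Z1)).
  have h2 := ratl_mul (ratl_mul (c (- a)) (ratl_mul x1 y1))
    (ratl_add (ratl_mul (ratl_mul Z1 Z1) E0) (ratl_mul (ratl_mul Z0 Z0) E1)).
  by apply: ratl_ext (ratl_add h1 h2) => t; rewrite /defect /X /Y; ring.
have d0 : d.[0] != 0.
  rewrite hornerM !horner_prod mulf_neq0 // prodf_seq_neq0; apply/allP => i;
    rewrite mem_iota1 => hi; have /andP[i0 _] := hi; rewrite /= at0 //; [exact: x0|exact: y0].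
have dX t i : d.[t] != 0 -> (0 < i <= n.+1)%N -> (curve x i).[t] != 0.
  rewrite hornerM !horner_prod mulf_eq0 negb_or => /andP[+ _] hi.
  by rewrite prodf_seq_neq0 => /allP /(_ i); rewrite mem_iota1 => /(_ hi).
have dY t i : d.[t] != 0 -> (0 < i <= n.+1)%N -> (curve y i).[t] != 0.
  rewrite hornerM !horner_prod mulf_eq0 negb_or => /andP[_ +] hi.
  by rewrite prodf_seq_neq0 => /allP /(_ i); rewrite mem_iota1 => /(_ hi).
have q0 : q1 * q2 != 0 by rewrite mulf_neq0.
have <- : defect n (X^~ 0) (Y^~ 0) = defect n x y.
  apply: eq_defect => i /andP[i0 _]; exact: at0.
apply: (ratl_eq0 d0 q0 rD) => t dt; rewrite hornerM mulf_eq0 negb_or => /andP[q1t q2t].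
apply: defect_generic; first by apply: gx => // i; apply: dX.
by apply: gy => // i; apply: dY.
Qed.
End Density.

(** * States as matrix products *)

Section FfunInsert.
Variables (T : finType) (n : nat) (k : 'I_n.+1).

Definition finsert (t : T) (f : {ffun 'I_n -> T}) : {ffun 'I_n.+1 -> T} :=
  [ffun i => if unlift k i is Some j then f j else t].

Lemma finsert_at t f : finsert t f k = t.
Proof. by rewrite ffunE unlift_none. Qed.

Lemma finsert_lift t f j : finsert t f (lift k j) = f j.
Proof. by rewrite ffunE liftK. Qed.

Lemma big_finsert (V : zmodType) (G : {ffun 'I_n.+1 -> T} -> V) :
  \sum_g G g = \sum_t \sum_f G (finsert t f).
Proof.
rewrite pair_big /= (reindex (fun p => finsert p.1 p.2)) //=.
exists (fun g : {ffun 'I_n.+1 -> T} => (g k, [ffun j => g (lift k j)])) => [[t f] _|g _] /=.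
  rewrite finsert_at; congr pair; apply/ffunP => j; by rewrite ffunE finsert_lift.
apply/ffunP => i; rewrite ffunE; case: unliftP => [j ->|->] //; by rewrite ffunE.
Qed.
End FfunInsert.

Definition fget n (f : {ffun 'I_n -> bool}) (j : nat) : bool :=
  if insub j is Some j' then f j' else false.

Lemma fget_ord n (f : {ffun 'I_n -> bool}) (j : 'I_n) : fget f j = f j.
Proof. by rewrite /fget valK. Qed.

Lemma fget_last n t (f : {ffun 'I_n -> bool}) : fget (finsert ord_max t f) n = t.
Proof. by have := fget_ord (finsert ord_max t f) ord_max; rewrite finsert_at. Qed.

Lemma fget_belast n t (f : {ffun 'I_n -> bool}) j : (j < n)%N ->
  fget (finsert ord_max t f) j = fget f j.
Proof.
move=> jn; have := fget_ord (finsert ord_max t f) (lift ord_max (Ordinal jn)).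
by rewrite finsert_lift lift_max /= => ->; have := fget_ord f (Ordinal jn).
Qed.

(** The last column chooses the outer block and up comes first, in agreement with [add_col]. *)
Fixpoint enc n (t : nat -> bool) : 'I_(spin_dim n) :=
  if n is n'.+1 return 'I_(spin_dim n) then
    if t n' then lshift (spin_dim n') (enc n' t) else rshift (spin_dim n') (enc n' t)
  else ord0.

Lemma eq_enc n t t' : (forall j, (j < n)%N -> t j = t' j) -> enc n t = enc n t'.
Proof.
elim: n => //= n IHn h; rewrite h // IHn // => j jn; by apply/h/ltnW.
Qed.

Lemma enc_inj n t t' : enc n t = enc n t' -> forall j, (j < n)%N -> t j = t' j.
Proof.
elim: n => //= n IHn; case et: (t n); case et': (t' n) => h j.
- rewrite ltnS leq_eqVlt => /orP[/eqP->|]; first by rewrite et et'.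
  by apply: IHn; apply: lshift_inj h.
- by have := eq_lrshift (enc n t) (enc n t'); rewrite h eqxx.
- by have := eq_rlshift (enc n t) (enc n t'); rewrite h eqxx.
- rewrite ltnS leq_eqVlt => /orP[/eqP->|]; first by rewrite et et'.
  by apply: IHn; apply: rshift_inj h.
Qed.

Lemma sum_enc (V : zmodType) n (G : 'I_(spin_dim n) -> V) :
  \sum_k G k = \sum_(t : {ffun 'I_n -> bool}) G (enc n (fget t)).
Proof.
elim: n G => [|n IHn] G.
  rewrite big_ord1 (big_pred1 [ffun=> false]) // => t.
  by apply/esym/eqP/ffunP => -[].
rewrite (big_finsert ord_max) big_split_ord !IHn big_bool.
congr (_ + _); apply: eq_bigr => t _; rewrite /= fget_last;
  by rewrite (@eq_enc n _ (fget t)) // => j jn; rewrite fget_belast.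
Qed.

Section OrderedProducts.
Variables (K : fieldType).

Fixpoint mprod d n (M : nat -> 'M[K]_d) : 'M[K]_d :=
  if n is n'.+1 then M 0%N *m mprod n' (fun i => M i.+1) else 1%:M.

Lemma eq_mprod d n (M N : nat -> 'M[K]_d) :
  (forall i, (i < n)%N -> M i = N i) -> mprod n M = mprod n N.
Proof.
elim: n M N => //= n IHn M N h; rewrite h //; congr (_ *m _).
by apply: IHn => i hi; apply: h.
Qed.

Lemma mprod_add d p q (M : nat -> 'M[K]_d) :
  mprod (p + q) M = mprod p M *m mprod q (fun i => M (p + i)%N).
Proof.
elim: p M => [|p IHp] M; first by rewrite mul1mx.
by rewrite addSn /= IHp mulmxA.
Qed.

Lemma mprod_recr d n (M : nat -> 'M[K]_d) : mprod n.+1 M = mprod n M *m M n.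
Proof. by rewrite -addn1 mprod_add /= mulmx1 addn0. Qed.

(** The transfer matrix principle: an entry of the product sums over all intermediate configurations
    of vertical edges. *)
Lemma mprod_paths C R (F : nat -> {ffun 'I_C -> bool} -> {ffun 'I_C -> bool} -> K)
    (M : nat -> 'M[K]_(spin_dim C)) t0 t1 :
  (forall i t b, (i < R)%N -> M i (enc C (fget t)) (enc C (fget b)) = F i t b) ->
  \sum_(v : {ffun 'I_R.+1 -> {ffun 'I_C -> bool}} | (v ord0 == t0) && (v ord_max == t1))
    \prod_(i < R) F i (v (widen_ord (leqnSn R) i)) (v (lift ord0 i)) =
  mprod R M (enc C (fget t0)) (enc C (fget t1)).
Proof.
elim: R F M t0 => [|R IHR] F M t0 h.
  have -> : ord_max = ord0 :> 'I_1 by apply: val_inj.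
  rewrite /= mxE; have [<-|t01] := eqVneq t0 t1.
    rewrite eqxx (big_pred1 [ffun=> t0]) ?big_ord0 // => v /=.
    rewrite andbb; apply/eqP/eqP => [v0|->]; last by rewrite ffunE.
    by apply/ffunP => i; rewrite ffunE ord1.
  rewrite big_pred0 => [|v].
    case: eqP => // /enc_inj et; case/eqP: t01; apply/ffunP => j.
    by rewrite -!fget_ord et.
  by apply/negP => /andP[/eqP-> /eqP e]; rewrite e eqxx in t01.
rewrite big_mkcond (big_finsert ord0) /= mxE sum_enc.
rewrite (bigD1 t0) //= [X in _ + X]big1 ?addr0 => [|t /negPf tt0]; last first.
  by rewrite big1 // => f _; rewrite finsert_at tt0.
have hR t : M 0%N (enc C (fget t0)) (enc C (fget t)) *
    mprod R (fun i => M i.+1) (enc C (fget t)) (enc C (fget t1)) =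
    \sum_(f : {ffun 'I_R.+1 -> {ffun 'I_C -> bool}}) (if (f ord0 == t) && (f ord_max == t1)
      then F 0%N t0 t * \prod_(i < R) F i.+1 (f (widen_ord (leqnSn R) i)) (f (lift ord0 i))
      else 0).
  rewrite h // -(IHR (fun i => F i.+1)) => [|i t' b' hi]; last exact: h.
  by rewrite big_distrr big_mkcond.
rewrite [RHS](eq_bigr _ (fun t _ => hR t)) exchange_big /=; apply: eq_bigr => f _.
rewrite (bigD1 (f ord0)) //= eqxx [X in _ + X]big1 ?addr0 => [|t /negPf ft]; last first.
  by rewrite eq_sym ft.
have -> : finsert ord0 t0 f ord0 = t0 by rewrite finsert_at.
have e j : finsert ord0 t0 f (lift ord0 j) = f j by rewrite finsert_lift.
have -> : finsert ord0 t0 f ord_max = f ord_max.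
  by rewrite -e; congr (finsert _ _ _ _); apply: val_inj.
rewrite eqxx /=; case: ifP => // _; rewrite big_ord_recl e; congr (_ * _).
  by congr (F _ _ _); rewrite -[RHS](finsert_at ord0 t0 f); congr (finsert _ _ _ _); apply: val_inj.
apply: eq_bigr => i _; rewrite e; congr (F _ _ _).
by rewrite -e; congr (finsert _ _ _ _); apply: val_inj.
Qed.

Lemma upv_mul n q (M : 'M[K]_(spin_dim n, q)) j :
  (upv K n *m M) 0 j = M (enc n (fun=> true)) j.
Proof.
elim: n M => [|n IHn] M; first by rewrite mul1mx.
by rewrite -[M]vsubmxK mul_row_col mul0mx addr0 IHn /= col_mxEu.
Qed.

Lemma mul_dnv n p (M : 'M[K]_(p, spin_dim n)) i :
  (M *m dnv K n) i 0 = M i (enc n (fun=> false)).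
Proof.
elim: n M => [|n IHn] M; first by rewrite mulmx1.
by rewrite -[M]hsubmxK mul_row_col mulmx0 add0r IHn /= row_mxEr.
Qed.

(** Below the centre the lines come in reverse order with opposite right edges, hence the index
    [m - i.+1] and the negation. *)
Lemma nest_mprod p q (U : K -> bool -> 'M[K]_p) (L : K -> bool -> 'M[K]_q) (x : nat -> K) k m
    (M : 'M[K]_(p, q)) :
  nest U L (map x (iota k m)) M =
  \sum_(e : {ffun 'I_m -> bool})
    mprod m (fun i => U (x (k + i)%N) (fget e i)) *m M *m
    mprod m (fun i => L (x (k + (m - i.+1))%N) (~~ fget e (m - i.+1))).
Proof.
elim: m k => [|m IHm] k.
  rewrite (big_pred1 [ffun=> false]) /= ?mul1mx ?mulmx1 // => e.
  by apply/esym/eqP/ffunP => -[].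
have f0 t (f : {ffun 'I_m -> bool}) : fget (finsert ord0 t f) 0 = t.
  by have := fget_ord (finsert ord0 t f) ord0; rewrite finsert_at.
have fS t (f : {ffun 'I_m -> bool}) i : (i < m)%N -> fget (finsert ord0 t f) i.+1 = fget f i.
  move=> im; have := fget_ord (finsert ord0 t f) (lift ord0 (Ordinal im)).
  by rewrite finsert_lift lift0 /= => ->; have := fget_ord f (Ordinal im).
rewrite (big_finsert ord0) big_bool /= /fold_line IHm.
have step t : U (x k) t *m (\sum_(e : {ffun 'I_m -> bool})
      mprod m (fun i => U (x (k.+1 + i)%N) (fget e i)) *m M *m
      mprod m (fun i => L (x (k.+1 + (m - i.+1))%N) (~~ fget e (m - i.+1)))) *m L (x k) (~~ t) =
    \sum_(f : {ffun 'I_m -> bool})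
      mprod m.+1 (fun i => U (x (k + i)%N) (fget (finsert ord0 t f) i)) *m M *m
      mprod m.+1 (fun i => L (x (k + (m.+1 - i.+1))%N) (~~ fget (finsert ord0 t f) (m.+1 - i.+1))).
  rewrite mulmx_sumr mulmx_suml; apply: eq_bigr => f _.
  rewrite [X in _ = _ *m X]mprod_recr subnn f0 /= f0 addn0 !mulmxA; congr (_ *m _ *m _ *m _ *m _).
    by apply: eq_mprod => i im; rewrite addSnnS fS.
  apply: eq_mprod => i im; rewrite subSS addSnnS -subSn // subSS.
  by rewrite -(subnSK im) fS // -subSn // subSS leq_subr.
by rewrite -!step.
Qed.
End OrderedProducts.

Section Transfer.
Variables (K : fieldType) (a : K).

Lemma with_col_entry d (U : K -> bool -> 'M[K]_d) v x r t b i j :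
  with_column a U v x r (if t then lshift d i else rshift d i)
    (if b then lshift d j else rshift d j) =
  \sum_k vweight a (x / v) k r t b * U x k i j.
Proof.
by rewrite big_bool; case: r; rewrite ?(with_colTE, with_colFE);
  case: t; case: b; rewrite ?(block_mxEul, block_mxEur, block_mxEdl, block_mxEdr) !mxE /=
  ?mul0r ?addr0 ?add0r.
Qed.

Lemma row_op_entry (y : nat -> K) n x r t b :
  row_op a y n x r (enc n t) (enc n b) =
  \sum_(h : {ffun 'I_n.+1 -> bool} | h ord0 && (h ord_max == r))
    \prod_(j < n) vweight a (x / y j.+1) (fget h j) (fget h j.+1) (t j) (b j).
Proof.
elim: n r => [|n IHn] r.
  rewrite big_mkcond (big_finsert ord0) big_bool /=.
  have e0 k : \sum_(f : {ffun 'I_0 -> bool}) (if finsert ord0 k f ord0 &&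
      (finsert ord0 k f ord_max == r) then \prod_(j < 0) vweight a (x / y j.+1)
      (fget (finsert ord0 k f) j) (fget (finsert ord0 k f) j.+1) (t j) (b j) else 0) =
      if k && (k == r) then 1 else 0.
    rewrite (big_pred1 [ffun=> false]) => [|f]; last by apply/esym/eqP/ffunP => -[].
    have -> : ord_max = ord0 :> 'I_1 by apply: val_inj.
    by rewrite finsert_at big_ord0.
  by rewrite !e0 addr0 {e0}; case: r; rewrite mxE.
rewrite /= with_col_entry [RHS]big_mkcond (big_finsert ord_max) [RHS]exchange_big /=.
have f0 k (f : {ffun 'I_n.+1 -> bool}) : finsert ord_max k f ord0 = f ord0.
  rewrite -[RHS](finsert_lift ord_max k f); congr (finsert _ _ _ _); apply: val_inj.
  by rewrite /= /bump leqn0.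
under [RHS]eq_bigr => f _.
  rewrite (bigD1 r) //= [X in _ + X]big1 ?addr0 => [|k /negPf kr]; last first.
    by rewrite finsert_at kr andbF.
  rewrite finsert_at eqxx andbT f0 big_ord_recr /= fget_last (fget_belast _ _ (ltnSn n)).
  over.
rewrite /=.
have hk k : vweight a (x / y n.+1) k r (t n) (b n) * row_op a y n x k (enc n t) (enc n b) =
    \sum_(f : {ffun 'I_n.+1 -> bool}) if f ord0 && (f ord_max == k) then
      vweight a (x / y n.+1) k r (t n) (b n) *
      \prod_(j < n) vweight a (x / y j.+1) (fget f j) (fget f j.+1) (t j) (b j) else 0.
  by rewrite IHn big_distrr big_mkcond.
rewrite (eq_bigr _ (fun k _ => hk k)) exchange_big /=; apply: eq_bigr => f _.
rewrite (bigD1 (f ord_max)) //= [X in _ + X]big1 ?addr0 => [|k]; last first.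
  by rewrite eq_sym => /negPf kr; rewrite kr andbF.
rewrite eqxx andbT; case: ifP => // _; rewrite mulrC; congr (_ * _); last first.
  by congr (vweight a _ _ _ _ _); rewrite -fget_ord.
by apply: eq_bigr => j _; rewrite !fget_belast // ltnS // ltnW.
Qed.

Definition rowh R C (h : {ffun 'I_R * 'I_C.+1 -> bool}) (i : 'I_R) : {ffun 'I_C.+1 -> bool} :=
  [ffun j => h (i, j)].
Definition rowv R C (v : {ffun 'I_R.+1 * 'I_C -> bool}) (i : 'I_R.+1) : {ffun 'I_C -> bool} :=
  [ffun j => v (i, j)].

Lemma hget_row R C (h : {ffun 'I_R * 'I_C.+1 -> bool}) (i : 'I_R) j :
  hget h i j = fget (rowh h i) j.
Proof. by rewrite /hget valK /fget; case: insubP => //= j' _ _; rewrite ffunE. Qed.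

Lemma vget_row R C (v : {ffun 'I_R.+1 * 'I_C -> bool}) (i : 'I_R.+1) j :
  vget v i j = fget (rowv v i) j.
Proof. by rewrite /vget valK /fget; case: insubP => //= j' _ _; rewrite ffunE. Qed.

Lemma big_curry (I J T : finType) (V : zmodType) (G : {ffun I -> {ffun J -> T}} -> V) :
  \sum_(h : {ffun I * J -> T}) G [ffun i => [ffun j => h (i, j)]] = \sum_g G g.
Proof.
rewrite [RHS](reindex (fun h : {ffun I * J -> T} => [ffun i => [ffun j => h (i, j)]])) //=.
exists (fun g : {ffun I -> {ffun J -> T}} => [ffun p => g p.1 p.2]) => g _.
  by apply/ffunP => -[i j]; rewrite !ffunE.
by apply/ffunP => i; apply/ffunP => j; rewrite !ffunE.
Qed.

(** The position [lab] is that of the right end of the row, whose direction [e] takes part in the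
    turns; [loc] holds the constraints that concern a single row. *)
Definition row_weight C (present : nat -> bool) (spec : nat -> K)
    (loc : {ffun 'I_C.+1 -> bool} -> {ffun 'I_C -> bool} -> {ffun 'I_C -> bool} -> bool)
    (lab : nat) (e : bool) (t b : {ffun 'I_C -> bool}) : K :=
  \sum_(h : {ffun 'I_C.+1 -> bool} | loc h t b && (fget h lab == e))
    \prod_(j < C | present j)
      vweight a (spec j) (fget h j) (fget h j.+1) (fget t j) (fget b j).

(** Once the directions of the right ends are fixed, the rows interact through vertical edges only,
    and the sum over horizontal edges distributes over the product of the rows. *)
Lemma gridPF_rows R C present spec constr (lab : nat -> nat)
    (loc : nat -> {ffun 'I_C.+1 -> bool} -> {ffun 'I_C -> bool} -> {ffun 'I_C -> bool} -> bool)
    (bd : {ffun 'I_C -> bool} -> {ffun 'I_C -> bool} -> bool) (P : pred {ffun 'I_R -> bool}) :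
  (forall (h : {ffun 'I_R * 'I_C.+1 -> bool}) (v : {ffun 'I_R.+1 * 'I_C -> bool}),
    constr (hget h) (vget v) = [&& bd (rowv v ord0) (rowv v ord_max),
      [forall i : 'I_R, loc i (rowh h i) (rowv v (widen_ord (leqnSn R) i)) (rowv v (lift ord0 i))] &
      P [ffun i => fget (rowh h i) (lab i)]]) ->
  gridPF a R C present spec constr =
  \sum_(e : {ffun 'I_R -> bool} | P e)
    \sum_(v : {ffun 'I_R.+1 -> {ffun 'I_C -> bool}} | bd (v ord0) (v ord_max))
      \prod_(i < R) row_weight (present i) (spec i) (loc i) (lab i) (e i)
        (v (widen_ord (leqnSn R) i)) (v (lift ord0 i)).
Proof.
move=> hc.
pose W (g : {ffun 'I_R -> {ffun 'I_C.+1 -> bool}})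
    (v : {ffun 'I_R.+1 -> {ffun 'I_C -> bool}}) :=
  \prod_(i < R) \prod_(j < C | present i j) vweight a (spec i j) (fget (g i) j)
    (fget (g i) j.+1) (fget (v (widen_ord (leqnSn R) i)) j) (fget (v (lift ord0 i)) j).
pose locs (g : {ffun 'I_R -> {ffun 'I_C.+1 -> bool}})
    (v : {ffun 'I_R.+1 -> {ffun 'I_C -> bool}}) :=
  [forall i : 'I_R, loc i (g i) (v (widen_ord (leqnSn R) i)) (v (lift ord0 i))].
pose labs (g : {ffun 'I_R -> {ffun 'I_C.+1 -> bool}}) := [ffun i : 'I_R => fget (g i) (lab i)].
transitivity (\sum_g \sum_(v : {ffun 'I_R.+1 -> {ffun 'I_C -> bool}})
    if [&& bd (v ord0) (v ord_max), locs g v & P (labs g)] then W g v else 0).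
  rewrite -big_curry; apply: eq_bigr => h _; rewrite -big_curry; apply: eq_bigr => v _.
  have rh i : [ffun i0 => [ffun j => h (i0, j)]] i = rowh h i by rewrite ffunE.
  have rv i : [ffun i0 => [ffun j => v (i0, j)]] i = rowv v i by rewrite ffunE.
  have -> : labs [ffun i => [ffun j => h (i, j)]] = [ffun i => fget (rowh h i) (lab i)].
    by apply/ffunP => i; rewrite ffunE rh [RHS]ffunE.
  rewrite hc !rv /locs /W.
  under [in RHS]eq_forallb => i do rewrite rh !rv.
  case: ifP => // _; apply: eq_bigr => i _; rewrite rh !rv; apply: eq_bigr => j _.
  have hv := vget_row v (widen_ord (leqnSn R) i) j; rewrite /= in hv.
  have hv' := vget_row v (lift ord0 i) j; rewrite lift0 in hv'.
  by rewrite !hget_row hv hv'.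
transitivity (\sum_(e : {ffun 'I_R -> bool} | P e) \sum_(v : {ffun 'I_R.+1 -> {ffun 'I_C -> bool}} |
    bd (v ord0) (v ord_max)) \sum_g if locs g v && (labs g == e) then W g v else 0); last first.
  apply: eq_bigr => e _; apply: eq_bigr => v _.
  rewrite /row_weight bigA_distr_big_dep [RHS]big_mkcond /=; apply: eq_bigr => g _.
  congr (if _ then _ else _); apply/andP/familyP => [[/forallP l /eqP le] i|l].
    by rewrite unfold_in l -le ffunE eqxx.
  split; first by apply/forallP => i; have := l i; rewrite unfold_in => /andP[].
  by apply/eqP/ffunP => i; have := l i; rewrite unfold_in ffunE => /andP[_ /eqP].
transitivity (\sum_g \sum_(e : {ffun 'I_R -> bool} | P e)
    \sum_(v : {ffun 'I_R.+1 -> {ffun 'I_C -> bool}} | bd (v ord0) (v ord_max))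
      if locs g v && (labs g == e) then W g v else 0); last first.
  rewrite exchange_big /=; apply: eq_bigr => e _; exact: exchange_big.
apply: eq_bigr => g _; rewrite exchange_big [RHS]big_mkcond /=; apply: eq_bigr => v _.
case: (bd _ _) => //=; case: (locs g v) => /=; last by rewrite big1.
rewrite big_mkcond (bigD1 (labs g)) //= eqxx [X in _ + X]big1 ?addr0 // => e.
by rewrite eq_sym => /negPf ->; case: ifP.
Qed.
End Transfer.

Section UTurn.
Variables (K : fieldType) (d : nat) (M : nat -> bool -> 'M[K]_d).

(** The first m right ends are free and determine the last m in reverse order. The even model has k
    = 0 free centre rows and the odd one k = 1. *)
Lemma sum_uturn_mprod R m k : R = (m + (k + m))%N ->
  \sum_(e : {ffun 'I_R -> bool} | [forall i : 'I_m, fget e i != fget e (R.-1 - i)])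
    mprod R (fun i => M i (fget e i)) =
  \sum_(e : {ffun 'I_m -> bool}) \sum_(c : {ffun 'I_k -> bool})
    mprod m (fun i => M i (fget e i)) *m mprod k (fun i => M (m + i)%N (fget c i)) *m
    mprod m (fun i => M (m + (k + i))%N (~~ fget e (m - i.+1))).
Proof.
move=> ->; pose h (p : {ffun 'I_m -> bool} * {ffun 'I_k -> bool}) :=
  [ffun i : 'I_(m + (k + m)) => if (i < m)%N then fget p.1 i else
    if (i < m + k)%N then fget p.2 (i - m) else ~~ fget p.1 ((m + (k + m)).-1 - i)].
pose h' (e : {ffun 'I_(m + (k + m)) -> bool}) :=
  ([ffun i : 'I_m => fget e i], [ffun i : 'I_k => fget e (m + i)]).
have fgetE n (f : nat -> bool) i : (i < n)%N -> fget [ffun i : 'I_n => f i] i = f i.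
  by move=> hi; rewrite -[i in LHS]/(nat_of_ord (Ordinal hi)) fget_ord ffunE.
have h1 p i : (i < m)%N -> fget (h p) i = fget p.1 i.
  move=> hi; have hi' : (i < m + (k + m))%N by rewrite ltn_addr.
  by rewrite -[i in LHS]/(nat_of_ord (Ordinal hi')) fget_ord ffunE /= hi.
have h2 p i : (i < k)%N -> fget (h p) (m + i) = fget p.2 i.
  move=> hi; have hi' : (m + i < m + (k + m))%N by rewrite ltn_add2l ltn_addr.
  rewrite -[(m + i)%N in LHS]/(nat_of_ord (Ordinal hi')) fget_ord ffunE /=.
  by rewrite ltnNge leq_addr /= ltn_add2l hi addKn.
have h3 p i : (i < m)%N -> fget (h p) (m + (k + i)) = ~~ fget p.1 (m - i.+1).
  move=> hi; have hi' : (m + (k + i) < m + (k + m))%N by rewrite !ltn_add2l.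
  rewrite -[(m + (k + i))%N in LHS]/(nat_of_ord (Ordinal hi')) fget_ord ffunE /=.
  rewrite ltnNge leq_addr /= ltn_add2l ltnNge leq_addr /=.
  by congr (~~ fget _ _); move: hi; clear; lia.
have h'1 e i : (i < m)%N -> fget (h' e).1 i = fget e i by exact: (fgetE _ (fget e)).
have h'2 e i : (i < k)%N -> fget (h' e).2 i = fget e (m + i).
  exact: (fgetE _ (fun j => fget e (m + j))).
rewrite (reindex_onto h h') /=; last first.
  move=> e /forallP pe; apply/ffunP => i; rewrite ffunE.
  case: ltnP => im; first by rewrite h'1 // fget_ord.
  case: ltnP => ik.
    by rewrite h'2 ?subnKC ?fget_ord // -(ltn_add2l m) subnKC.
  have hi : ((m + (k + m)).-1 - i < m)%N by move: (ltn_ord i) ik; clear; lia.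
  have := pe (Ordinal hi); rewrite h'1 //= subKn.
    by rewrite fget_ord; case: (fget _ _); case: (e i).
  by move: (ltn_ord i); clear; lia.
have hh p : [forall i : 'I_m, fget (h p) i != fget (h p) ((m + (k + m)).-1 - i)] && (h' (h p) == p).
  apply/andP; split.
    apply/forallP => i; rewrite h1 //.
    have -> : ((m + (k + m)).-1 - i = m + (k + (m - i.+1)))%N.
      by move: (ltn_ord i); clear; lia.
    rewrite h3; last by move: (ltn_ord i); clear; lia.
    have -> : (m - (m - i.+1).+1 = i)%N by move: (ltn_ord i); clear; lia.
    by case: (fget _ _).
  apply/eqP; case: p => p1 p2; congr pair; apply/ffunP => i; rewrite ffunE.
    by rewrite h1 // fget_ord.
  by rewrite h2 // fget_ord.
rewrite (eq_bigl xpredT) => [|p]; last exact: hh.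
rewrite pair_big /=; apply: eq_bigr => -[p1 p2] _ /=.
rewrite !mprod_add mulmxA; congr (_ *m _ *m _); apply: eq_mprod => i hi.
- by rewrite h1.
- by rewrite h2.
- by rewrite h3.
Qed.
End UTurn.

(** * The three partition functions as matrix elements *)

Section Bridge.
Variables (K : numFieldType) (a : K).
Notation row_op := (row_op a).
Implicit Types (x y : nat -> K).

Lemma gridPF_mprod R C present spec constr (lab : nat -> nat)
    (loc : nat -> {ffun 'I_C.+1 -> bool} -> {ffun 'I_C -> bool} -> {ffun 'I_C -> bool} -> bool)
    (t0 t1 : {ffun 'I_C -> bool}) (P : pred {ffun 'I_R -> bool})
    (M : nat -> bool -> 'M[K]_(spin_dim C)) :
  (forall (h : {ffun 'I_R * 'I_C.+1 -> bool}) (v : {ffun 'I_R.+1 * 'I_C -> bool}),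
    constr (hget h) (vget v) = [&& (rowv v ord0 == t0) && (rowv v ord_max == t1),
      [forall i : 'I_R, loc i (rowh h i) (rowv v (widen_ord (leqnSn R) i)) (rowv v (lift ord0 i))] &
      P [ffun i => fget (rowh h i) (lab i)]]) ->
  (forall i e (t b : {ffun 'I_C -> bool}), (i < R)%N -> M i e (enc C (fget t)) (enc C (fget b)) =
    row_weight a (present i) (spec i) (loc i) (lab i) e t b) ->
  gridPF a R C present spec constr =
  (\sum_(e : {ffun 'I_R -> bool} | P e) mprod R (fun i => M i (fget e i)))
    (enc C (fget t0)) (enc C (fget t1)).
Proof.
move=> hc hM.
rewrite (gridPF_rows a present spec (lab := lab) (loc := loc)
  (bd := fun u w => (u == t0) && (w == t1)) (P := P) hc).
rewrite summxE; apply: eq_bigr => e _.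
rewrite -(mprod_paths _ _ (fun i t b hi => hM i (fget e i) t b hi)).
by apply: eq_bigr => v _; apply: eq_bigr => i _; rewrite fget_ord.
Qed.

Lemma foldr_mprod C x y k m (w : 'cV[K]_(spin_dim C)) :
  foldr (fun z w => row_op y C z false *m w) w (map x (iota k m)) =
  mprod m (fun i => row_op y C (x (k + i)%N) false) *m w.
Proof.
elim: m k => [|m IHm] k /=; first by rewrite mul1mx.
rewrite IHm addn0 mulmxA; congr (_ *m _ *m _); apply: eq_mprod => i _.
by rewrite addSnnS.
Qed.

Definition all_up n : {ffun 'I_n -> bool} := [ffun=> true].
Definition all_dn n : {ffun 'I_n -> bool} := [ffun=> false].

Lemma enc_up n : enc n (fget (all_up n)) = enc n (fun=> true).
Proof.
by apply: eq_enc => j hj; rewrite -[j]/(nat_of_ord (Ordinal hj)) fget_ord ffunE.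
Qed.

Lemma enc_dn n : enc n (fget (all_dn n)) = enc n (fun=> false).
Proof.
by apply: eq_enc => j hj; rewrite -[j]/(nat_of_ord (Ordinal hj)) fget_ord ffunE.
Qed.

Lemma upMdn n (M : 'M[K]_(spin_dim n)) :
  M (enc n (fget (all_up n))) (enc n (fget (all_dn n))) = (upv K n *m M *m dnv K n) 0 0.
Proof. by rewrite mul_dnv upv_mul enc_up enc_dn. Qed.

Lemma rowv_eq_up R C (v : {ffun 'I_R.+1 * 'I_C -> bool}) i :
  (rowv v i == all_up C) = [forall j : 'I_C, vget v i j].
Proof.
apply/eqP/forallP => [e j|e]; first by rewrite vget_row e fget_ord ffunE.
by apply/ffunP => j; have := e j; rewrite vget_row fget_ord [in RHS]ffunE.
Qed.

Lemma rowv_eq_dn R C (v : {ffun 'I_R.+1 * 'I_C -> bool}) i :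
  (rowv v i == all_dn C) = [forall j : 'I_C, ~~ vget v i j].
Proof.
apply/eqP/forallP => [e j|e]; first by rewrite vget_row e fget_ord ffunE.
by apply/ffunP => j; have := e j; rewrite vget_row fget_ord [in RHS]ffunE => /negPf.
Qed.

Lemma forallb_and (T : finType) (P Q : pred T) :
  [forall i, P i && Q i] = [forall i, P i] && [forall i, Q i].
Proof.
apply/forallP/andP => [h|[/forallP hP /forallP hQ] i]; last by rewrite hP hQ.
by split; apply/forallP => i; have /andP[] := h i.
Qed.

Lemma hget0 R C (h : {ffun 'I_R * 'I_C.+1 -> bool}) (i : 'I_R) :
  hget h i 0 = rowh h i ord0.
Proof. by rewrite hget_row -fget_ord. Qed.

Lemma row_op_weight y n (spec : nat -> K) z e (t b : {ffun 'I_n -> bool}) :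
  (forall j, spec j = z / y j.+1) ->
  row_op y n z e (enc n (fget t)) (enc n (fget b)) =
  row_weight a (fun=> true) spec (fun h _ _ => h ord0) n e t b.
Proof.
move=> hs; rewrite row_op_entry /row_weight; apply: eq_big => [h|h _].
  by rewrite -(fget_ord h ord_max).
by apply: eq_bigr => j _; rewrite hs.
Qed.

Lemma Zdw_mx n x y : Zdw a n x y = dwmx a n x y.
Proof.
rewrite /Zdw (gridPF_mprod (lab := fun=> n) (loc := fun i h t b => h ord0)
  (t0 := all_up n) (t1 := all_dn n) (P := fun e => [forall i, ~~ e i])
  (M := fun i e => row_op y n (x i.+1) e)).
- rewrite (big_pred1 [ffun=> false]) => [|e]; last first.
    apply/forallP/eqP => [h|-> i]; last by rewrite ffunE.
    by apply/ffunP => i; rewrite ffunE; apply/negbTE.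
  rewrite upMdn /dwmx /dwpf foldr_mprod mulmxA.
  congr ((_ *m _ *m _) _ _); apply: eq_mprod => i hi; rewrite add1n.
  by rewrite -[i in fget _ i]/(nat_of_ord (Ordinal hi)) fget_ord ffunE.
- move=> h v; rewrite rowv_eq_up rowv_eq_dn !forallb_and andbC; congr (_ && (_ && _)).
    by apply: eq_forallb => i; rewrite hget0.
  by apply: eq_forallb => i; rewrite ffunE hget_row.
- by move=> i e t b hi; apply: row_op_weight.
Qed.

Lemma fget_labels R C (h : {ffun 'I_R * 'I_C.+1 -> bool}) (lab : nat -> nat) j : (j < R)%N ->
  fget [ffun i : 'I_R => fget (rowh h i) (lab i)] j = hget h j (lab j).
Proof.
move=> hj; have := fget_ord [ffun i : 'I_R => fget (rowh h i) (lab i)] (Ordinal hj).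
by rewrite ffunE -hget_row.
Qed.

Lemma ZHTeven_mx m x y : ZHTeven a m x y = evmx a m x y.
Proof.
rewrite /ZHTeven (gridPF_mprod (lab := fun=> m) (loc := fun i h t b => h ord0)
  (t0 := all_up m) (t1 := all_dn m)
  (P := fun e => [forall i : 'I_m, fget e i != fget e ((m.*2).-1 - i)])
  (M := fun i e => row_op y m (x (minn i.+1 (m.*2 - i))) e)).
- rewrite (@sum_uturn_mprod _ _ (fun i e => row_op y m (x (minn i.+1 (m.*2 - i))) e) m.*2 m 0);
    last by rewrite add0n addnn.
  rewrite upMdn /evmx /evpf nest_mprod; congr ((_ *m _ *m _) _ _).
  apply: eq_bigr => e _; rewrite (big_pred1 [ffun=> false]) => [|c]; last first.
    by apply/esym/eqP/ffunP => -[].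
  congr (_ *m _ *m _); apply: eq_mprod => i hi; congr (row_op y m (x _) _).
    by move: hi; clear; lia.
  by move: hi; clear; lia.
- move=> h v; rewrite rowv_eq_up rowv_eq_dn !forallb_and.
  rewrite [X in X && _]andbC -andbA; congr (_ && (_ && _)).
    by apply: eq_forallb => i; rewrite hget0.
  apply: eq_forallb => i; have hi := ltn_ord i.
  rewrite !(fget_labels h (fun=> m)) //; move: hi; clear; lia.
- by move=> i e t b hi; apply: row_op_weight.
Qed.

(* The constraints of [ZHTodd] that involve only the row [i]. *)
Definition odd_loc m i (h : {ffun 'I_m.+2 -> bool}) (t b : {ffun 'I_m.+1 -> bool}) :=
  [&& h ord0, (i <= m)%N ==> ~~ h ord_max && ~~ t ord_max &
      (i == m) ==> (fget h m != b ord_max)].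

(** In these rows the last horizontal position is a dummy fixed to [false], so only the edges of a
    row with m columns are summed over. *)
Lemma odd_upper_weight m i y (present : nat -> bool) (spec : nat -> K) z e
    (t b : {ffun 'I_m.+1 -> bool}) :
  (i <= m)%N -> (forall j, (j <= m)%N -> present j = (j < m)%N) ->
  (forall j, spec j = z / y j.+1) ->
  row_weight a present spec (odd_loc i) m e t b =
  if ~~ t ord_max && ((i == m) ==> (e != b ord_max)) then
    row_op y m z e (enc m (fget t)) (enc m (fget b)) else 0.
Proof.
move=> im hp hs; rewrite /row_weight big_mkcond (big_finsert ord_max) big_bool /=.
rewrite big1 ?add0r => [|f _]; last by rewrite /odd_loc finsert_at im /= !andbF.
rewrite row_op_entry [in RHS]big_mkcond.
have f0 (f : {ffun 'I_m.+1 -> bool}) : finsert ord_max false f ord0 = f ord0.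
  rewrite -[RHS](finsert_lift ord_max false f); congr (finsert _ _ _ _); apply: val_inj.
  by rewrite /= /bump leqn0.
have -> : (if ~~ t ord_max && ((i == m) ==> (e != b ord_max)) then
      \sum_(h : {ffun 'I_m.+1 -> bool}) (if h ord0 && (h ord_max == e) then
        \prod_(j < m) vweight a (z / y j.+1) (fget h j) (fget h j.+1) (fget t j) (fget b j)
        else 0) else 0) =
    \sum_(h : {ffun 'I_m.+1 -> bool}) (if [&& ~~ t ord_max, (i == m) ==> (e != b ord_max),
        h ord0 & h ord_max == e] then
        \prod_(j < m) vweight a (z / y j.+1) (fget h j) (fget h j.+1) (fget t j) (fget b j)
        else 0).
  case: (~~ _) => /=; last by rewrite big1.
  by case: (_ ==> _) => //=; rewrite big1.
apply: eq_bigr => f _; rewrite /odd_loc finsert_at f0 im /= (fget_belast _ _ (ltnSn m)).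
rewrite -[f ord_max]fget_ord /=.
have -> : [&& f ord0, ~~ t ord_max & (i == m) ==> (fget f m != b ord_max)] && (fget f m == e) =
    [&& ~~ t ord_max, (i == m) ==> (e != b ord_max), f ord0 & fget f m == e].
  by case: (fget f m =P e) => [->|]; rewrite ?andbT ?andbF //;
    case: (f ord0); rewrite ?andbT ?andbF.
case: ifP => // _; rewrite big_mkcond big_ord_recr /= hp // ltnn mulr1.
apply: eq_bigr => j _; rewrite hp ?ltn_ord // 1?ltnW //.
by rewrite hs !fget_belast // ltnS // ltnW.
Qed.

(* Rows above the middle have no vertex in the last column: the edge above it is forced
   down, while the edge below it is left free, being forced by the next row; the middle
   row turns its right edge [e] into the edge below the last column. *)
Definition odd_row m x y i e : 'M[K]_(spin_dim m.+1) :=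
  if (i < m)%N then
    block_mx 0 0 (row_op y m (x i.+1) e) (row_op y m (x i.+1) e)
  else if i == m then
    block_mx 0 0 (if e then 0 else row_op y m (x m.+1) false)
                 (if e then row_op y m (x m.+1) true else 0)
  else row_op y m.+1 (x (m.*2.+1 - i)%N) e.

Lemma odd_row_weight m x y i e (t b : {ffun 'I_m.+1 -> bool}) : (i < m.*2.+1)%N ->
  odd_row m x y i e (enc m.+1 (fget t)) (enc m.+1 (fget b)) =
  row_weight a (fun j => (j < m) || (m.+1 <= i))%N
    (fun j => x (minn i.+1 (m.*2.+1 - i)) / y j.+1)
    (odd_loc i) (if (i <= m)%N then m else m.+1) e t b.
Proof.
move=> hi; have [im|im] := leqP i m; last first.
  rewrite /odd_row ltnNge (ltnW im) /= gtn_eqF //.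
  rewrite (@row_op_weight y m.+1 (fun j => x (minn i.+1 (m.*2.+1 - i)) / y j.+1)).
    rewrite /row_weight; apply: eq_big => [h|h _]; last by apply: eq_bigl => j; rewrite orbT.
    by rewrite /odd_loc leqNgt im (gtn_eqF im) /= andbT.
  by move=> j; congr (x _ / _); move: hi im; clear; lia.
rewrite (@odd_upper_weight _ _ y _ _ (x i.+1)) //; last 2 first.
- by move=> j _; rewrite orbF.
- by move=> j; congr (x _ / _); move: im; clear; lia.
have tm : fget t m = t ord_max by rewrite -fget_ord.
have bm : fget b m = b ord_max by rewrite -fget_ord.
rewrite /odd_row /= tm bm; move: im; rewrite leq_eqVlt => /orP[/eqP->|im].
  rewrite ltnn eqxx /=; case: (t ord_max); case: (b ord_max); case: e => /=;
  by rewrite ?(block_mxEul, block_mxEur, block_mxEdl, block_mxEdr) ?mxE.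
rewrite im (ltn_eqF im) /= andbT; case: (t ord_max); case: (b ord_max) => /=;
by rewrite ?(block_mxEul, block_mxEur, block_mxEdl, block_mxEdr) ?mxE.
Qed.

(** The top position of the last column carries no edge and is [false] by convention. *)
Definition odd_top m : {ffun 'I_m.+1 -> bool} := [ffun j : 'I_m.+1 => (j < m)%N].

Lemma odd_constraints m (h : {ffun 'I_m.*2.+1 * 'I_m.+2 -> bool})
    (v : {ffun 'I_m.*2.+2 * 'I_m.+1 -> bool}) :
  [forall i : 'I_m.*2.+1, hget h i 0] && [forall j : 'I_m, vget v 0 j] &&
  [forall j : 'I_m.+1, ~~ vget v m.*2.+1 j] && [forall i : 'I_m.+1, ~~ hget h i m.+1] &&
  [forall i : 'I_m.+1, ~~ vget v i m] && (hget h m m != vget v m.+1 m) &&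
  [forall i : 'I_m, hget h i m != hget h (m.*2 - i)%N m.+1] =
  [&& (rowv v ord0 == odd_top m) && (rowv v ord_max == all_dn m.+1),
    [forall i : 'I_m.*2.+1, odd_loc i (rowh h i) (rowv v (widen_ord (leqnSn _) i))
       (rowv v (lift ord0 i))] &
    [forall i : 'I_m,
      fget [ffun i : 'I_m.*2.+1 => fget (rowh h i) (if (i <= m)%N then m else m.+1)] i !=
      fget [ffun i : 'I_m.*2.+1 => fget (rowh h i) (if (i <= m)%N then m else m.+1)]
        ((m.*2.+1).-1 - i)]].
Proof.
have -> : [forall i : 'I_m,
      fget [ffun i : 'I_m.*2.+1 => fget (rowh h i) (if (i <= m)%N then m else m.+1)] i !=
      fget [ffun i : 'I_m.*2.+1 => fget (rowh h i) (if (i <= m)%N then m else m.+1)]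
        ((m.*2.+1).-1 - i)] = [forall i : 'I_m, hget h i m != hget h (m.*2 - i)%N m.+1].
  apply: eq_forallb => i; have hi := ltn_ord i.
  rewrite !(fget_labels h (fun i => if (i <= m)%N then m else m.+1)) /=; last 2 first.
  - by move: hi; clear; lia.
  - by move: hi; clear; lia.
  rewrite (ltnW hi) leqNgt; have -> : (m < m.*2 - i)%N by move: hi; clear; lia.
  by [].
rewrite rowv_eq_dn !andbA; congr (_ && _).
have vw (i : 'I_m.*2.+1) j : fget (rowv v (widen_ord (leqnSn _) i)) j = vget v i j.
  by rewrite -vget_row.
have vl (i : 'I_m.*2.+1) j : fget (rowv v (lift ord0 i)) j = vget v i.+1 j.
  by rewrite -vget_row lift0.
have hmax (i : 'I_m.*2.+1) : rowh h i ord_max = hget h i m.+1 by rewrite hget_row -fget_ord.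
have mR : (m < m.*2.+1)%N by rewrite ltnS -addnn leq_addr.
apply/idP/idP.
  move=> /andP[/andP[/andP[/andP[/andP[/forallP A0 /forallP A1] A2] /forallP A3] /forallP A4] A5].
  rewrite A2 andbT; apply/andP; split.
    apply/eqP/ffunP => j; rewrite -[LHS]fget_ord -vget_row ffunE.
    case: ltnP => jm; first by rewrite (A1 (Ordinal jm)).
    have -> : nat_of_ord j = m by apply/eqP; rewrite eqn_leq jm -ltnS ltn_ord.
    exact/negbTE/(A4 ord0).
  apply/forallP => i; rewrite /odd_loc -hget0 A0 hmax /=; apply/andP; split.
    apply/implyP => im; have im' : (i < m.+1)%N by [].
    by rewrite (A3 (Ordinal im')) -[X in ~~ X]fget_ord vw (A4 (Ordinal im')).
  apply/implyP => /eqP im.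
  by rewrite -hget_row -[X in _ != X]fget_ord vl im.
move=> /andP[/andP[/eqP B0 ->] /forallP B].
have Bi i (hi : (i <= m)%N) : ~~ hget h i m.+1 && ~~ vget v i m.
  have hi' : (i < m.*2.+1)%N by apply: leq_ltn_trans mR.
  have := B (Ordinal hi'); rewrite /odd_loc hmax /= hi => /and3P[_ + _].
  by rewrite -[X in _ && ~~ X -> _]fget_ord vw.
rewrite !andbT; do ![apply/andP; split].
- by apply/forallP => i; have := B i; rewrite hget0 => /andP[].
- apply/forallP => j; have jm : (j < m.+1)%N by rewrite ltnS ltnW.
  have := congr1 (fun f : {ffun _ -> _} => f (Ordinal jm)) B0.
  by rewrite -[LHS]fget_ord -vget_row ffunE /= ltn_ord => ->.
- by apply/forallP => i; have /andP[] := Bi i (ltn_ord i).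
- by apply/forallP => i; have /andP[] := Bi i (ltn_ord i).
- have := B (Ordinal mR); rewrite /odd_loc eqxx -hget_row /= => /and3P[_ _].
  by rewrite -[X in _ != X -> _]fget_ord vl.
Qed.

(** Each block matrix forces the dummy edge above it down, so the component [z] dies and the last
    column matters only in the final factor. *)
Lemma odd_upper_product m (A : nat -> 'M[K]_(spin_dim m)) (X Y : 'M[K]_(spin_dim m)) n z w :
  (row_mx z w : 'rV_(spin_dim m.+1)) *m mprod n (fun i => block_mx 0 0 (A i) (A i)) *m
    block_mx 0 0 X Y = w *m mprod n A *m row_mx X Y.
Proof.
elim: n z w A => [|n IHn] z w A /=.
  by rewrite !mulmx1 mul_row_block !mulmx0 !add0r mul_mx_row.
by rewrite !mulmxA mul_row_block !mulmx0 !add0r IHn.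
Qed.

Lemma ZHTodd_mx m x y : ZHTodd a m x y = odmx a m x y.
Proof.
rewrite /ZHTodd (gridPF_mprod (lab := fun i => if (i <= m)%N then m else m.+1)
  (loc := @odd_loc m) (t0 := odd_top m) (t1 := all_dn m.+1)
  (P := fun e => [forall i : 'I_m, fget e i != fget e ((m.*2.+1).-1 - i)])
  (M := odd_row m x y)); last 2 first.
- by move=> h v; rewrite -odd_constraints.
- by move=> i e t b hi; apply: odd_row_weight.
rewrite (@sum_uturn_mprod _ _ (odd_row m x y) m.*2.+1 m 1); last by rewrite add1n addnS addnn.
have etop : enc m.+1 (fget (odd_top m)) = rshift (spin_dim m) (enc m (fun=> true)).
  have := fget_ord (odd_top m) ord_max; rewrite ffunE ltnn /= => ->; congr rshift.
  apply: eq_enc => j hj; have hj' : (j < m.+1)%N by apply: ltnW.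
  by rewrite -[j in LHS]/(nat_of_ord (Ordinal hj')) fget_ord ffunE.
have entry (M : 'M[K]_(spin_dim m.+1)) :
    M (enc m.+1 (fget (odd_top m))) (enc m.+1 (fget (all_dn m.+1))) =
    ((row_mx 0 (upv K m) : 'rV_(spin_dim m.+1)) *m M *m dnv K m.+1) 0 0.
  rewrite mul_dnv etop enc_dn -[M in RHS]vsubmxK mul_row_col mul0mx add0r upv_mul.
  by rewrite -[M in LHS]vsubmxK col_mxEd.
rewrite entry /odmx /odpf nest_mprod; congr (fun_of_matrix (_ *m _) _ _).
rewrite !mulmx_sumr; apply: eq_bigr => e _.
rewrite (big_finsert ord0) big_bool /=.
have one k (f : {ffun 'I_0 -> bool}) : fget (finsert ord0 k f) 0 = k.
  by have := fget_ord (finsert ord0 k f) ord0; rewrite finsert_at.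
rewrite !(big_pred1 [ffun=> false]) => [|f|f]; try by apply/esym/eqP/ffunP => -[].
rewrite !one !mulmx1 addn0.
have -> : mprod m (fun i => odd_row m x y (m + (1 + i)) (~~ fget e (m - i.+1))) =
    mprod m (fun i => with_column a (row_op y m) (y m.+1) (x (1 + (m - i.+1))%N)
                        (~~ fget e (m - i.+1))).
  apply: eq_mprod => i hi; rewrite /odd_row ltnNge leq_addr /= gtn_eqF; last first.
    by rewrite -[X in (X < _)%N]addn0 ltn_add2l.
  by congr (with_column a _ _ (x _) _); move: hi; clear; lia.
have -> : mprod m (fun i => odd_row m x y i (fget e i)) =
    mprod m (fun i => block_mx 0 0 (row_op y m (x (1 + i)%N) (fget e i))
                        (row_op y m (x (1 + i)%N) (fget e i))).
  by apply: eq_mprod => i hi; rewrite /odd_row hi.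
(* The two directions of the right end of the centre row fill the two blocks of [row_mx]; pointing
   right means entering the last column downwards, the second block. *)
rewrite /odd_row ltnn eqxx /= mulmxDr !mulmxA !odd_upper_product -mulmxDl -mulmxDr.
by rewrite add_row_mx addr0 add0r.
Qed.
End Bridge.

(** * Nondegeneracy, and the identity in quotient form *)

Lemma row_op_false_degenerate (K : fieldType) (a : K) (y : nat -> K) n x :
  sigma (a ^+ 2) = 0 -> row_op a y n x false = 0.
Proof.
move=> s0; elim: n => //= n IHn.
by rewrite with_colFE IHn s0 scale0r !scaler0 block_mx0.
Qed.

(** In a domain-wall state every row reverses its direction and so contains a corner, of weight
    sigma(a^2). This is how a^4 = 1 gets excluded. *)
Lemma sigma_sqr_neq0 (K : numFieldType) (a : K) n x y :
  Zdw a n.+1 x y != 0 -> sigma (a ^+ 2) != 0.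
Proof.
apply: contraNneq => s0; rewrite Zdw_mx /dwmx /dwpf /=.
by rewrite with_colFE (row_op_false_degenerate _ _ _ s0) s0 scale0r !scaler0 block_mx0
  mul0mx mulmx0 mxE.
Qed.

Theorem theorem1 (C : numClosedFieldType) (a : C) (m : nat) (x y : nat -> C) :
  a != 0 -> sigma a != 0 ->
  (forall i : nat, (1 <= i <= m.+1)%N -> x i != 0) ->
  (forall j : nat, (1 <= j <= m.+1)%N -> y j != 0) ->
  a * x m.+1 + y m.+1 != 0 -> a * y m.+1 + x m.+1 != 0 ->
  Zdw a m x y != 0 -> Zdw a m.+1 x y != 0 ->
  ZHTodd a m x y =
    a * x m.+1 * y m.+1 /
      (sigma a * (a * x m.+1 + y m.+1) * (a * y m.+1 + x m.+1)) *
    (Zdw a m.+1 x y * ZHT2 a m x y + Zdw a m x y * ZHT2 a m.+1 x y).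
Proof.
move=> a0 sa0 x0 y0 d1 d2 Z0 Z1.
have a4 : a ^+ 4 != 1.
  apply: contraNneq (sigma_sqr_neq0 Z1) => a4; rewrite /sigma subr_eq0; apply/eqP.
  by apply: (mulfI (expf_neq0 2 a0)); rewrite mulfV ?expf_neq0 // -exprD a4.
have := defect_eq0 a0 a4 x0 y0; rewrite /defect -!Zdw_mx -!ZHTeven_mx -ZHTodd_mx.
move/eqP; rewrite subr_eq0 => /eqP e; rewrite /ZHT2.
set c := sigma a * (a * x m.+1 + y m.+1) * (a * y m.+1 + x m.+1).
have c0 : c != 0 by rewrite !mulf_neq0.
apply: (mulfI (mulf_neq0 (mulf_neq0 c0 Z0) Z1)).
transitivity (c * ZHTodd a m x y * Zdw a m x y * Zdw a m.+1 x y); first by ring.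
by rewrite /c e -/c; field; rewrite Z0 Z1 c0.
Qed.
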